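(* Let $\phi : M^{m}_{s} \rightarrow \mathbb{H}^{n}_{p}(-1)$ be a full totally umbilical isometric immersion, let $\bar{g}$ be the metric of $\mathbb{H}^{n}_{p}(-1)$, and let $H$ be the mean curvature vector field of $\phi$. Then, up to isometry, the image of $\phi$ is congruent to an open portion of (the image of) one of the following: (1) $\mathbb{H}^{m}_{s}(-1) \rightarrow \mathbb{H}^{m+1}_{s}(-1) \subset \mathbb{H}^{n}_{p}(-1)$; $x \mapsto (x,0)$ (totally geodesic, $H=0$); (2) $\mathbb{H}^{m}_{s}(-1) \rightarrow \mathbb{H}^{m+1}_{s+1}(-1) \subset \mathbb{H}^{n}_{p}(-1)$; $x \mapsto (0,x)$ (totally geodesic, $H=0$); (3) $\mathbb{H}^{m}_{s}(-r^2) \rightarrow \mathbb{H}^{m+1}_{s+1}(-1) \subset \mathbb{H}^{n}_{p}(-1)$; $x \mapsto (\sqrt{1-r^2}, x)$ ($0<r<1$, $\bar{g}(H,H) < 0$); (4) $\mathbb{H}^{m}_{s}(-r^2) \rightarrow \mathbb{H}^{m+1}_{s}(-1) \subset \mathbb{H}^{n}_{p}(-1)$; $x \mapsto (x, \sqrt{r^2-1})$ ($r>1$, $0 < \bar{g}(H,H) < 1$); (5) $\mathbb{H}^{m}_{s}(-1) \rightarrow \mathbb{H}^{m+2}_{s+1}(-1) \subset \mathbb{H}^{n}_{p}(-1)$; $x \mapsto (1,x,1)$ ($H \neq 0$, $\bar{g}(H,H) = 0$); (6) $\mathbb{S}^{m}_{s}(r^2) \rightarrow \mathbb{H}^{m+1}_{s}(-1)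 \subset \mathbb{H}^{n}_{p}(-1)$; $x \mapsto (\sqrt{1+r^2}, x)$ ($r>0$, $\bar{g}(H,H) > 1$); (7) $\mathbb{E}^{m}_{s} \rightarrow \mathbb{H}^{m+1}_{s}(-1) \subset \mathbb{H}^{n}_{p}(-1)$; $x \mapsto \left(\langle x, x \rangle_{s}+\frac{5}{4},\,x,\,\langle x, x \rangle_{s}+\frac{3}{4}\right)$ ($\bar{g}(H,H) = 1$). Moreover, when $M^{m}_{s}$ is geodesically complete, the image of $\phi$ globally coincides with (the image of) one of the maps (1)--(7).
   Context: $m,n$ are positive integers. $L^m_s$ denotes an $m$-dimensional pseudo-Riemannian manifold of index $s$. $\mathbb{E}^{n}_{p}$ is $\mathbb{R}^n$ with the metric $\langle\cdot,\cdot\rangle_p=-\sum_{i=1}^{p}dx_i^2+\sum_{j=p+1}^{n}dx_j^2$ (the first $p$ coordinates are the negative ones). For $r>0$, $$\mathbb{S}^{n}_{p}(r^2)=\{x\in\mathbb{E}^{n+1}_{p}\mid\langle x,x\rangle_p=r^2\},\qquad \mathbb{H}^{n}_{p}(-r^2)=\{x\in\mathbb{E}^{n+1}_{p+1}\mid\langle x,x\rangle_{p+1}=-r^2\},$$ with the induced metrics (pseudo-sphere and pseudo-hyperbolic space of index $p$). The standard hyperbolic space is $\mathbb{H}^n_0(-1)\cap\{x_1>0\}$. In the listed maps, the components are written in the coordinates of the pseudo-Euclidean space containing the target, and the inclusions $\mathbb{H}^{k}_{q}(-1)\subset\mathbb{H}^{n}_{p}(-1)$ are the totally geodesic pseudo-hyperbolic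 subspaces $\{(x_1,\dots,x_{q+1},0,\dots,0,x_{q+2},\dots,x_{k+1})\in\mathbb{H}^n_p(-1)\}\cong\mathbb{H}^k_q(-1)$. For an isometric immersion $\phi:(M,g)\to(\bar M,\bar g)$ of pseudo-Riemannian manifolds with second fundamental form $h$ and mean curvature vector field $H$: $\phi$ is totally geodesic if $h=0$, and totally umbilical if $h(X,Y)=g(X,Y)H$ for all $X,Y\in\Gamma(TM)$. An isometric immersion $\phi:M^m_s\to\mathbb{H}^n_p(-1)$ is full if $\phi(M)$ is not contained in any non-degenerate totally geodesic hypersurface of $\mathbb{H}^n_p(-1)$. Congruent means equal up to composition with an isometry of the ambient space.
   Formalization: Assumes m ≥ 2 (for m = 1 every non-null curve is totally umbilical) and m < n (for m = n the identity is a counterexample); for complete M the image is a connected component of the model, i.e. one sheet when the model is a two-sheeted quadric such as H^m_0(-r^2). *)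

(* Defs.v *)
(* MathComp / MathComp-Analysis. *)
From HB Require Import structures.
From mathcomp Require Import all_boot all_order all_algebra.
From mathcomp Require Import all_classical all_reals all_analysis.

Set Implicit Arguments.
Unset Strict Implicit.
Unset Printing Implicit Defensive.

Import Order.TTheory GRing.Theory Num.Theory.
Import numFieldNormedType.Exports.

Local Open Scope classical_set_scope.
Local Open Scope ring_scope.

Section calculus.
Variable R : realType.

(* [C^k] on [U]; intended for [U] open and [V] finite-dimensional. *)
Fixpoint Ck_on (V W : normedModType R) (k : nat) (U : set V) (f : V -> W)
    : Prop :=
  if k is k'.+1 then
    (forall x, U x -> differentiable f x) /\
    (forall v : V, Ck_on k' U (fun x => 'D_v f x))
  else forall x, U x -> {for x, continuous f}.

Definition smooth_on (V W : normedModType R) (U : set V) (f : V -> W) : Prop :=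
  forall k, Ck_on k U f.

Definition ebase m (a : 'I_m) : 'rV[R]_m := delta_mx 0 a.

(* [partial a f u] is $\partial f/\partial u^a$ at [u]. *)
Definition partial m (W : normedModType R) (a : 'I_m) (f : 'rV[R]_m -> W)
    (u : 'rV[R]_m) : W :=
  'D_(ebase a) f u.

End calculus.

Definition relatively_open (T : topologicalType) (B A : set T) : Prop :=
  exists O : set T, open O /\ A = B `&` O.

Section pseudo_Euclidean.
Variable R : realType.

(* The scalar product of E^N_q; the first [q] coordinates are negative. *)
Definition pform (q N : nat) (x y : 'rV[R]_N) : R :=
  \sum_(i < N) (-1) ^+ (i < q)%N * x 0 i * y 0 i.

(* S^n_p(r^2) *)
Definition psphere (n p : nat) (r : R) : set 'rV[R]_n.+1 :=
  [set x | pform p x x = r ^+ 2].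

(* H^n_p(-r^2) *)
Definition phyp (n p : nat) (r : R) : set 'rV[R]_n.+1 :=
  [set x | pform p.+1 x x = - r ^+ 2].

(* Orthogonal projection of E^{n+1}_{p+1} onto T_x H^n_p(-1), for
   [x] in H^n_p(-1). *)
Definition tangent_proj (n p : nat) (x w : 'rV[R]_n.+1) : 'rV[R]_n.+1 :=
  w + pform p.+1 w x *: x.

End pseudo_Euclidean.

Section pseudo_Riemannian.
Variable R : realType.

Definition negative_definite_on m (G W : 'M[R]_m) : Prop :=
  forall v : 'rV[R]_m, (v <= W)%MS -> v != 0 -> (v *m G *m v^T) 0 0 < 0.

Definition metric_of_index m (s : nat) (G : 'M[R]_m) : Prop :=
  [/\ G^T = G, G \in unitmx,
      exists2 W : 'M[R]_m, \rank W = s & negative_definite_on G W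
    & forall W : 'M[R]_m, negative_definite_on G W -> (\rank W <= s)%N].

(* Connected smooth manifold of dimension [m] with a metric of index [s].
   The chart [i] has domain [cdom i], coordinate map [chart_coord i] and inverse
   [param i]; the last two are meaningful only on [cdom i] and on its image.
   [gram i u] is the Gram matrix of the metric in the coordinate frame of
   the chart [i], at the point of coordinates [u]. *)
Record pseudoRiemannian (m s : nat) := PseudoRiemannian {
  carrier :> topologicalType;
  chart : Type;
  cdom : chart -> set carrier;
  chart_coord : chart -> carrier -> 'rV[R]_m;
  param : chart -> 'rV[R]_m -> carrier;
  gram : chart -> 'rV[R]_m -> 'M[R]_m;
  carrier_hausdorff : hausdorff_space carrier;
  carrier_second_countable : @second_countable carrier;
  carrier_connected : connected [set: carrier];
  chart_cover : forall x, exists i, cdom i x;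
  cdom_open : forall i, open (cdom i);
  cimage_open : forall i, open (chart_coord i @` cdom i);
  chart_coordK : forall i x, cdom i x -> param i (chart_coord i x) = x;
  chart_coord_continuous :
    forall i x, cdom i x -> {for x, continuous (chart_coord i)};
  param_continuous :
    forall i u, (chart_coord i @` cdom i) u -> {for u, continuous (param i)};
  transition_smooth : forall i j,
    smooth_on (chart_coord i @` (cdom i `&` cdom j))
      (chart_coord j \o param i);
  gram_smooth : forall i (a b : 'I_m),
    smooth_on (chart_coord i @` cdom i) (fun u => (gram i u a b : R));
  gram_index :
    forall i u, (chart_coord i @` cdom i) u -> metric_of_index s (gram i u);
  (* tensoriality; ['J] is the Jacobian acting on row vectors *)
  gram_tensorial : forall i j x, cdom i x -> cdom j x ->
    let J := 'J (chart_coord j \o param i) (chart_coord i x) in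
    gram i (chart_coord i x) = J *m gram j (chart_coord j x) *m J^T
}.

Definition cimage m s (M : pseudoRiemannian m s) (i : chart M)
    : set 'rV[R]_m := @chart_coord m s M i @` cdom i.

(* [christoffel g u c a b] is $\Gamma^c_{ab}$ at [u], for the metric with
   Gram matrix [g] in coordinates. *)
Definition christoffel m (g : 'rV[R]_m -> 'M[R]_m) (u : 'rV[R]_m)
    (c a b : 'I_m) : R :=
  2^-1 * \sum_(d < m) invmx (g u) c d *
    (partial a (fun v => (g v b d : R)) u
     + partial b (fun v => (g v a d : R)) u
     - partial d (fun v => (g v a b : R)) u).

Definition geodesic m s (M : pseudoRiemannian m s) (gamma : R -> M) : Prop :=
  continuous gamma /\
  forall i : chart M,
    let c : R -> 'rV[R]_m := chart_coord i \o gamma in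
    let I := gamma @^-1` cdom i in
    smooth_on I c /\
    forall t, I t -> forall k : 'I_m,
      derive1n 2 c t 0 k
      + \sum_(a < m) \sum_(b < m)
          christoffel (gram i) (c t) k a b
          * derive1 c t 0 a * derive1 c t 0 b = 0.

(* The geodesic with any given initial velocity exists for all time. *)
Definition geodesically_complete m s (M : pseudoRiemannian m s) : Prop :=
  forall (i : chart M) (x : M) (v : 'rV[R]_m), cdom i x ->
    exists gamma : R -> M,
      [/\ geodesic gamma, gamma 0 = x & derive1 (chart_coord i \o gamma) 0 = v].

End pseudo_Riemannian.

Section submanifolds.
Variable R : realType.

(* Below, the ambient space is H^n_p(-1), and [f] is an immersion into it
   expressed in coordinates of the source. *)
Definition induced_gram m n (p : nat) (f : 'rV[R]_m -> 'rV[R]_n.+1)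
    (u : 'rV[R]_m) : 'M[R]_m :=
  \matrix_(a, b) pform p.+1 (partial a f u) (partial b f u).

(* [second_ff p g f u a b] is $h(\partial_a,\partial_b) =
   \bar\nabla_{\partial_a}(df(\partial_b)) - df(\nabla_{\partial_a}\partial_b)$,
   where $\bar\nabla$ is the tangential part of the flat derivative. *)
Definition second_ff m n (p : nat) (g : 'rV[R]_m -> 'M[R]_m)
    (f : 'rV[R]_m -> 'rV[R]_n.+1) (u : 'rV[R]_m) (a b : 'I_m)
    : 'rV[R]_n.+1 :=
  tangent_proj p (f u) (partial a (partial b f) u)
  - \sum_(c < m) christoffel g u c a b *: partial c f u.

Definition mean_curv m n (p : nat) (g : 'rV[R]_m -> 'M[R]_m)
    (f : 'rV[R]_m -> 'rV[R]_n.+1) (u : 'rV[R]_m) : 'rV[R]_n.+1 :=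
  m%:R^-1 *: \sum_(a < m) \sum_(b < m)
    invmx (g u) a b *: second_ff p g f u a b.

Section immersions.
Variables (m s n p : nat) (M : pseudoRiemannian R m s) (phi : M -> 'rV[R]_n.+1).

(* Injectivity of the differential follows from the last clause, since
   [gram] is non-degenerate. *)
Definition isometric_immersion : Prop :=
  [/\ forall x, phyp p 1 (phi x),
      forall i : chart M, smooth_on (cimage i) (phi \o param i)
    & forall (i : chart M) u, cimage i u ->
        induced_gram p (phi \o param i) u = gram i u].

Definition sff (i : chart M) (u : 'rV[R]_m) (a b : 'I_m) : 'rV[R]_n.+1 :=
  second_ff p (gram i) (phi \o param i) u a b.

(* The mean curvature vector at the point [x], read in the chart [i]. *)
Definition mean_curvature (i : chart M) (x : M) : 'rV[R]_n.+1 :=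
  mean_curv p (gram i) (phi \o param i) (chart_coord i x).

Definition totally_geodesic : Prop :=
  forall (i : chart M) u, cimage i u -> forall a b, sff i u a b = 0.

Definition totally_umbilical : Prop :=
  forall (i : chart M) x, cdom i x -> forall a b,
    sff i (chart_coord i x) a b
    = gram i (chart_coord i x) a b *: mean_curvature i x.

(* The mean curvature vector satisfies [P] at every point. *)
Definition mean_curvature_satisfies (P : 'rV[R]_n.+1 -> Prop) : Prop :=
  forall (i : chart M) x, cdom i x -> P (mean_curvature i x).

End immersions.

(* Embedded hypersurfaces, given by local parametrizations that are
   homeomorphisms onto relatively open subsets. *)
Definition totally_geodesic_hypersurface (n p : nat) (S : set 'rV[R]_n.+1)
    : Prop :=
  S `<=` phyp p 1 /\
  forall x, S x ->
    exists (U : set 'rV[R]_n.-1) (f : 'rV[R]_n.-1 -> 'rV[R]_n.+1),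
      [/\ open U /\ (f @` U) x,
          smooth_on U f /\ set_inj U f,
          forall V : set 'rV[R]_n.-1, open V -> V `<=` U ->
            relatively_open S (f @` V),
          (* non-degeneracy *)
          forall u, U u -> induced_gram p f u \in unitmx
        & forall u, U u -> forall a b,
            second_ff p (induced_gram p f) f u a b = 0].

Definition full m s n (p : nat) (M : pseudoRiemannian R m s)
    (phi : M -> 'rV[R]_n.+1) : Prop :=
  ~ exists S, totally_geodesic_hypersurface p S /\ range phi `<=` S.

(* [F] maps H^n_p(-1) to itself, is smooth there (it extends locally to a
   smooth map of the vector space), and its differential preserves the scalar
   products of tangent vectors. *)
Definition local_isometry (n p : nat) (F : 'rV[R]_n.+1 -> 'rV[R]_n.+1)
    : Prop :=
  forall x, phyp p 1 x -> phyp p 1 (F x) /\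
    exists (U : set 'rV[R]_n.+1) (G : 'rV[R]_n.+1 -> 'rV[R]_n.+1),
      [/\ open U /\ U x, smooth_on U G,
          forall y, U y -> phyp p 1 y -> G y = F y
        & forall v w : 'rV[R]_n.+1,
            pform p.+1 v x = 0 -> pform p.+1 w x = 0 ->
            pform p.+1 ('D_v G x) ('D_w G x) = pform p.+1 v w].

(* Isometries of H^n_p(-1); the values of [F] elsewhere are irrelevant. *)
Definition ambient_isometry (n p : nat) (F : 'rV[R]_n.+1 -> 'rV[R]_n.+1)
    : Prop :=
  local_isometry p F /\
  exists F' : 'rV[R]_n.+1 -> 'rV[R]_n.+1,
    [/\ local_isometry p F', {in phyp p 1, cancel F F'}
      & {in phyp p 1, cancel F' F}].

End submanifolds.

Section models.
Variable R : realType.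

(* (a, x) *)
Definition prepend N (a : R) (x : 'rV[R]_N) : 'rV[R]_N.+1 :=
  \row_i oapp (x 0) a (unlift ord0 i).

(* (x, a) *)
Definition append N (x : 'rV[R]_N) (a : R) : 'rV[R]_N.+1 :=
  \row_i oapp (x 0) a (unlift ord_max i).

(* The inclusion of H^k_q(-1) into H^n_p(-1), inserting [n - k] zeros after
   the first [q + 1] coordinates; it is meaningful when [included k q n p]. *)
Definition hyp_incl (k q n : nat) (x : 'rV[R]_k.+1) : 'rV[R]_n.+1 :=
  \row_(i < n.+1)
    if (i <= q)%N then x 0 (inord i)
    else if (q + (n - k) < i)%N then x 0 (inord (i - (n - k)))
    else 0.

(* [q <= p] and [k - q <= n - p]: the inserted coordinates comprise [p - q]
   negative ones followed by [(n - p) - (k - q)] positive ones. *)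
Definition included (k q n p : nat) : Prop :=
  (q <= p)%N /\ (k + p <= n + q)%N.

Section maps.
Variables (m s n : nat).

Definition model1 : set 'rV[R]_n.+1 :=
  [set hyp_incl s n (append x 0) | x in @phyp R m s 1].

Definition model2 : set 'rV[R]_n.+1 :=
  [set hyp_incl s.+1 n (prepend 0 x) | x in @phyp R m s 1].

Definition model3 (r : R) : set 'rV[R]_n.+1 :=
  [set hyp_incl s.+1 n (prepend (Num.sqrt (1 - r ^+ 2)) x)
     | x in @phyp R m s r].

Definition model4 (r : R) : set 'rV[R]_n.+1 :=
  [set hyp_incl s n (append x (Num.sqrt (r ^+ 2 - 1))) | x in @phyp R m s r].

Definition model5 : set 'rV[R]_n.+1 :=
  [set hyp_incl s.+1 n (prepend 1 (append x 1)) | x in @phyp R m s 1].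

Definition model6 (r : R) : set 'rV[R]_n.+1 :=
  [set hyp_incl s n (prepend (Num.sqrt (1 + r ^+ 2)) x)
     | x in @psphere R m s r].

Definition model7 : set 'rV[R]_n.+1 :=
  [set hyp_incl s n (prepend (pform s x x + 5 / 4)
                         (append x (pform s x x + 3 / 4)))
     | x in [set: 'rV[R]_m]].

End maps.

(* [A], the image of an isometric immersion of [M], is an open portion of the
   model [B], and all of it when [M] is complete. Since [M] is connected,
   "all of it" refers to a connected component of [B], which is [B] itself
   except for the two-sheeted quadrics H^m_0(-r^2) and S^m_m(r^2). *)
Definition realizes m s n (M : pseudoRiemannian R m s)
    (A B : set 'rV[R]_n.+1) : Prop :=
  relatively_open B A /\
  (geodesically_complete M -> exists2 y, B y & A = connected_component B y).

End models.

Arguments model1 {R} m s n.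
Arguments model2 {R} m s n.
Arguments model3 {R} m s n r.
Arguments model4 {R} m s n r.
Arguments model5 {R} m s n.
Arguments model6 {R} m s n r.
Arguments model7 {R} m s n.

(* Main.v *)
(* Inside the vector space E^{n+1}_{p+1}, total umbilicity says that the second
   derivatives of phi have normal part <X, Y> N with N = H + phi. Symmetry of the
   third derivatives (Codazzi, using m >= 2) gives dN = - k dphi, so k = <N, N>
   and C = N + k phi are constant, and every vector orthogonal to the tangent
   space and to N at one point has constant product with phi. The image is
   therefore an open part of the quadric Q cut on H^n_p(-1) by the affine hull
   of phi(M). Along a geodesic, phi'' = e (C - k phi) with e constant; solving
   this equation reaches every point of Q close to the image, so that the image
   is closed in Q when M is complete.
   A nonnull vector orthogonal to all of phi(M) cuts out a non-degenerate totally
   geodesic hypersurface, so fullness makes the orthogonal of the span of the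
   tangent space, phi and H totally isotropic. This forces n = m + 1 when
   <H, H> = k + 1 is nonzero; otherwise it forces H <> 0 and n = m + 2. In
   particular H = 0 never happens and cases (1) and (2) are vacuous. The index
   counts give p, and products of reflections move C (or phi and H, or C and a
   companion vector) to the position read off the model. *)
Require Import Defs.
From HB Require Import structures.
From mathcomp Require Import all_boot all_order all_algebra.
From mathcomp Require Import all_classical all_reals all_analysis.
From mathcomp Require Import ring lra zify.

Set Implicit Arguments.
Unset Strict Implicit.
Unset Printing Implicit Defensive.

Import Order.TTheory GRing.Theory Num.Theory.
Import numFieldNormedType.Exports.

Local Open Scope classical_set_scope.
Local Open Scope ring_scope.

(** The image is not known in advance to be a submanifold, so its openness in Q is obtained
    pointwise. A point [y] of Q is [phi x + v + a N] with [v] tangent, [a = -1 - <y, phi x>] and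
    [<v, v> = 2 a - k a^2]. Near [phi x] only the root with [k a < 1] occurs, so [v] determines [y],
    and local surjectivity of the tangential coordinate fills a neighbourhood. Geodesics from [x]
    reach the points with [k a < 2]: the coefficient of [N] after unit time is governed by a
    generalized cosine whose value there must be [1 - k a], and these functions attain exactly what
    exceeds -1. Near a limit point [a] tends to 0 while [k] is the same everywhere, which gives
    closedness. The vector [N] is only given chart by chart through an average of second
    derivatives; its derivability and its independence of the chart are both extracted from
    umbilicity. [<C, C> = kappa (1 - kappa)] for [kappa = <H, H>], so [C] is null when [kappa] is 0
    or 1. Reflections only move nonnull vectors, which is why in these two cases an orthogonal pair
    of nonnull vectors is moved in place of [C]. *)

(** * Directional derivatives of matrix-valued maps *)

Section matrix_calculus.
Variable R : realType.
Variable V : normedModType R.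

Lemma is_derive_mxP a b (F : V -> 'M[R]_(a, b)) dF u v :
  is_derive u v F dF <->
  forall i j, is_derive u v (fun x => F x i j : R) (dF i j).
Proof.
split=> [[dF1 <-] i j|dF1].
  split; first exact: (derivable_mxP _ _ _).1.
  by rewrite derive_mx// mxE.
have dF2 : derivable F u v by apply/derivable_mxP => i j; have [] := dF1 i j.
split=> //; rewrite derive_mx//; apply/matrixP => i j; rewrite mxE.
by have [] := dF1 i j.
Qed.

Lemma is_derive_big (I : eqType) (r : seq I) (P : pred I) (F : I -> V -> R) dF u v :
  (forall i, P i -> is_derive u v (F i) (dF i)) ->
  is_derive u v (fun x => \sum_(i <- r | P i) F i x) (\sum_(i <- r | P i) dF i).
Proof.
move=> dFi; rewrite (_ : (fun x => _) = \sum_(i <- r | P i) F i).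
  by elim/big_ind2 : _ => // [|f df g dg f1 g1]; [exact: is_derive_cst|exact: is_deriveD].
by apply/funext => x; rewrite fct_sumE.
Qed.

Lemma derivable_big (I : eqType) (r : seq I) (P : pred I) (F : I -> V -> R) u v :
  (forall i, derivable (F i) u v) ->
  derivable (fun x => \sum_(i <- r | P i) F i x) u v.
Proof.
move=> Fd; suff: is_derive u v (fun x => \sum_(i <- r | P i) F i x)
  (\sum_(i <- r | P i) 'D_v (F i) u) by case.
by apply: is_derive_big => i _; exact: derivableP.
Qed.

Lemma is_derive_mulr (f g : V -> R) df dg u v :
  is_derive u v f df -> is_derive u v g dg ->
  is_derive u v (fun x => f x * g x) (df * g u + f u * dg).
Proof.
move=> fd gd; apply: is_derive_eq (@is_deriveM _ _ f g _ _ _ _ fd gd) _.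
by rewrite /GRing.scale/= addrC mulrC [df * _]mulrC [f u * _]mulrC.
Qed.

Lemma is_derive_mulmx a b c (F : V -> 'M[R]_(a, b)) (G : V -> 'M[R]_(b, c))
    dF dG u v :
  is_derive u v F dF -> is_derive u v G dG ->
  is_derive u v (fun x => F x *m G x) (dF *m G u + F u *m dG).
Proof.
move=> /is_derive_mxP Fd /is_derive_mxP Gd; apply/is_derive_mxP => i j.
under eq_fun do rewrite mxE; rewrite !mxE -big_split/=.
by apply: is_derive_big => k _; exact: is_derive_mulr.
Qed.

Lemma is_derive_trmx a b (F : V -> 'M[R]_(a, b)) dF u v :
  is_derive u v F dF -> is_derive u v (fun x => (F x)^T) dF^T.
Proof.
move=> /is_derive_mxP Fd; apply/is_derive_mxP => i j.
by under eq_fun do rewrite mxE; rewrite mxE.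
Qed.

Lemma derivable_prod (I : eqType) (r : seq I) (F : I -> V -> R) u v :
  (forall i, derivable (F i) u v) -> derivable (fun x => \prod_(i <- r) F i x) u v.
Proof.
move=> Fd; elim: r => [|i r IH].
  by under eq_fun do rewrite big_nil; exact: derivable_cst.
by under eq_fun do rewrite big_cons; exact: derivableM.
Qed.

Lemma derivable_det a (F : V -> 'M[R]_a) u v :
  derivable F u v -> derivable (fun x => \det (F x)) u v.
Proof.
move=> /derivable_mxP Fd; rewrite /determinant.
apply: derivable_big => s.
apply: derivableM; first exact: derivable_cst.
by apply: derivable_prod => i; exact: Fd.
Qed.

(** On [U] the inverse is the adjugate divided by the determinant, hence rational in the entries. *)
Lemma derivable_invmx a (F : V -> 'M[R]_a) u v (U : set V) :
  open U -> U u -> (forall x, U x -> F x \in unitmx) ->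
  derivable F u v -> derivable (fun x => invmx (F x)) u v.
Proof.
move=> oU Uu FU Fd.
apply: (@near_eq_derivable _ _ _ (fun x => (\det (F x))^-1 *: \adj (F x))).
  near=> x; rewrite /invmx FU//; near: x; exact: open_nbhs_nbhs.
apply/derivable_mxP => i j; under eq_fun do rewrite !mxE.
apply: derivableM.
  apply: derivableV; last exact: derivable_det.
  by have := FU _ Uu; rewrite unitmxE unitfE.
rewrite /cofactor; apply: derivableM; first exact: derivable_cst.
apply: derivable_det; apply/derivable_mxP => k l.
under eq_fun do rewrite !mxE.
by move/derivable_mxP : Fd; apply.
Unshelve. all: by end_near. Qed.

(** Once the inverse is known to be derivable, the formula follows by differentiating
    [F F^-1 = 1]. *)
Lemma is_derive_invmx a (F : V -> 'M[R]_a) dF u v (U : set V) :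
  open U -> U u -> (forall x, U x -> F x \in unitmx) ->
  is_derive u v F dF ->
  is_derive u v (fun x => invmx (F x)) (- (invmx (F u) *m dF *m invmx (F u))).
Proof.
move=> oU Uu FU Fd.
have [Fd1 FdE] := Fd.
have := derivable_invmx oU Uu FU Fd1; set dI := 'D_v (fun x => invmx (F x)) u.
move=> /derivableP Id; split; first by case: Id.
have FI := is_derive_mulmx Fd Id.
have : is_derive u v (fun x => F x *m invmx (F x)) 0.
  apply: (@near_eq_is_derive _ _ _ (cst 1%:M)) => /=.
  near=> x; rewrite mulmxV ?FU//; near: x; exact: open_nbhs_nbhs.
case: FI => _ FIE [_]; rewrite FIE => /(congr1 (mulmx (invmx (F u)))).
rewrite mulmx0 mulmxDr [X in _ + X]mulmxA mulVmx ?FU// mul1mx => /eqP.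
by rewrite addrC addr_eq0 mulmxA => /eqP.
Unshelve. all: by end_near. Qed.

End matrix_calculus.

(** * Symmetry of second derivatives, constancy, curves *)

Section normed_calculus.
Variable R : realType.
Variable V : normedModType R.

Lemma is_derive_line (W : normedModType R) (f : V -> W) df u v (t : R) :
  is_derive (u + t *: v) v f df -> is_derive t 1 (fun s => f (u + s *: v)) df.
Proof.
have E : (fun h : R => h^-1 *: (((fun s => f (u + s *: v)) \o shift t) (h *: 1)
            - f (u + t *: v)))
       = (fun h : R => h^-1 *: ((f \o shift (u + t *: v)) (h *: v) - f (u + t *: v))).
  apply/funext => h /=; congr (_ *: (f _ - _)).
  by rewrite [h *: 1]mulr1 scalerDl addrCA.
by case=> df1 dfE; split; rewrite /derivable /derive E.
Qed.

Lemma differentiable_littleo (W : normedModType R) (f : V -> W) u (e : R) :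
  differentiable f u -> 0 < e ->
  \forall y \near 0, `|f (y + u) - f u - 'D_y f u| <= e * `|y|.
Proof.
move=> fd e0; have /diff_locallyP[_ fE] := fd.
have /eqaddoP /(_ e e0) := fE; apply: filterS => y /=.
by rewrite deriveE// opprD addrA.
Qed.

(** The mean value theorem along [v] turns the second difference into [h] times the increment of
    ['D_v f] across [h *: w]; differentiability of ['D_v f] at [u] evaluates that increment up to
    [e h]. *)
Lemma symmetric_difference (f : V -> R) (U : set V) u v w :
  open U -> U u -> (forall x, U x -> derivable f x v) ->
  differentiable (fun x => 'D_v f x : R) u ->
  forall e : R, 0 < e -> exists2 d : R, 0 < d & forall h : R, 0 < h < d ->
  `|f (u + h *: v + h *: w) - f (u + h *: v) - f (u + h *: w) + f u
    - h ^+ 2 * 'D_w (fun x => 'D_v f x) u| <= e * h ^+ 2.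
Proof.
move=> oU Uu fd gd e e0; set g := fun x => 'D_v f x : R.
pose M := `|v| + `|w| + 1.
have M0 : 0 < M by rewrite ltr_wpDl// addr_ge0.
have e1 : 0 < e / (2 * M) by rewrite divr_gt0// mulr_gt0.
have /nbhs_ballP[d1 /= d10 B1] := differentiable_littleo gd e1.
have /nbhs_ballP[d2 /= d20 B2] : nbhs u U by exact: open_nbhs_nbhs.
pose d := Num.min d1 d2 / M.
have d0 : 0 < d by rewrite divr_gt0// lt_min d10.
exists d => // h /andP[h0 hd].
have small a b : 0 <= a <= h -> 0 <= b <= h ->
    `|a *: v + b *: w| <= h * M /\ h * M < Num.min d1 d2.
  move=> /andP[a0 ah] /andP[b0 bh]; split; last by rewrite -ltr_pdivlMr.
  rewrite (le_trans (ler_normD _ _))// !normrZ !ger0_norm//.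
  by rewrite /M !mulrDr mulr1 ler_wpDr ?(ltW h0)// lerD// ler_wpM2r.
have inU a b : 0 <= a <= h -> 0 <= b <= h -> U (u + (a *: v + b *: w)).
  move=> ha hb; apply: B2; rewrite -ball_normE/= opprD addrA subrr sub0r normrN.
  have [s1 s2] := small _ _ ha hb.
  by rewrite (le_lt_trans s1)// (lt_le_trans s2)// ge_min lexx orbT.
have gE a b : 0 <= a <= h -> 0 <= b <= h ->
    `|g (u + (a *: v + b *: w)) - g u - (a * 'D_v g u + b * 'D_w g u)|
      <= e / 2 * h.
  move=> ha hb; have [s1 s2] := small _ _ ha hb.
  have := B1 (a *: v + b *: w); rewrite -ball_normE/= sub0r normrN.
  have s3 : `|a *: v + b *: w| < d1.
    by rewrite (le_lt_trans s1)// (lt_le_trans s2)// ge_min lexx.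
  move=> /(_ s3); rewrite [_ + u]addrC (deriveE _ gd) linearD !linearZ/= -!deriveE//.
  move=> /le_trans; apply; rewrite -/g.
  have -> : e / 2 * h = e / (2 * M) * (h * M).
    by field; exact: lt0r_neq0.
  by rewrite ler_wpM2l// ltW.
(* The second difference is [ph h - ph 0]. *)
pose ph t : R := f (u + (t *: v + h *: w)) - f (u + (t *: v + 0 *: w)).
have hh : 0 <= h <= h by rewrite lexx ltW.
have h0' : 0 <= (0 : R) <= h by rewrite lexx ltW.
have phd t : 0 <= t <= h -> is_derive t 1 ph
    (g (u + (t *: v + h *: w)) - g (u + (t *: v + 0 *: w))).
  move=> th; apply: is_deriveB.
    rewrite (_ : (fun t => _) = (fun t => f ((u + h *: w) + t *: v))); last first.
      by apply/funext => s; rewrite [s *: v + _]addrC addrA.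
    apply: is_derive_line; rewrite -addrA [h *: w + _]addrC.
    by apply: derivableP; apply: fd; exact: inU.
  rewrite (_ : (fun t => _) = (fun t => f (u + t *: v))); last first.
    by apply/funext => s; rewrite scale0r addr0.
  apply: is_derive_line; rewrite scale0r addr0; apply: derivableP; apply: fd.
  by have := inU _ _ th h0'; rewrite scale0r addr0.
have [x xh] : exists2 x, x \in `]0, h[%R & ph h - ph 0 =
    (g (u + (x *: v + h *: w)) - g (u + (x *: v + 0 *: w))) * (h - 0).
  apply: (@MVT _ ph (fun x => g (u + (x *: v + h *: w)) - g (u + (x *: v + 0 *: w)))).
  - by [].
  - by move=> x; rewrite in_itv/= => /andP[x0 xh]; apply: phd; rewrite !ltW.
  - apply: derivable_within_continuous => t; rewrite in_itv/= => th.
    by have [] := phd _ th.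
move: xh; rewrite in_itv/= => /andP[/ltW x0 /ltW xh0]; rewrite subr0 /ph.
have xx : 0 <= x <= h by rewrite x0.
rewrite !scale0r !addr0 add0r => E.
have -> : f (u + h *: v + h *: w) - f (u + h *: v) - f (u + h *: w) + f u =
   (g (u + (x *: v + h *: w)) - g (u + (x *: v + 0 *: w))) * h.
  by rewrite scale0r addr0 -E -[u + h *: v + _]addrA; ring.
have A1 := gE _ _ xx hh; have A2 := gE _ _ xx h0'.
set G1 := g (u + (x *: v + h *: w)) in A1 *.
set G2 := g (u + (x *: v + 0 *: w)) in A2 *.
(* The error is a difference of two first-order remainders of ['D_v f] at [u], each at most
   [e / 2 * h]; the contributions of the [v] direction cancel. *)
have alg (p q c d1' d2' : R) : (p - q) * h - h ^+ 2 * d2' =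
  ((p - c - (x * d1' + h * d2')) - (q - c - (x * d1' + 0 * d2'))) * h by ring.
rewrite (alg G1 G2 (g u) ('D_v g u)).
rewrite normrM (gtr0_norm h0) expr2 mulrA ler_wpM2r ?(ltW h0)//.
rewrite (le_trans (ler_normB _ _))// (le_trans (lerD A1 A2))//.
by rewrite -mulrDl -splitr.
Qed.

(** Both mixed derivatives are approximated, up to [e / 2], by one second difference over [h ^+ 2],
    whose expression is symmetric in [v] and [w]. *)
Lemma symmetric_derive (f : V -> R) (U : set V) u v w :
  open U -> U u ->
  (forall x, U x -> derivable f x v) -> (forall x, U x -> derivable f x w) ->
  differentiable (fun x => 'D_v f x : R) u ->
  differentiable (fun x => 'D_w f x : R) u ->
  'D_w (fun x => 'D_v f x) u = 'D_v (fun x => 'D_w f x) u :> R.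
Proof.
move=> oU Uu fv fw gv gw; apply/eqP; rewrite -subr_eq0 -normr_le0.
apply/ler_addgt0Pl => e e0; rewrite addr0.
have e2 : 0 < e / 2 by rewrite divr_gt0.
have [d1 d10 B1] := symmetric_difference w oU Uu fv gv e2.
have [d2 d20 B2] := symmetric_difference v oU Uu fw gw e2.
pose h := Num.min d1 d2 / 2.
have m0 : 0 < Num.min d1 d2 by rewrite lt_min d10.
have h0 : 0 < h by rewrite divr_gt0.
have hm : h < Num.min d1 d2 by rewrite ltr_pdivrMr// ltr_pMr// ltr1n.
have := B1 h; rewrite h0 (lt_le_trans hm) ?ge_min ?lexx// => /(_ isT) A1.
have := B2 h; rewrite h0 (lt_le_trans hm) ?ge_min ?lexx ?orbT// => /(_ isT) A2.
have h2 : 0 < h ^+ 2 by rewrite exprn_gt0.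
rewrite -(ler_pM2r h2) -[X in _ * X](gtr0_norm h2) -normrM.
move: A1 A2; set a := 'D_w _ u; set b := 'D_v _ u.
rewrite [u + h *: w + _]addrAC; set D := f (u + h *: v + _) => A1 A2.
have -> : (a - b) * h ^+ 2 =
   (D - f (u + h *: w) - f (u + h *: v) + f u - h ^+ 2 * b) -
   (D - f (u + h *: v) - f (u + h *: w) + f u - h ^+ 2 * a) by ring.
rewrite (le_trans (ler_normB _ _))// (le_trans (lerD A2 A1))//.
by rewrite -mulrDl -splitr.
Qed.

(** The segment from the centre to [x] stays in the ball, so the mean value theorem applies to each
    entry along it. *)
Lemma derive0_constant a b (F : V -> 'M[R]_(a, b)) u (r : R) :
  (forall x v, ball u r x -> is_derive x v F 0) ->
  forall x, ball u r x -> F x = F u.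
Proof.
move=> Fd x ux; apply/matrixP => i j.
have bl (t : R) : 0 <= t <= 1 -> ball u r (u + t *: (x - u)).
  move=> /andP[t0 t1]; move: ux; rewrite -!ball_normE/=; apply: le_lt_trans.
  rewrite opprD addrA subrr sub0r normrN normrZ distrC ger0_norm//.
  by rewrite ler_piMl.
have phd (t : R) : 0 <= t <= 1 -> is_derive t 1 (fun t => F (u + t *: (x - u)) i j : R) 0.
  move=> /bl /(Fd _ (x - u)) /is_derive_mxP /(_ i j); rewrite mxE.
  exact: (@is_derive_line _ (fun x => F x i j)).
have [||c _] := @MVT R (fun t => F (u + t *: (x - u)) i j) (fun=> 0) 0 1 ltr01.
- by move=> y; rewrite in_itv/= => /andP[y0 y1]; apply: phd; rewrite !ltW.
- apply: derivable_within_continuous => t; rewrite in_itv/= => th.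
  by have [] := phd _ th.
rewrite mul0r scale1r scale0r addr0 [u + _]addrC subrK => /eqP.
by rewrite subr_eq0 => /eqP.
Qed.

Lemma is_derive_curve (W : normedModType R) (f : V -> W) (c : R -> V) t dc :
  differentiable f (c t) -> is_derive t 1 c dc ->
  is_derive t 1 (fun s => f (c s)) ('D_dc f (c t)).
Proof.
move=> fd [/derivable1_diffP cd cE].
have fcd : differentiable (f \o c) t by exact: differentiable_comp.
split; first exact/derivable1_diffP.
rewrite (deriveE _ fcd) diff_comp//= deriveE//; congr ('d f _ _).
by rewrite -cE deriveE.
Qed.

End normed_calculus.

(** * Linear maps on row vectors and local surjectivity *)

Section row_vector_calculus.
Variable R : realType.

Lemma mx_norm_coord a b (A : 'M[R]_(a, b)) i j : `|A i j| <= `|A|.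
Proof.
rewrite [leRHS]/Num.Def.normr/= mx_normrE.
exact: (le_bigmax _ (fun ij : 'I_a * 'I_b => `|A ij.1 ij.2|) (i, j)).
Qed.

Lemma mx_norm_le a b (A : 'M[R]_(a, b)) (k : R) : 0 <= k ->
  (forall i j, `|A i j| <= k) -> `|A| <= k.
Proof.
move=> k0 Ak; rewrite [leLHS]/Num.Def.normr/= mx_normrE.
by apply: bigmax_le => // -[i j] _; exact: Ak.
Qed.

Lemma mx_norm_mulmx a b c (A : 'M[R]_(a, b)) (B : 'M[R]_(b, c)) :
  `|A *m B| <= b%:R * `|B| * `|A|.
Proof.
apply: mx_norm_le => [|i j]; first by rewrite !mulr_ge0.
rewrite mxE (le_trans (ler_norm_sum _ _ _))//.
rewrite (@le_trans _ _ (\sum_(k < b) `|B| * `|A|))//; last first.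
  by rewrite sumr_const card_ord -mulrA mulr_natl.
apply: ler_sum => k _; rewrite normrM mulrC.
by rewrite ler_pM// mx_norm_coord.
Qed.

Lemma linear_rV_differentiable m (W : normedModType R)
    (f : {linear 'rV[R]_m -> W}) u : differentiable f u.
Proof.
rewrite (_ : (f : _ -> _) = \sum_(i < m) fun x : 'rV[R]_m => x 0 i *: f (delta_mx 0 i)).
  apply: differentiable_sum => i; apply: differentiableZl.
  exact: differentiable_coord.
apply/funext => x; rewrite fct_sumE {1}(row_sum_delta x) linear_sum/=.
by apply: eq_bigr => i _; rewrite linearZ.
Qed.

Lemma linear_rV_continuous m (W : normedModType R)
    (f : {linear 'rV[R]_m -> W}) : continuous f.
Proof. by move=> u; apply: differentiable_continuous; exact: linear_rV_differentiable. Qed.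

Lemma linear_rV_derive m (W : normedModType R)
    (f : {linear 'rV[R]_m -> W}) u v : is_derive u v f (f v).
Proof.
have fd := linear_rV_differentiable f u.
split; first exact: diff_derivable.
by rewrite deriveE// diff_lin//; exact: linear_rV_continuous.
Qed.

Lemma mulmx_rV_continuous m k (B : 'M[R]_(m, k)) :
  continuous (fun x : 'rV[R]_m => x *m B).
Proof. by have := @linear_rV_continuous m 'rV[R]_k (mulmxr B). Qed.

(** This is the surjectivity half of the inverse function theorem. The sum of squares of the entries
    of [F u - y] is minimized on a closed ball; the minimum is interior because [F] stays away from
    [F u0] on the sphere, and at an interior minimum the invertible Jacobian forces the value 0. *)
Lemma locally_onto m (F : 'rV[R]_m -> 'rV[R]_m) (U : set 'rV[R]_m) u0 :
  open U -> U u0 ->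
  (forall u, U u -> differentiable F u /\ jacobian F u \in unitmx) ->
  \forall y \near F u0, exists2 u, U u & F u = y.
Proof.
move=> oU Uu0 FU; have [Fd0 J0u] := FU _ Uu0.
set J := jacobian F u0 in J0u.
pose K := m%:R * `|invmx J| + 1.
have K0 : 0 < K by rewrite ltr_wpDl// mulr_ge0.
have Jlow (w : 'rV[R]_m) : `|w| <= K * `|w *m J|.
  rewrite -{1}(mulmxK J0u w) (le_trans (mx_norm_mulmx _ _))//.
  by rewrite ler_wpM2r// /K lerDl.
pose c := (2 * K)^-1.
have c0 : 0 < c by rewrite invr_gt0 mulr_gt0.
have /nbhs_ballP[d1 /= d10 B1] := differentiable_littleo Fd0 c0.
have /nbhs_ballP[d2 /= d20 B2] : nbhs u0 U by exact: open_nbhs_nbhs.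
pose r := Num.min d1 d2 / 2.
have m0 : 0 < Num.min d1 d2 by rewrite lt_min d10.
have r0 : 0 < r by rewrite divr_gt0.
have rm : r < Num.min d1 d2 by rewrite ltr_pdivrMr// ltr_pMr// ltr1n.
have rU (u : 'rV[R]_m) : `|u - u0| <= r -> U u.
  move=> ur; apply: B2; rewrite -ball_normE/= distrC (le_lt_trans ur)//.
  by rewrite (lt_le_trans rm)// ge_min lexx orbT.
have Flow (u : 'rV[R]_m) : `|u - u0| = r -> c * r <= `|F u - F u0|.
  move=> ur; have := B1 (u - u0); rewrite -ball_normE/= sub0r normrN ur.
  rewrite (lt_le_trans rm) ?ge_min ?lexx// => /(_ isT).
  rewrite subrK deriveEjacobian// -/J => h1.
  have h2 := Jlow (u - u0); rewrite ur in h2.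
  have h3 : 2 * c * r <= `|(u - u0) *m J|.
    rewrite -(ler_pM2l K0) (le_trans _ h2)// /c.
    by rewrite le_eqVlt; apply/orP; left; apply/eqP; field; exact: lt0r_neq0.
  have h4 := ler_distD (F u - F u0) ((u - u0) *m J) 0.
  rewrite subr0 subr0 distrC in h4.
  by move: h1 h3 h4; nra.
(* The factor [m + 2] reconciles the sup norm with the sum of squares: that sum is at most [m eta^2]
   at the centre, whereas on the sphere some entry is at least [(m + 1) eta]. *)
pose eta := c * r / (m%:R + 2).
have m2 : (0 : R) < m%:R + 2 by rewrite ltr_wpDl.
have eta0 : 0 < eta by rewrite divr_gt0// mulr_gt0.
near=> y.
have yeta : `|y - F u0| < eta.
  rewrite distrC; near: y.
  by apply/nbhs_ballP; exists eta => //= y; rewrite -ball_normE.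
pose E u : R := \sum_(k < m) (F u 0 k - y 0 k) ^+ 2.
pose D : set 'rV[R]_m := [set u | `|u - u0| <= r].
have DE : D = closed_ball u0 r.
  rewrite closed_ballE//; apply/seteqP; split=> u;
  by rewrite /D/closed_ball_/= distrC.
have Dc : compact D.
  apply: bounded_closed_compact; last by rewrite DE; exact: closed_ball_closed.
  exists (`|u0| + r); split; first exact: num_real.
  move=> M hM u Du /=; rewrite (le_trans _ (ltW hM))//.
  by rewrite -{1}(subrK u0 u) addrC (le_trans (ler_normD _ _))// lerD2l.
have Ed u : D u -> differentiable E u.
  move=> /rU /FU[Fd _]; rewrite /E.
  rewrite (_ : (fun u => _) = \sum_(k < m) fun u => (F u 0 k - y 0 k) ^+ 2).
    apply: differentiable_sum => k.
    have Fk : differentiable (fun u => F u 0 k - y 0 k) u.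
      apply: (@differentiableB _ _ _ (fun u => F u 0 k : R) (cst (y 0 k))) => //.
      apply: (@differentiable_comp _ _ _ _ F (fun N => N 0 k : R)) => //.
      exact: differentiable_coord.
    exact: (differentiableM Fk Fk).
  by apply/funext => x; rewrite fct_sumE.
have Ec : {within D, continuous E}.
  by apply: continuous_in_subspaceT => u /set_mem/Ed/differentiable_continuous.
have Du0 : D u0 by rewrite /D/= subrr normr0 ltW.
have [|x0 /set_mem Dx0 xmin] := EVT_min_rV _ Dc Ec; first by exists u0.
have E0 : E u0 <= m%:R * eta ^+ 2.
  rewrite /E (@le_trans _ _ (\sum_(k < m) eta ^+ 2))//; last first.
    by rewrite sumr_const card_ord mulr_natl.
  apply: ler_sum => k _; rewrite -real_normK ?num_real// ler_sqr ?nnegrE ?(ltW eta0)//.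
  have := mx_norm_coord (y - F u0) 0 k; rewrite !mxE distrC => /le_trans; apply.
  exact: ltW.
have xr : `|x0 - u0| < r.
  rewrite lt_neqAle Dx0 andbT; apply/negP => /eqP xr.
  have h1 := Flow _ xr.
  have h2 : c * r - eta <= `|F x0 - y|.
    have := ler_distD y (F x0) (F u0) => h.
    by move: h1 h yeta; lra.
  have crE : c * r = (m%:R + 2) * eta by rewrite /eta; field; exact: lt0r_neq0.
  have h3 : (m%:R + 1) * eta <= `|F x0 - y| by move: h2; rewrite crE; nra.
  have me0 : 0 < (m%:R + 1) * eta by rewrite mulr_gt0// ltr_wpDl.
  have [k hk] : exists k, (m%:R + 1) * eta <= `|F x0 0 k - y 0 k|.
    apply: contrapT => /forallNP h4.
    have : `|F x0 - y| < (m%:R + 1) * eta.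
      rewrite [ltLHS]/Num.Def.normr/= mx_normrE bigmax_lt// => -[i j] _ /=.
      rewrite ord1 !mxE ltNge; apply/negP; exact: h4.
    by rewrite ltNge h3.
  have : E u0 < E x0.
    rewrite (le_lt_trans E0)// /E (bigD1 k)//= ltr_wpDr//.
      by apply: sumr_ge0 => i _; rewrite sqr_ge0.
    rewrite (@lt_le_trans _ _ (((m%:R + 1) * eta) ^+ 2))//.
      have mr0 : (0 : R) <= m%:R by [].
      by rewrite [ltRHS]exprMn ltr_pM2r ?exprn_gt0//; nra.
    by rewrite -[leRHS]real_normK ?num_real// ler_sqr ?nnegrE// ltW.
  by rewrite ltNge xmin// inE.
have [Fd Ju] := FU _ (rU _ Dx0).
(* Along [w] the map [F] has derivative [F x0 - y], so the derivative of [E] is twice its value. *)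
pose w := (F x0 - y) *m invmx (jacobian F x0).
have Ew : is_derive (x0 : 'rV[R]_m) w E (\sum_(k < m) 2 * (F x0 0 k - y 0 k) ^+ 2).
  apply: is_derive_big => k _.
  have Fk : is_derive x0 w (fun u => F u 0 k - y 0 k : R) (F x0 0 k - y 0 k).
    have : is_derive x0 w F (F x0 - y).
      split; first exact: diff_derivable.
      by rewrite deriveEjacobian// /w mulmxKV.
    move=> /is_derive_mxP/(_ 0 k); rewrite !mxE => Fk.
    apply: is_derive_eq (@is_deriveB _ _ _ _ (cst (y 0 k)) _ _ _ _ Fk (is_derive_cst _ _ _)) _.
    by rewrite subr0.
  apply: is_derive_eq (is_derive_mulr Fk Fk) _.
  by rewrite expr2 mulr_natl mulr2n.
have Ew0 : is_derive (0 : R) 1 (fun t => E (x0 + t *: w))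
    (\sum_(k < m) 2 * (F x0 0 k - y 0 k) ^+ 2).
  by apply: is_derive_line; rewrite scale0r addr0.
have [e e0 eD] : exists2 e : R, 0 < e & forall t, -e < t < e -> D (x0 + t *: w).
  have w1 : 0 < `|w| + 1 by rewrite ltr_wpDl.
  exists ((r - `|x0 - u0|) / (`|w| + 1)).
    by rewrite divr_gt0 ?subr_gt0.
  move=> t; rewrite -ltr_norml ltr_pdivlMr// => ht.
  rewrite /D/= addrAC (le_trans (ler_normD _ _))// normrZ.
  have := normr_ge0 t; have := normr_ge0 w; move: ht; nra.
have : is_derive (0 : R) 1 (fun t => E (x0 + t *: w)) 0.
  apply: (@derive1_at_min _ _ (- e) e) => [|t||t].
  - by rewrite ge0_cp// ltW.
  - rewrite in_itv/= => /eD /Ed Edt.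
    have /derivableP := @diff_derivable _ _ _ _ _ w Edt.
    by move=> /is_derive_line[].
  - by rewrite in_itv/= oppr_lt0 e0.
  - rewrite in_itv/= => /eD Dt; rewrite scale0r addr0.
    by apply: xmin; rewrite inE.
case=> _; case: Ew0 => _ -> /eqP.
rewrite psumr_eq0 => [/allP s0|k _]; last by rewrite mulr_ge0// sqr_ge0.
exists x0; first exact: rU.
apply/rowP => k; have := s0 k (mem_index_enum _).
by rewrite mulf_eq0 pnatr_eq0/= sqrf_eq0 subr_eq0 => /eqP.
Unshelve. all: by end_near. Qed.

End row_vector_calculus.

(** * Stability properties of smooth maps *)

Section smoothness.
Variable R : realType.
Variable V : normedModType R.

Lemma near_eq_differentiable (W : normedModType R) (f g : V -> W) x :
  {near x, f =1 g} -> differentiable f x -> differentiable g x.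
Proof.
move=> fg fd.
suff hd : differentiable (g - f) x.
  by rewrite -(subrK f g); exact: differentiableD.
have hE : (g - f) \o shift x = cst ((g - f) x) + \0 +o_ 0 id.
  apply/eqaddoP => e e0.
  have fg0 : \forall y \near 0, f (y + x) = g (y + x).
    have : \forall y \near x, f y = g y by exact: fg.
    by rewrite (near_shift 0) subr0.
  apply: filterS fg0 => y fgy.
  rewrite -[X in `|X|]/((g (y + x) - f (y + x)) - ((g x - f x) + 0)).
  by rewrite fgy (nbhs_singleton fg) !subrr addr0 subrr normr0 mulr_ge0// ltW.
have dE : 'd (g - f) x = \0 :> (V -> W).
  by apply: diff_unique hE; exact: cst_continuous.
by apply/diff_locallyP; rewrite dE; split => //; exact: cst_continuous.
Qed.

Lemma Ck_on_eq (W : normedModType R) k (U : set V) (f g : V -> W) :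
  open U -> (forall x, U x -> f x = g x) -> Ck_on k U f -> Ck_on k U g.
Proof.
move=> oU; elim: k f g => [|k IH] f g fg /=.
  move=> fc x Ux; have fx : f @ x --> f x by exact: fc.
  suff : g @ x --> g x by [].
  rewrite -fg//; apply: cvg_trans fx; apply: near_eq_cvg; near=> y.
  by apply: fg; near: y; exact: open_nbhs_nbhs.
have nfg x : U x -> {near x, f =1 g}.
  by move=> Ux; near=> y; apply: fg; near: y; exact: open_nbhs_nbhs.
move=> [fd fD]; split=> [x Ux|v].
  exact: near_eq_differentiable (nfg _ Ux) (fd _ Ux).
by apply: IH (fD v) => x Ux; exact: near_eq_derive (nfg _ Ux).
Unshelve. all: by end_near. Qed.

Lemma Ck_onW (W : normedModType R) k (U : set V) (f : V -> W) :
  Ck_on k.+1 U f -> Ck_on k U f.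
Proof.
elim: k f => [|k IH] f [fd fD].
  by move=> x /fd/differentiable_continuous.
by split=> // v; exact: IH (fD v).
Qed.

Lemma Ck_on_cst (W : normedModType R) k (U : set V) (w : W) :
  Ck_on k U (cst w).
Proof.
elim: k w => [|k IH] w /=; first by move=> x _; exact: cst_continuous.
split=> [x _|v]; first exact: differentiable_cst.
by rewrite (_ : (fun x => _) = cst 0) //; apply/funext => x; rewrite derive_cst.
Qed.

Lemma Ck_onD (W : normedModType R) k (U : set V) (f g : V -> W) :
  open U -> Ck_on k U f -> Ck_on k U g -> Ck_on k U (fun x => f x + g x).
Proof.
move=> oU; elim: k f g => [|k IH] f g /=.
  by move=> fc gc x Ux; apply: continuousD; [exact: fc|exact: gc].
move=> [fd fD] [gd gD]; split=> [x Ux|v].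
  by apply: differentiableD; [exact: fd|exact: gd].
apply: Ck_on_eq (IH _ _ (fD v) (gD v)) => // x Ux.
by rewrite -deriveD//; apply: diff_derivable; [exact: fd|exact: gd].
Qed.

Lemma Ck_on_sum (W : normedModType R) k (U : set V) (I : Type) (r : seq I)
    (f : I -> V -> W) :
  open U -> (forall i, Ck_on k U (f i)) -> Ck_on k U (fun x => \sum_(i <- r) f i x).
Proof.
move=> oU fk; elim: r => [|i r IH].
  by under eq_fun do rewrite big_nil; exact: Ck_on_cst.
by under eq_fun do rewrite big_cons; exact: Ck_onD.
Qed.

Lemma Ck_onM k (U : set V) (f g : V -> R) :
  open U -> Ck_on k U f -> Ck_on k U g -> Ck_on k U (fun x => f x * g x : R).
Proof.
move=> oU; elim: k f g => [|k IH] f g.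
  by move=> fc gc x Ux; apply: continuousM; [exact: fc|exact: gc].
move=> fk gk; have [fd fD] := fk; have [gd gD] := gk.
split=> [x Ux|v]; first by apply: differentiableM; [exact: fd|exact: gd].
have := Ck_onD oU (IH _ _ (fD v) (Ck_onW gk)) (IH _ _ (Ck_onW fk) (gD v)).
apply: Ck_on_eq => // x Ux.
have fx := derivableP (@diff_derivable _ _ _ _ _ v (fd _ Ux)).
have gx := derivableP (@diff_derivable _ _ _ _ _ v (gd _ Ux)).
by have [_ ->] := is_derive_mulr fx gx.
Qed.

Lemma Ck_onZl (W : normedModType R) k (U : set V) (f : V -> R) (w : W) :
  open U -> Ck_on k U f -> Ck_on k U (fun x => f x *: w).
Proof.
move=> oU; elim: k f => [|k IH] f.
  by move=> fc x Ux; apply: cvgZr_tmp; exact: fc.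
move=> [fd fD]; split=> [x Ux|v].
  by apply: differentiableZl; exact: fd.
apply: Ck_on_eq (IH _ (fD v)) => // x Ux.
have fdx := fd _ Ux.
rewrite [RHS]deriveE; last exact: differentiableZl.
by rewrite diffZl// deriveE.
Qed.

(** The root and its inverse are treated in one induction on the order: the derivative of either is
    a product of ['D_v q] with powers of the inverse root. *)
Lemma smooth_sqrt (U : set V) (q : V -> R) :
  open U -> (forall x, U x -> 0 < q x) -> smooth_on U q ->
  smooth_on U (fun x => Num.sqrt (q x)).
Proof.
move=> oU q0 qs.
pose rho x := Num.sqrt (q x).
have rho0 x : U x -> rho x != 0 by move=> Ux; rewrite sqrtr_eq0 -ltNge q0.
have qd x : U x -> differentiable q x by move=> Ux; have [] := qs 1%N => + _; apply.
have sqd x : U x -> is_derive (q x) 1 (@Num.sqrt R) (2 * rho x)^-1.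
  by move=> Ux; apply: is_derive1_sqrt; exact: q0.
have rd x : U x -> differentiable rho x.
  move=> Ux; apply: differentiable_comp; first exact: qd.
  by apply/derivable1_diffP; have [] := sqd _ Ux.
have rD x v : U x -> is_derive x v rho ('D_v q x * (2 * rho x)^-1).
  move=> Ux; split; first exact/diff_derivable/rd.
  have sd : differentiable (@Num.sqrt R) (q x).
    by apply/derivable1_diffP; have [] := sqd _ Ux.
  rewrite deriveE; last exact: rd.
  rewrite (@diff_comp _ _ _ _ q)//=; last exact: qd.
  have [_ sE] := sqd _ Ux; move: sE; rewrite deriveE// => sE.
  rewrite deriveE; last exact: qd.
  by rewrite -sE -{1}['d q x v]mulr1 -[_ * 1]/(_ *: (1 : R^o)) linearZ.
suff H k : Ck_on k U rho /\ Ck_on k U (fun x => (rho x)^-1) by move=> k; have [] := H k.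
elim: k => [|k [IH1 IH2]].
  split=> x Ux; first exact/differentiable_continuous/rd.
  by apply: continuousV; [exact: rho0|exact/differentiable_continuous/rd].
have qk v : Ck_on k U (fun x => 'D_v q x) by have [_] := qs k.+1; exact.
split; split.
- by move=> x Ux; exact: rd.
- move=> v; apply: (@Ck_on_eq _ _ _ (fun x => 'D_v q x * (2^-1 * (rho x)^-1))) => //.
    by move=> x Ux; have [_ ->] := rD x v Ux; rewrite invfM.
  by apply: Ck_onM => //; apply: (Ck_onM (f := cst 2^-1)) => //; exact: Ck_on_cst.
- by move=> x Ux; apply: differentiableV; [exact: rd|exact: rho0].
- move=> v; apply: (@Ck_on_eq _ _ _ (fun x => 'D_v q x * (- 2^-1 *
     ((rho x)^-1 * ((rho x)^-1 * (rho x)^-1))))) => //.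
    move=> x Ux; have [dr1 dr2] := rD x v Ux.
    rewrite deriveV ?rho0// dr2 /GRing.scale/=.
    by field; exact: rho0.
  apply: Ck_onM => //; apply: (Ck_onM (f := cst (- 2^-1))) => //; first exact: Ck_on_cst.
  by apply: Ck_onM => //; apply: Ck_onM.
Qed.

End smoothness.

Lemma smooth_linear (R : realType) m (W : normedModType R)
    (f : {linear 'rV[R]_m -> W}) (U : set 'rV[R]_m) : smooth_on U f.
Proof.
case=> [x _|k /=]; first exact: linear_rV_continuous.
split=> [x _|v]; first exact: linear_rV_differentiable.
rewrite (_ : (fun x => _) = cst (f v)); first exact: Ck_on_cst.
by apply/funext => x; have [] := linear_rV_derive f x v.
Qed.

(** * Orthogonality, rank and sign in pseudo-Euclidean space *)

Section pseudo_Euclidean_algebra.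
Variables (R : realType) (q N : nat).
Implicit Types x y z w : 'rV[R]_N.

(** In the sequel [A *m eta_mx *m w^T = 0] expresses that [w] is orthogonal to all rows of [A]. *)
Definition eta_mx : 'M[R]_N := diag_mx (\row_(i < N) (-1) ^+ (i < q)%N).

Lemma pformE x y : pform q x y = (x *m eta_mx *m y^T) 0 0.
Proof.
rewrite /pform mxE; apply: eq_bigr => i _.
by rewrite mul_mx_diag !mxE [x 0 i * _]mulrC.
Qed.

Lemma trmx_eta : eta_mx^T = eta_mx. Proof. exact: tr_diag_mx. Qed.

Lemma eta_eta : eta_mx *m eta_mx = 1%:M.
Proof.
rewrite /eta_mx mulmx_diag -diag_const_mx; congr diag_mx; apply/rowP => i.
by rewrite !mxE -expr2 sqrr_sign.
Qed.

Lemma eta_unit : eta_mx \in unitmx. Proof. exact: (mulmx1_unit eta_eta).1. Qed.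

Lemma eta_entry a b (A : 'M[R]_(a, N)) (B : 'M[R]_(b, N)) i j :
  (A *m eta_mx *m B^T) i j = pform q (row i A) (row j B).
Proof.
rewrite pformE -row_mul [LHS]mxE [RHS]mxE.
by apply: eq_bigr => k _; rewrite !mxE.
Qed.

Lemma pformC x y : pform q x y = pform q y x.
Proof. by apply: eq_bigr => i _; rewrite mulrAC. Qed.

Lemma pformDl x y z : pform q (x + y) z = pform q x z + pform q y z.
Proof.
rewrite -big_split/=; apply: eq_bigr => i _.
by rewrite mxE mulrDr mulrDl.
Qed.

Lemma pformZl (k : R) x z : pform q (k *: x) z = k * pform q x z.
Proof. by rewrite mulr_sumr; apply: eq_bigr => i _; rewrite mxE mulrCA !mulrA. Qed.

Lemma pformDr x y z : pform q x (y + z) = pform q x y + pform q x z.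
Proof. by rewrite pformC pformDl !(pformC x). Qed.

Lemma pformZr (k : R) x z : pform q x (k *: z) = k * pform q x z.
Proof. by rewrite pformC pformZl pformC. Qed.

Lemma pformNl x z : pform q (- x) z = - pform q x z.
Proof. by rewrite -scaleN1r pformZl mulN1r. Qed.

Lemma pformNr x z : pform q x (- z) = - pform q x z.
Proof. by rewrite pformC pformNl pformC. Qed.

Lemma pform0l x : pform q 0 x = 0.
Proof. by rewrite -(scale0r 0) pformZl mul0r. Qed.

Lemma pform0r x : pform q x 0 = 0.
Proof. by rewrite pformC pform0l. Qed.

Definition pformDZ :=
  (pformDl, pformDr, pformNl, pformNr, pformZl, pformZr, pform0l, pform0r).

Lemma pform_mulmx k (v : 'rV[R]_k) (A : 'M[R]_(k, N)) (w : 'rV[R]_N) :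
  A *m eta_mx *m w^T = 0 -> pform q (v *m A) w = 0.
Proof. by move=> Aw; rewrite pformE -!mulmxA [A *m _]mulmxA Aw mulmx0 mxE. Qed.

Lemma eta_col0P k (A : 'M[R]_(k, N)) w :
  A *m eta_mx *m w^T = 0 <-> forall i, pform q (row i A) w = 0.
Proof.
split=> [A0 i|A0].
  have := congr1 (fun M : 'M[R]_(k, 1) => M i 0) A0.
  by rewrite eta_entry row_id mxE.
by apply/matrixP => i j; rewrite eta_entry ord1 row_id A0 mxE.
Qed.

(** The columns of the cokernel matrix of [W], multiplied by [eta_mx], are vectors orthogonal to
    [W]; testing [y] on them is testing membership in the row space. *)
Lemma double_orthogonal k (W : 'M[R]_(k, N)) y :
  (forall w, W *m eta_mx *m w^T = 0 -> pform q y w = 0) -> (y <= W)%MS.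
Proof.
move=> Wy; rewrite submxE; apply/eqP/matrixP => i j; rewrite ord1 [RHS]mxE.
have := Wy ((eta_mx *m col j (cokermx W))^T).
have eC k' (X : 'M[R]_(k', N)) : X *m eta_mx *m (eta_mx *m col j (cokermx W)) =
    col j (X *m cokermx W).
  by rewrite -!mulmxA (mulmxA eta_mx) eta_eta mul1mx !colE mulmxA.
rewrite pformE trmxK !eC mulmx_coker => Wj.
have := Wj; rewrite [X in X = 0]colE mul0mx => /(_ erefl).
by rewrite mxE.
Qed.

Lemma pform_nondegenerate y : (forall w, pform q y w = 0) -> y = 0.
Proof.
move=> y0; suff: y *m eta_mx = 0.
  by move=> /(congr1 (mulmx^~ eta_mx)); rewrite -mulmxA eta_eta mulmx1 mul0mx.
apply/rowP => i; have := y0 (delta_mx 0 i).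
by rewrite pformE trmx_delta -colE !mxE.
Qed.

Lemma rank_orthogonal k (W : 'M[R]_(k, N)) :
  \rank (kermx (eta_mx *m W^T)) = (N - \rank W)%N.
Proof.
rewrite mxrank_ker; congr (_ - _)%N.
by rewrite -mxrank_tr trmx_mul trmxK trmx_eta mxrankMfree// row_free_unit eta_unit.
Qed.

Lemma kernel_vector k l (A : 'M[R]_(k, l)) : (l < k)%N ->
  exists2 v : 'rV[R]_k, v != 0 & v *m A = 0.
Proof.
move=> lk; have : kermx A != 0.
  by rewrite kermx_eq0 /row_free neq_ltn (leq_ltn_trans (rank_leq_col A) lk).
by case/rowV0Pn => v vk v0; exists v => //; exact/sub_kermxP.
Qed.

(** With more than [q] rows, some nontrivial combination has its first [q] coordinates equal to 0,
    and the form is nonnegative there. *)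
Lemma negative_dim k (A : 'M[R]_(k, N)) :
  (forall v : 'rV[R]_k, v != 0 -> pform q (v *m A) (v *m A) < 0) -> (k <= q)%N.
Proof.
move=> An; rewrite leqNgt; apply/negP => qk.
pose B : 'M[R]_(N, q) := \matrix_(i, j) (i == j :> nat)%:R.
have [v v0 vAB] := kernel_vector (A *m B) qk.
have := An _ v0; rewrite ltNge => /negP; apply.
apply: sumr_ge0 => i _; case: ltnP => iq; last first.
  by rewrite expr0 mul1r -expr2 sqr_ge0.
rewrite (_ : (v *m A) 0 i = 0) ?mulr0//.
have := congr1 (fun M : 'rV[R]_q => M 0 (Ordinal iq)) vAB.
rewrite mulmxA /= [LHS]mxE (bigD1 i)//= [B _ _]mxE eqxx mulr1 [RHS]mxE.
rewrite big1 ?addr0// => j ji.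
by rewrite [B _ _]mxE (negbTE ji : (j == i :> nat) = false) mulr0.
Qed.

(** [K] cuts out the combinations whose [N - q] positive coordinates vanish; on them the form is
    minus a sum of squares. *)
Lemma nonpositive_dim k (A : 'M[R]_(k, N)) :
  exists2 K : 'M[R]_k, (k <= \rank K + (N - q))%N &
  forall v : 'rV[R]_k, (v <= K)%MS -> v *m A != 0 -> pform q (v *m A) (v *m A) < 0.
Proof.
pose B : 'M[R]_(N, (N - q)%N) := \matrix_(i, j) ((i == q + j :> nat)%N)%:R.
exists (kermx (A *m B)).
  by rewrite mxrank_ker addnC -leq_subLR leq_sub2l// rank_leq_col.
move=> v /sub_kermxP; rewrite mulmxA; move: (v *m A) => {v}x xB x0.
have xq (i : 'I_N) : (q <= i)%N -> x 0 i = 0.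
  move=> qi; have iq : (i - q < N - q)%N by rewrite ltn_sub2r// (leq_ltn_trans qi).
  have := congr1 (fun M : 'rV[R]_(N - q) => M 0 (Ordinal iq)) xB.
  rewrite /= [LHS]mxE (bigD1 i)//= [B _ _]mxE/= subnKC// eqxx mulr1 [RHS]mxE.
  rewrite big1 ?addr0// => j ji.
  by rewrite [B _ _]mxE/= subnKC// (negbTE ji : (j == i :> nat) = false) mulr0.
have /rV0Pn[j xj] := x0.
have jq : (j < q)%N by rewrite ltnNge; apply: contra xj => /xq ->.
have E (i : 'I_N) : (-1) ^+ (i < q)%N * x 0 i * x 0 i = - (x 0 i) ^+ 2.
  case: ltnP => iq; first by rewrite expr1 mulN1r mulNr expr2.
  by rewrite xq// !mulr0 expr0n oppr0.
rewrite /pform; under eq_bigr do rewrite E.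
rewrite sumrN oppr_lt0 (bigD1 j)//= ltr_pwDl ?sumr_ge0//.
  by rewrite lt_def sqrf_eq0 xj sqr_ge0.
by move=> i _; rewrite sqr_ge0.
Qed.

End pseudo_Euclidean_algebra.

(** * Bounds on the index of a tangent space and its orthogonal complement *)

Section index.
Variables (R : realType) (q N m s : nat) (J : 'M[R]_(m, N)).
Hypothesis Gs : metric_of_index s (J *m eta_mx R q N *m J^T).

(** A negative subspace of dimension [s] in the row space of [J], added to the orthogonal negative
    rows of [Y], is still negative definite. *)
Lemma index_lower_bound k (Y : 'M[R]_(k, N)) :
  J *m eta_mx R q N *m Y^T = 0 ->
  (forall v : 'rV[R]_k, v != 0 -> pform q (v *m Y) (v *m Y) < 0) ->
  (s + k <= q)%N.
Proof.
case: Gs => _ _ [W rW Wn] _ JY Yn.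
have [B BW Bf] : exists2 B : 'M[R]_(s, m), (B <= W)%MS & row_free B.
  by rewrite -rW; exists (row_base W); rewrite ?eq_row_base ?row_base_free.
apply: (@negative_dim _ _ _ _ (col_mx (B *m J) Y)) => v v0.
rewrite -[v]hsubmxK mul_row_col; set a := lsubmx v; set b := rsubmx v.
have ab : pform q (a *m (B *m J)) (b *m Y) = 0.
  rewrite pformE trmx_mul -!mulmxA (mulmxA J) (mulmxA (J *m _)) JY.
  by rewrite mul0mx !mulmx0 mxE.
rewrite pformDl !pformDr ab pformC ab addr0 add0r.
have aE : pform q (a *m (B *m J)) (a *m (B *m J)) =
    (a *m B *m (J *m eta_mx R q N *m J^T) *m (a *m B)^T) 0 0.
  by rewrite pformE !trmx_mul !mulmxA.
have [a0|a0] := eqVneq a 0.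
  rewrite a0 !mul0mx pform0l add0r; apply: Yn.
  by apply: contra v0 => /eqP b0; rewrite -[v]hsubmxK -/a -/b a0 b0 row_mx0.
have aneg : pform q (a *m (B *m J)) (a *m (B *m J)) < 0.
  rewrite aE; apply: Wn; first exact: submx_trans (submxMl _ _) BW.
  by rewrite mulmx_free_eq0.
have [b0|b0] := eqVneq b 0; first by rewrite b0 mul0mx pform0l addr0.
by move: (Yn _ b0) aneg; lra.
Qed.

(** A negative subspace of the span of [J] and [Z] projects injectively to the [J] part, where it
    remains negative because [Z] only contributes nonnegative terms; maximality of [s] bounds its
    dimension. *)
Lemma index_upper_bound k (Z : 'M[R]_(k, N)) :
  J *m eta_mx R q N *m Z^T = 0 ->
  (forall v : 'rV[R]_k, v != 0 -> 0 < pform q (v *m Z) (v *m Z)) ->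
  (m + k <= s + (N - q))%N.
Proof.
case: Gs => _ Gu _ Ws JZ Zp.
have [K rK Kn] := nonpositive_dim q (col_mx J Z).
apply: (leq_trans rK); rewrite leq_add2r.
have split_form (v : 'rV[R]_(m + k)) :
    pform q (v *m col_mx J Z) (v *m col_mx J Z) =
    (lsubmx v *m (J *m eta_mx R q N *m J^T) *m (lsubmx v)^T) 0 0
    + pform q (rsubmx v *m Z) (rsubmx v *m Z).
  rewrite -{1 2}[v]hsubmxK mul_row_col; set a := lsubmx v; set b := rsubmx v.
  have ab : pform q (a *m J) (b *m Z) = 0.
    rewrite pformE trmx_mul -!mulmxA (mulmxA J) (mulmxA (J *m _)) JZ.
    by rewrite mul0mx !mulmx0 mxE.
  rewrite pformDl !pformDr ab pformC ab addr0 add0r; congr (_ + _).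
  by rewrite pformE !trmx_mul !mulmxA.
have Zge (b : 'rV[R]_k) : 0 <= pform q (b *m Z) (b *m Z).
  by have [->|b0] := eqVneq b 0; [rewrite mul0mx pform0l|rewrite ltW// Zp].
have vA (v : 'rV[R]_(m + k)) : v *m col_mx J Z = 0 -> v = 0.
  rewrite -[v]hsubmxK mul_row_col; set a := lsubmx v; set b := rsubmx v => v0.
  have a0 : a = 0.
    have := congr1 (fun x => x *m (eta_mx R q N *m J^T)) v0.
    rewrite mul0mx mulmxDl -!mulmxA.
    have -> : Z *m (eta_mx R q N *m J^T) = 0.
      by apply: trmx_inj; rewrite !trmx_mul trmxK trmx_eta trmx0.
    by rewrite mulmx0 addr0 => aG; rewrite -(mulmxK Gu a) -(mulmxA J) aG mul0mx.
  move: v0; rewrite a0 mul0mx add0r => bZ.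
  have [->|b0] := eqVneq b 0; first by rewrite row_mx0.
  by have := Zp _ b0; rewrite bZ pform0l ltxx.
have Klneg (v : 'rV[R]_(m + k)) : (v <= K)%MS -> v != 0 ->
    (lsubmx v *m (J *m eta_mx R q N *m J^T) *m (lsubmx v)^T) 0 0 < 0.
  move=> vK v0; have := Kn _ vK; rewrite split_form => h.
  have {}h := h (contra_neq (vA v) v0).
  by have := Zge (rsubmx v); lra.
have lE a (X : 'M[R]_(a, m + k)) : lsubmx X = X *m lsubmx 1%:M.
  by rewrite mulmx_lsub mulmx1.
(* A vector of [K] with zero [J] part would have negative value 0, so the projection has trivial
   kernel on [K]. *)
have <- : \rank (lsubmx K) = \rank K.
  rewrite lE; apply/mxrank_injP/rowV0P => v.
  rewrite sub_capmx => /andP[vK /sub_kermxP v1].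
  apply/eqP; apply: contraT => v0; have := Klneg v vK v0.
  by rewrite lE v1 !mul0mx mxE ltxx.
rewrite -mxrank_gen; apply: Ws => w; rewrite genmxE => /submxP[D wD] w0.
have wE : w = lsubmx (D *m K) by rewrite wD mulmx_lsub.
rewrite wE; apply: Klneg; first exact: submxMl.
by apply: contra w0 => /eqP DK; rewrite wE DK lE mul0mx.
Qed.

End index.

(** * Linear isometries from reflections *)

Section reflections.
Variables (R : realType) (q N : nat).
Implicit Types x y z w : 'rV[R]_N.
Local Notation E := (eta_mx R q N).

Definition isometry_mx (A : 'M[R]_N) := A *m E *m A^T = E.

Lemma isometry_mxP A : isometry_mx A ->
  forall x y, pform q (x *m A) (y *m A) = pform q x y.
Proof.
by move=> AE x y; rewrite !pformE trmx_mul -[in RHS]AE !mulmxA.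
Qed.

Lemma isometry_mxM A B : isometry_mx A -> isometry_mx B -> isometry_mx (A *m B).
Proof.
rewrite /isometry_mx => AE BE.
by rewrite trmx_mul !mulmxA -(mulmxA A) -(mulmxA A) BE AE.
Qed.

Lemma isometry_mx_unit A : isometry_mx A -> A \in unitmx.
Proof.
rewrite /isometry_mx => AE; have : A *m (E *m A^T *m E) = 1%:M.
  by rewrite !mulmxA AE eta_eta.
by move/mulmx1_unit => [].
Qed.

Lemma isometry_mxV A : isometry_mx A -> isometry_mx (invmx A).
Proof.
move=> AE; have Au := isometry_mx_unit AE; rewrite /isometry_mx -{1}AE.
by rewrite !mulmxA mulVmx// mul1mx -mulmxA -trmx_mul mulVmx// trmx1 mulmx1.
Qed.

Lemma isometry_mxI A : (forall x y, pform q (x *m A) (y *m A) = pform q x y) ->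
  isometry_mx A.
Proof.
move=> Axy; apply/matrixP => i j.
have := Axy (delta_mx 0 i) (delta_mx 0 j); rewrite -!rowE -eta_entry => ->.
by rewrite pformE -rowE trmx_delta -colE !mxE.
Qed.

Lemma reflection w : pform q w w != 0 ->
  exists2 A, isometry_mx A &
    forall x, x *m A = x - (2 * pform q x w / pform q w w) *: w.
Proof.
move=> w0; pose A : 'M[R]_N := 1%:M - (2 / pform q w w) *: (E *m w^T *m w).
have AE x : x *m A = x - (2 * pform q x w / pform q w w) *: w.
  rewrite mulmxBr mulmx1 -scalemxAr !mulmxA (mx11_scalar (x *m E *m w^T)).
  by rewrite -pformE mul_scalar_mx scalerA mulrAC.
exists A => //; apply: isometry_mxI => x y; rewrite !AE.
rewrite !pformDZ (pformC _ w y).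
by move: (pform q w w) (pform q x w) (pform q y w) (pform q x y) w0 => a b c d a0; field.
Qed.

(** The reflection in [x - y] exchanges [x] and [y]. If [x - y] is null then [x + y] is not, since
    their norms add up to [4 <y, y>]; the reflection in [x + y] sends [x] to [- y], and the one in
    [y] corrects the sign. The last clause allows successive moves that do not disturb one
    another. *)
Lemma isometry_move x y : pform q x x = pform q y y -> pform q y y != 0 ->
  exists A, [/\ isometry_mx A, x *m A = y &
    forall z, pform q z x = 0 -> pform q z y = 0 -> z *m A = z].
Proof.
move=> xy y0.
have [b0|b0] := eqVneq (pform q (x - y) (x - y)) 0; last first.
  have k1 : 2 * pform q x (x - y) / pform q (x - y) (x - y) = 1.
    move: b0; rewrite !pformDZ (pformC _ y x) xy.
    move: (pform q y y) (pform q x y) => a b b0; rewrite -[RHS](divff b0); congr (_ / _).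
    by ring.
  have [A AE Ax] := reflection b0; exists A; split=> // [|z zx zy].
    by rewrite Ax k1 scale1r opprB addrCA subrr addr0.
  by rewrite Ax pformDr pformNr zx zy subrr mulr0 mul0r scale0r subr0.
have c0 : pform q (x + y) (x + y) != 0.
  have -> : pform q (x + y) (x + y) = 4 * pform q y y - pform q (x - y) (x - y).
    by rewrite !pformDZ (pformC _ y x) xy; move: (pform q y y) (pform q x y) => a b; ring.
  by rewrite b0 subr0 mulf_neq0// pnatr_eq0.
have k1 : 2 * pform q x (x + y) / pform q (x + y) (x + y) = 1.
  move: c0; rewrite !pformDZ (pformC _ y x) xy.
  move: (pform q y y) (pform q x y) => a b c0; rewrite -[RHS](divff c0); congr (_ / _).
  by ring.
have [A AE Ax] := reflection c0; have [B BE Bx] := reflection y0.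
exists (A *m B); split=> [||z zx zy]; first exact: isometry_mxM.
  rewrite mulmxA Ax k1.
  rewrite scale1r opprD addrA subrr sub0r Bx pformNl mulrN mulNr mulfK//.
  by rewrite scaleNr opprK scaler_nat mulr2n addKr.
rewrite mulmxA Ax pformDr zx zy addr0 mulr0 mul0r scale0r subr0.
by rewrite Bx zy mulr0 mul0r scale0r subr0.
Qed.

Lemma isometry_move2 x1 x2 y1 y2 :
  pform q x1 x1 = pform q y1 y1 -> pform q x2 x2 = pform q y2 y2 ->
  pform q y1 y1 != 0 -> pform q y2 y2 != 0 ->
  pform q x1 x2 = 0 -> pform q y1 y2 = 0 ->
  exists A, [/\ isometry_mx A, x1 *m A = y1 & x2 *m A = y2].
Proof.
move=> h1 h2 n1 n2 x12 y12.
have [A [AE Ax _]] := isometry_move h1 n1.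
have h3 : pform q (x2 *m A) (x2 *m A) = pform q y2 y2 by rewrite isometry_mxP.
have [B [BE Bx Bz]] := isometry_move h3 n2.
exists (A *m B); split; first exact: isometry_mxM.
  by rewrite mulmxA Ax Bz// -Ax isometry_mxP.
by rewrite mulmxA.
Qed.

End reflections.

(** * Matrix identities for higher derivatives of a patch *)

Section symmetric_derivative_mx.
Variables (R : realType) (V : normedModType R) (a b : nat).

Lemma derive_entry (F : V -> 'M[R]_(a, b)) u v i j :
  derivable F u v -> 'D_v F u i j = 'D_v (fun x => F x i j : R) u.
Proof. by move=> Fd; rewrite derive_mx// mxE. Qed.

Lemma differentiable_entry (F : V -> 'M[R]_(a, b)) u i j :
  differentiable F u -> differentiable (fun x => F x i j : R) u.
Proof.
move=> Fd; apply: (@differentiable_comp _ _ _ _ F (fun X => X i j : R)) => //.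
exact: differentiable_coord.
Qed.

Lemma symmetric_derive_mx (F : V -> 'M[R]_(a, b)) (U : set V) u v w :
  open U -> U u -> (forall x, U x -> differentiable F x) ->
  (forall v x, U x -> differentiable ('D_v F) x) ->
  'D_w ('D_v F) u = 'D_v ('D_w F) u.
Proof.
move=> oU Uu F1 F2; apply/matrixP => i j.
have E v' w' : 'D_w' ('D_v' F) u i j = 'D_w' (fun x => 'D_v' (fun x => F x i j : R) x) u.
  rewrite derive_entry; last exact/diff_derivable/F2.
  apply: near_eq_derive; near=> x; rewrite derive_entry//.
  by apply/diff_derivable/F1; near: x; exact: open_nbhs_nbhs.
have D v' x : U x -> differentiable (fun x => 'D_v' (fun x => F x i j : R) x : R) x.
  move=> Ux; apply: (@near_eq_differentiable _ _ _ (fun x => 'D_v' F x i j)).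
    near=> y; rewrite derive_entry//.
    by apply/diff_derivable/F1; near: y; exact: open_nbhs_nbhs.
  exact: differentiable_entry (F2 _ _ Ux).
have d v' x : U x -> derivable (fun x => F x i j : R) x v'.
  by move=> Ux; apply/diff_derivable/differentiable_entry/F1.
apply: etrans (E v w) _.
apply: etrans _ (esym (E w v)).
exact: (@symmetric_derive _ _ _ _ _ v w oU Uu (d v) (d w) (D v u Uu) (D w u Uu)).
Unshelve. all: by end_near. Qed.

End symmetric_derivative_mx.

(** Here [I] stands for the inverse Gram matrix and [A] for the derivative of [J]. The product rule
    is regrouped so that every [A] meets the normal projection, the only part of the Hessian that
    umbilicity controls. *)
Lemma normal_proj_derivative_algebra (R : realType) m N (S : 'M[R]_N)
    (A J : 'M[R]_(m, N)) (I : 'M[R]_m) :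
  (S *m A^T *m I + S *m J^T *m - (I *m (A *m S *m J^T + J *m S *m A^T) *m I)) *m J
    + S *m J^T *m I *m A =
  (1%:M - S *m J^T *m I *m J) *m S *m A^T *m I *m J
    + S *m J^T *m I *m A *m (1%:M - S *m J^T *m I *m J).
Proof.
rewrite mulmxBr mulmx1 !mulmxBl mul1mx.
rewrite [I *m (_ + _)]mulmxDr [X in - X]mulmxDl mulmxN mulmxDr opprD !mulmxDl !mulNmx !mulmxA.
set a := S *m A^T *m I *m J; set b := S *m J^T *m I *m A.
set c := b *m S *m J^T *m I *m J; set d := S *m J^T *m I *m J *m S *m A^T *m I *m J.
by rewrite [- c - d]addrC -!addrA [b - c]addrC.
Qed.

Lemma is_derive_pform (R : realType) (V : normedModType R) q k (F F' : V -> 'rV[R]_k) dF dF' a x :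
  is_derive a x F dF -> is_derive a x F' dF' ->
  is_derive a x (fun y => pform q (F y) (F' y) : R) (pform q dF (F' a) + pform q (F a) dF').
Proof.
move=> Fd Fd'; have := is_derive_mulmx (is_derive_mulmx Fd
  (is_derive_cst (eta_mx R q k) a x)) (is_derive_trmx Fd').
rewrite /cst mulmx0 addr0 => /is_derive_mxP/(_ 0 0); rewrite mxE -!pformE.
by under eq_fun => y do rewrite -pformE.
Qed.

(** [T] and [h] are the third and second derivatives, [P] the normal projection. The hypothesis is
    the derivative of the umbilicity equation; applying [P] kills the term ending in [J], and
    umbilicity turns the other derivative of [P] into a multiple of [N0]. *)
Lemma codazzi_algebra (R : realType) m N (T h N0 dN : 'rV[R]_N) (S P : 'M[R]_N)
    (A J : 'M[R]_(m, N)) (G : 'M[R]_m) (x : 'rV[R]_m) (Gd g : 'M[R]_1) :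
  G \in unitmx -> G^T = G -> J *m P = 0 -> P *m P = P -> N0 *m P = N0 ->
  A *m P = (x *m G)^T *m N0 ->
  T *m P + h *m - (S *m (A *m P)^T *m invmx G *m J + S *m J^T *m invmx G *m A *m P)
    = Gd *m N0 + g *m dN ->
  T *m P = (Gd + h *m S *m (x *m J)^T) *m N0 + g *m (dN *m P).
Proof.
move=> Gu Gs JP PP NP AP /(congr1 (mulmx^~ P)); rewrite mulmxDl -(mulmxA T) PP => H.
have Z : h *m - (S *m (A *m P)^T *m invmx G *m J + S *m J^T *m invmx G *m A *m P) *m P
    = - (h *m S *m (x *m J)^T *m N0).
  rewrite mulmxN mulNmx; congr (- _).
  rewrite -mulmxA mulmxDl -(mulmxA _ J) JP mulmx0 add0r.
  rewrite -(mulmxA _ P) PP -(mulmxA _ A) AP !trmx_mul Gs.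
  by rewrite -!mulmxA (mulmxA (invmx G)) mulVmx// mul1mx.
move: H; rewrite Z => /eqP; rewrite subr_eq => /eqP ->.
rewrite [in LHS]mulmxDl -(mulmxA Gd) NP -(mulmxA g) [LHS]addrAC; congr (_ + _).
by rewrite [RHS]mulmxDl.
Qed.

(** * Umbilical patches: Codazzi equation and constant quantities *)

Section immersed_patch.
Variables (R : realType) (m n p : nat).
Local Notation E := (eta_mx R p.+1 n.+1).
Implicit Types (f : 'rV[R]_m -> 'rV[R]_n.+1) (u v w x : 'rV[R]_m).

Definition tangent_mx f u : 'M[R]_(m, n.+1) := \matrix_(a < m) partial a f u.

Definition hessian_mx f v u : 'M[R]_(m, n.+1) :=
  \matrix_(a < m) 'D_v (partial a f) u.

(* Acting on the right: the orthogonal projection onto the normal space of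
   the patch inside the vector space. *)
Definition normal_proj f u : 'M[R]_n.+1 :=
  1%:M - E *m (tangent_mx f u)^T *m invmx (induced_gram p f u) *m tangent_mx f u.

Lemma induced_gramE f u :
  induced_gram p f u = tangent_mx f u *m E *m (tangent_mx f u)^T.
Proof. by apply/matrixP => a b; rewrite eta_entry !mxE !rowK. Qed.

Lemma tr_induced_gram f u : (induced_gram p f u)^T = induced_gram p f u.
Proof. by rewrite !induced_gramE !trmx_mul trmxK trmx_eta mulmxA. Qed.

Variables (f : 'rV[R]_m -> 'rV[R]_n.+1) (U : set 'rV[R]_m).
Hypotheses (oU : open U) (fs : smooth_on U f).
Hypothesis fH : forall u, U u -> pform p.+1 (f u) (f u) = - 1.
Hypothesis Gu : forall u, U u -> induced_gram p f u \in unitmx.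

Local Notation J := (tangent_mx f).
Local Notation A := (hessian_mx f).
Local Notation G := (induced_gram p f).
Local Notation Pi := (normal_proj f).

Lemma patch_differentiable u : U u -> differentiable f u.
Proof. by have [fd _] := fs 1%N; exact: fd. Qed.

Lemma patch_differentiable1 v u : U u -> differentiable ('D_v f) u.
Proof. by have [_ /(_ v) [fd _]] := fs 2%N; exact: fd. Qed.

Lemma patch_differentiable2 v w u : U u -> differentiable ('D_w ('D_v f)) u.
Proof. by have [_ /(_ v) [_ /(_ w) [fd _]]] := fs 3%N; exact: fd. Qed.

Lemma patch_derive u v : U u -> is_derive u v f (v *m J u).
Proof.
move=> Uu; have fd := patch_differentiable Uu; split; first exact: diff_derivable.
rewrite [v in 'D_v _ _]row_sum_delta deriveE// linear_sum/= mulmx_sum_row.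
apply: eq_bigr => a _; rewrite linearZ/= rowK /partial.
by rewrite deriveE.
Qed.

Lemma patch_derivE u v : U u -> 'D_v f u = v *m J u.
Proof. by move=> /(patch_derive v)[]. Qed.

Lemma tangent_mx_derive u v : U u -> is_derive u v J (A v u).
Proof.
move=> Uu; apply/is_derive_mxP => a j.
have fd := patch_differentiable1 (ebase R a) Uu.
have -> : (fun x => J x a j) = (fun x => 'D_(ebase R a) f x 0 j).
  by apply/funext => x; rewrite mxE.
have /derivableP/is_derive_mxP/(_ 0 j) := @diff_derivable _ _ _ _ _ v fd.
by rewrite [A v u a j]mxE.
Qed.

Lemma patch_derivE2 u v w : U u -> 'D_v ('D_w f) u = w *m A v u.
Proof.
move=> Uu.
have : is_derive u v (fun x => w *m J x) (0 *m J u + w *m A v u).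
  exact: is_derive_mulmx (is_derive_cst _ _ _) (tangent_mx_derive _ Uu).
rewrite mul0mx add0r => -[_ <-]; apply: near_eq_derive; near=> x.
by rewrite patch_derivE//; near: x; exact: open_nbhs_nbhs.
Unshelve. all: by end_near. Qed.

Lemma hessian_sym u v w : U u -> w *m A v u = v *m A w u.
Proof.
move=> Uu; apply: etrans (esym (patch_derivE2 v w Uu)) _.
apply: etrans _ (patch_derivE2 w v Uu).
exact: (symmetric_derive_mx w v oU Uu patch_differentiable patch_differentiable1).
Qed.

Lemma third_derivative_sym u v w x : U u ->
  'D_x ('D_v ('D_w f)) u = 'D_w ('D_v ('D_x f)) u.
Proof.
move=> Uu.
have S v' w' y : U y -> 'D_v' ('D_w' f) y = 'D_w' ('D_v' f) y.
  move=> Uy.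
  exact: (symmetric_derive_mx w' v' oU Uy patch_differentiable patch_differentiable1).
have near_S x' v' w' : 'D_x' ('D_v' ('D_w' f)) u = 'D_x' ('D_w' ('D_v' f)) u.
  by apply: near_eq_derive; near=> y; apply: S; near: y; exact: open_nbhs_nbhs.
apply: etrans (near_S x v w) _; apply: etrans _ (near_S w x v).
exact: (symmetric_derive_mx w x oU Uu (@patch_differentiable1 v) (@patch_differentiable2 v)).
Unshelve. all: by end_near. Qed.

Lemma gram_derive u v : U u ->
  is_derive u v G (A v u *m E *m (J u)^T + J u *m E *m (A v u)^T).
Proof.
move=> Uu; have Jd := tangent_mx_derive v Uu.
have := is_derive_mulmx (is_derive_mulmx Jd (is_derive_cst E u v)) (is_derive_trmx Jd).
rewrite /cst mulmx0 addr0.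
by under eq_fun => x do rewrite -induced_gramE.
Qed.

Lemma normal_proj_tangent u : U u -> J u *m Pi u = 0.
Proof.
move=> Uu; rewrite /normal_proj mulmxBr mulmx1 !mulmxA -induced_gramE.
by rewrite mulmxV ?Gu// mul1mx subrr.
Qed.

Lemma normal_proj_normal k (Y : 'M[R]_(k, n.+1)) u :
  Y *m E *m (J u)^T = 0 -> Y *m Pi u = Y.
Proof.
by move=> YJ; rewrite /normal_proj mulmxBr mulmx1 !mulmxA YJ !mul0mx subr0.
Qed.

Lemma normal_proj_orthogonal k (Y : 'M[R]_(k, n.+1)) u : U u ->
  Y *m Pi u *m E *m (J u)^T = 0.
Proof.
move=> Uu; rewrite /normal_proj mulmxBr mulmx1 !mulmxBl !mulmxA.
rewrite -!(mulmxA _ (J u)) -(mulmxA _ (J u *m E)) -induced_gramE.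
by rewrite mulmxKV ?Gu// subrr.
Qed.

Lemma eta_normal_proj u : Pi u *m E = E *m (Pi u)^T.
Proof.
rewrite /normal_proj mulmxBl mul1mx linearB/= trmx1 mulmxBr mulmx1.
by rewrite !trmx_mul trmxK trmx_eta trmx_inv tr_induced_gram !mulmxA.
Qed.

Lemma normal_proj_derive u v : U u -> is_derive u v Pi
  (- (E *m (A v u *m Pi u)^T *m invmx (G u) *m J u
      + E *m (J u)^T *m invmx (G u) *m A v u *m Pi u)).
Proof.
move=> Uu; have Jd := tangent_mx_derive v Uu.
have Id := is_derive_invmx oU Uu Gu (gram_derive v Uu).
have T1 := is_derive_mulmx (is_derive_cst E u v) (is_derive_trmx Jd).
have := is_derive_mulmx (is_derive_mulmx T1 Id) Jd.
move=> /(is_deriveB (is_derive_cst (1%:M : 'M[R]_n.+1) u v)).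
move=> h; apply: (is_derive_eq h); rewrite sub0r /cst mul0mx add0r; congr (- _).
rewrite trmx_mul mulmxA -eta_normal_proj /normal_proj.
exact: normal_proj_derivative_algebra.
Qed.

Variable N : 'rV[R]_m -> 'rV[R]_n.+1.
Hypothesis NPi : forall u, U u -> N u *m Pi u = N u.
Hypothesis umbilic : forall u v w, U u ->
  'D_v ('D_w f) u *m Pi u = v *m G u *m w^T *m N u.

Lemma umbilic_normal u : U u -> N u *m E *m (J u)^T = 0.
Proof. by move=> Uu; rewrite -(NPi Uu) normal_proj_orthogonal. Qed.

Lemma trmx11 (B : 'M[R]_1) : B^T = B.
Proof. by apply/matrixP => i j; rewrite !ord1 mxE. Qed.

Lemma umbilic_hessian u v : U u -> A v u *m Pi u = (v *m G u)^T *m N u.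
Proof.
move=> Uu; apply/row_matrixP => a; rewrite !rowE mulmxA -patch_derivE2//.
by rewrite umbilic// -[X in X *m N u = _]trmx11 trmx_mul trmxK mulmxA.
Qed.

Lemma normal_projK u : U u -> Pi u *m Pi u = Pi u.
Proof.
move=> Uu; apply: normal_proj_normal.
by rewrite -[X in X *m E]mul1mx normal_proj_orthogonal.
Qed.

(** Contracting the umbilicity equation with the inverse Gram matrix writes [N] through first and
    second derivatives of [f], so three derivatives of [f] suffice. *)
Lemma umbilic_derivable u x : (1 < m)%N -> U u -> derivable N u x.
Proof.
move=> m2 Uu; pose c : 'I_m := Ordinal (ltnW m2).
have NE y : U y -> N y = delta_mx 0 c *m invmx (G y) *m A (delta_mx 0 c) y *m Pi y.
  move=> Uy; rewrite -mulmxA umbilic_hessian// mulmxA trmx_mul tr_induced_gram.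
  rewrite mulmxA mulmxKV ?Gu// trmx_delta mul_delta_mx.
  by rewrite (_ : delta_mx 0 0 = 1%:M) ?mul1mx//; apply/matrixP => i j; rewrite !ord1 !mxE.
have Ad : is_derive u x (A (delta_mx 0 c)) (\matrix_a 'D_x ('D_(delta_mx 0 c) (partial a f)) u).
  apply/is_derive_mxP => a j.
  have -> : (fun y => A (delta_mx 0 c) y a j) =
      (fun y => 'D_(delta_mx 0 c) ('D_(ebase R a) f) y 0 j).
    by apply/funext => y; rewrite mxE.
  have fd := patch_differentiable2 (ebase R a) (delta_mx 0 c) Uu.
  have /derivableP/is_derive_mxP/(_ 0 j) := @diff_derivable _ _ _ _ _ x fd.
  by move=> H; rewrite [X in is_derive _ _ _ X]mxE.
have Id := is_derive_invmx oU Uu Gu (gram_derive x Uu).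
have := is_derive_mulmx (is_derive_mulmx (is_derive_mulmx
  (is_derive_cst (delta_mx 0 c : 'rV[R]_m) u x) Id) Ad) (normal_proj_derive x Uu).
case=> + _; apply: near_eq_derivable; near=> y.
by apply/esym/NE; near: y; exact: open_nbhs_nbhs.
Unshelve. all: by end_near. Qed.

(** The coefficient of [N u] is left explicit because, by symmetry of the Hessian, it does not
    change when [x] and [w] are exchanged. *)
Lemma codazzi u x v w : (1 < m)%N -> U u ->
  'D_x ('D_v ('D_w f)) u *m Pi u =
  (v *m A x u *m E *m (w *m J u)^T + v *m J u *m E *m (w *m A x u)^T
   + w *m A v u *m E *m (x *m J u)^T) *m N u
  + v *m G u *m w^T *m ('D_x N u *m Pi u).
Proof.
move=> m2 Uu.
have /derivableP Nd := @umbilic_derivable u x m2 Uu.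
have fd := patch_differentiable2 w v Uu.
have /derivableP Td := @diff_derivable _ _ _ _ _ x fd.
have [_ L] := is_derive_mulmx Td (normal_proj_derive x Uu).
have Gd := is_derive_mulmx (is_derive_mulmx (is_derive_cst v u x) (gram_derive x Uu))
  (is_derive_cst w^T u x).
have [_ Q] := is_derive_mulmx Gd Nd.
have : 'D_x (fun y => 'D_v ('D_w f) y *m Pi y) u = 'D_x (fun y => v *m G y *m w^T *m N y) u.
  by apply: near_eq_derive; near=> y; apply: umbilic; near: y; exact: open_nbhs_nbhs.
rewrite L Q /cst mul0mx add0r mulmx0 addr0.
move=> /(codazzi_algebra (Gu Uu) (tr_induced_gram f u) (normal_proj_tangent Uu)
  (normal_projK Uu) (NPi Uu) (umbilic_hessian x Uu)) ->.
rewrite patch_derivE2//; congr ((_ + _) *m _ + _).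
move: (A x u) (J u) => B C.
by rewrite mulmxDr mulmxDl !trmx_mul !mulmxA.
Unshelve. all: by end_near. Qed.

Lemma umbilic_parallel u x : (1 < m)%N -> U u -> 'D_x N u *m Pi u = 0.
Proof.
move=> m2 Uu.
have S v w : v *m G u *m w^T *m ('D_x N u *m Pi u) = v *m G u *m x^T *m ('D_w N u *m Pi u).
  have H := etrans (esym (codazzi x v w m2 Uu)) (etrans (congr1 (mulmx^~ (Pi u))
    (third_derivative_sym v w x Uu)) (codazzi w v x m2 Uu)).
  have e1 := hessian_sym x v Uu; have e2 := hessian_sym x w Uu.
  have e3 := hessian_sym v w Uu; move: H e1 e2 e3.
  move: (A x u) (A v u) (A w u) (J u) => B1 B2 B3 J1 H e1 e2 e3.
  move: H; rewrite e1 e2 e3.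
  rewrite [X in X *m N u + _ = _]addrAC [X in (X + _) *m N u + _ = _]addrC.
  by rewrite [X in X *m N u + _ = _]addrAC; exact: addrI.
(* As [m >= 2], some nonzero [v] is orthogonal to [x]; for a [w] with [<v, w> <> 0] the right side
   of [S] vanishes and the normal derivative along [x] must be 0. *)
have [v v0 vx] := kernel_vector (G u *m x^T) m2.
have [w vw] : exists w, (v *m G u *m w^T) 0 0 != 0.
  apply: contrapT => /forallNP nw; move/eqP: v0; apply.
  rewrite -(mulmxK (Gu Uu) v) (_ : v *m G u = 0) ?mul0mx//.
  apply/rowP => a; have /negP := nw (delta_mx 0 a); rewrite negbK => /eqP.
  by rewrite trmx_delta -colE !mxE.
have := S v w; rewrite -[v *m G u *m x^T]mulmxA vx mul0mx.
rewrite (mx11_scalar (v *m G u *m w^T)) mul_scalar_mx => /eqP.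
by rewrite scaler_eq0 (negbTE vw) => /eqP.
Qed.

(** The normal part of the derivative vanishes by [umbilic_parallel]; the tangential part comes from
    differentiating the orthogonality of [N] to the tangent frame. *)
Lemma umbilic_derive u x : (1 < m)%N -> U u ->
  is_derive u x N (- pform p.+1 (N u) (N u) *: (x *m J u)).
Proof.
move=> m2 Uu; have /derivableP Nd := @umbilic_derivable u x m2 Uu.
apply: (is_derive_eq Nd).
have NJ : 'D_x N u *m E *m (J u)^T = - (pform p.+1 (N u) (N u) *: (x *m G u)).
  have [_] := is_derive_mulmx (is_derive_mulmx Nd (is_derive_cst E u x))
    (is_derive_trmx (tangent_mx_derive x Uu)).
  rewrite /cst mulmx0 addr0 => Z.
  have : 'D_x (fun y => N y *m E *m (J y)^T) u = 0.
    transitivity ('D_x (cst (0 : 'M[R]_(1, m))) u); last by rewrite derive_cst.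
    by apply: near_eq_derive; near=> y; apply: umbilic_normal; near: y; exact: open_nbhs_nbhs.
  rewrite Z => /eqP; rewrite addr_eq0 => /eqP ->; congr (- _).
  rewrite -{1}(NPi Uu) -(mulmxA _ (Pi u)) eta_normal_proj !mulmxA -mulmxA -trmx_mul.
  rewrite umbilic_hessian// trmx_mul trmxK mulmxA.
  by rewrite (mx11_scalar (N u *m E *m _)) -pformE mul_scalar_mx.
have -> : 'D_x N u = 'D_x N u *m Pi u + 'D_x N u *m E *m (J u)^T *m invmx (G u) *m J u.
  by rewrite /normal_proj mulmxBr mulmx1 !mulmxA subrK.
rewrite umbilic_parallel// add0r NJ scaleNr mulNmx -!scalemxAl mulmxK ?Gu//.
by rewrite mulNmx scalemxAl.
Unshelve. all: by end_near. Qed.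

Lemma umbilic_curvature_derive u x : (1 < m)%N -> U u ->
  is_derive u x (fun u => pform p.+1 (N u) (N u) : R) 0.
Proof.
move=> m2 Uu; have Nd := umbilic_derive x m2 Uu.
have TN : pform p.+1 (x *m J u) (N u) = 0.
  apply: pform_mulmx; apply: trmx_inj.
  by rewrite !trmx_mul trmxK trmx_eta trmx0 mulmxA umbilic_normal.
apply: (is_derive_eq (is_derive_pform p.+1 Nd Nd)).
by rewrite pformZr pformZl [pform _ _ (x *m _)]pformC TN !mulr0 addr0.
Qed.

Lemma patch_position_normal u : U u -> f u *m E *m (J u)^T = 0.
Proof.
move=> Uu; apply: trmx_inj; rewrite trmx0; apply/matrixP => a j.
rewrite ord1 trmx_mul trmxK trmx_mul trmx_eta mulmxA eta_entry !mxE row_id.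
have fd := patch_derive (delta_mx 0 a) Uu.
have [_ D] := is_derive_pform p.+1 fd fd.
have : 'D_(delta_mx 0 a) (fun y => pform p.+1 (f y) (f y) : R) u = 0.
  transitivity ('D_(delta_mx 0 a) (cst (-1 : R)) u); last by rewrite derive_cst.
  by apply: near_eq_derive; near=> y; apply: fH; near: y; exact: open_nbhs_nbhs.
rewrite D -rowE [pform _ (f u) _]pformC => D0.
by move/eqP: D0; rewrite -mulr2n mulrn_eq0 => /eqP.
Unshelve. all: by end_near. Qed.

Hypothesis Nf : forall u, U u -> pform p.+1 (N u) (f u) = -1.
Hypothesis m2 : (1 < m)%N.

(* The orthogonal projection onto the span of the tangent space, [f] and [N]
   when the latter is non-degenerate. *)
Definition span_proj u : 'M[R]_n.+1 :=
  1%:M - Pi u - (E *m (N u)^T *m f u + E *m (f u)^T *m N u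
    + pform p.+1 (N u) (N u) *: (E *m (f u)^T *m f u)).

(** By umbilicity the derivative of [- Pi] is the symmetrized product of [N] with the tangent vector
    [x *m J u]. The bracketed terms have the same derivative because [dN = - k df], and this needs
    no division by [1 + k]. *)
Lemma span_proj_derive u x : U u -> is_derive u x span_proj 0.
Proof.
move=> Uu; have Nd := umbilic_derive x m2 Uu; have fd := patch_derive x Uu.
have Ed := is_derive_cst E u x.
have kd := umbilic_curvature_derive x m2 Uu.
have d1 := is_derive_mulmx (is_derive_mulmx Ed (is_derive_trmx Nd)) fd.
have d2 := is_derive_mulmx (is_derive_mulmx Ed (is_derive_trmx fd)) Nd.
have d3 := is_derive_mulmx (is_derive_mulmx Ed (is_derive_trmx fd)) fd.
have d4 : is_derive u x (fun y => pform p.+1 (N y) (N y) *: (E *m (f y)^T *m f y))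
    (pform p.+1 (N u) (N u) *: (E *m (x *m J u)^T *m f u + E *m (f u)^T *m (x *m J u))).
  apply/is_derive_mxP => i j; move: d3 => /is_derive_mxP/(_ i j) d3.
  rewrite (_ : (fun y => _) = (fun y => pform p.+1 (N y) (N y) *
      (E *m (f y)^T *m f y) i j)); last by apply/funext => y; rewrite mxE.
  apply: is_derive_eq (is_derive_mulr kd d3) _.
  by rewrite mul0r add0r /cst mul0mx add0r [RHS]mxE.
have d5 := is_deriveB (is_derive_cst (1%:M : 'M[R]_n.+1) u x) (normal_proj_derive x Uu).
have := is_deriveB d5 (is_deriveD (is_deriveD d1 d2) d4).
move=> d6; apply: (is_derive_eq d6); rewrite /cst !mul0mx !add0r opprK.
rewrite -(mulmxA _ (A x u)) umbilic_hessian// trmx_mul trmxK !mulmxA mulmxK ?Gu//.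
rewrite trmx_mul tr_induced_gram mulmxA mulmxKV ?Gu//.
rewrite linearZ/= -!scalemxAr -!scalemxAl !trmx_mul !scaleNr !mulmxA.
move: (pform _ _ _) => k; rewrite scalerDr.
set X1 := E *m (N u)^T *m x *m J u; set X2 := E *m (J u)^T *m x^T *m N u.
set Y1 := k *: _; set Y2 := k *: _.
by rewrite (addrC (- Y1)) (addrACA X1) -opprD subrK subrr.
Qed.

Lemma umbilic_center_derive u x : U u ->
  is_derive u x (fun y => N y + pform p.+1 (N u) (N u) *: f y) 0.
Proof.
move=> Uu; have Nd := umbilic_derive x m2 Uu; have fd := patch_derive x Uu.
apply: is_derive_eq (is_deriveD Nd (@is_deriveZ _ _ _ f _ _ _ _ fd)) _.
by rewrite scaleNr addNr.
Qed.

Lemma patch_curvature_constant u0 (r : R) : ball u0 r `<=` U ->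
  forall u, ball u0 r u -> pform p.+1 (N u) (N u) = pform p.+1 (N u0) (N u0).
Proof.
move=> rU u ur; have := @derive0_constant _ _ 1 1
  (fun y => (pform p.+1 (N y) (N y))%:M) u0 r _ u ur.
move=> /(_ _)/matrixP/(_ 0 0); rewrite !mxE !mulr1n; apply=> x v /rU Ux.
apply/is_derive_mxP => i j; rewrite !ord1 mxE.
under eq_fun => y do rewrite mxE mulr1n.
exact: umbilic_curvature_derive.
Qed.

Lemma patch_center_constant u0 (r : R) : ball u0 r `<=` U ->
  forall u, ball u0 r u -> N u + pform p.+1 (N u) (N u) *: f u =
    N u0 + pform p.+1 (N u0) (N u0) *: f u0.
Proof.
move=> rU u ur; rewrite (patch_curvature_constant rU ur).
apply: (@derive0_constant _ _ _ _ (fun y => N y + pform p.+1 (N u0) (N u0) *: f y)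
  u0 r _ u ur) => x v xr.
by rewrite -(patch_curvature_constant rU xr); apply/umbilic_center_derive/rU.
Qed.

(** [xi *m span_proj u] is the tangential part of [xi] minus [<xi, N> f] minus [<xi, f> C]. Equating
    its values at [u1] and [u2], where the first two terms vanish at [u1], gives [eqC]; pairing with
    [N u2] and [f u2] then compares the two heights. *)
Lemma patch_affine_hull u0 (r : R) xi : ball u0 r `<=` U ->
  forall u1 u2, ball u0 r u1 -> ball u0 r u2 ->
  J u1 *m E *m xi^T = 0 -> pform p.+1 xi (N u1) = 0 ->
  pform p.+1 xi (f u2) = pform p.+1 xi (f u1).
Proof.
move=> rU u1 u2 r1 r2 xJ xN.
have PE u : ball u0 r u -> span_proj u = span_proj u0.
  by apply: derive0_constant => x v /rU Ux; exact: span_proj_derive.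
have kE u : ball u0 r u -> pform p.+1 (N u) (N u) = pform p.+1 (N u0) (N u0).
  exact: patch_curvature_constant.
have CE u : ball u0 r u -> N u + pform p.+1 (N u) (N u) *: f u =
    N u0 + pform p.+1 (N u0) (N u0) *: f u0 by exact: patch_center_constant.
have outer (a b c : 'rV[R]_n.+1) : a *m (E *m b^T *m c) = pform p.+1 a b *: c.
  by rewrite !mulmxA (mx11_scalar (a *m E *m b^T)) -pformE mul_scalar_mx.
have xP u : xi *m span_proj u = xi *m E *m (J u)^T *m invmx (G u) *m J u
    - pform p.+1 xi (N u) *: f u
    - pform p.+1 xi (f u) *: (N u + pform p.+1 (N u) (N u) *: f u).
  rewrite /span_proj mulmxBr mulmxBr mulmx1 !mulmxDr -scalemxAr !outer.
  rewrite mulmx1 mulmxN opprB addrCA subrr addr0 !mulmxA scalerDr !scalerA.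
  by rewrite [_ * pform _ (N u) _]mulrC !opprD !addrA.
have xJ' : xi *m E *m (J u1)^T = 0.
  by apply: trmx_inj; rewrite !trmx_mul trmxK trmx_eta trmx0 mulmxA.
have := congr1 (mulmx xi) (etrans (PE _ r1) (esym (PE _ r2))).
rewrite !xP xJ' !mul0mx xN scale0r subr0 sub0r !CE//.
set k := pform p.+1 (N u0) (N u0); set C := N u0 + _.
set d := pform p.+1 xi (f u1); set d2 := pform p.+1 xi (f u2).
have {}CE u : ball u0 r u -> N u + k *: f u = C.
  by move=> ru; rewrite /C -(CE _ ru) kE.
have {}kE u : ball u0 r u -> pform p.+1 (N u) (N u) = k := kE u.
clearbody C k.
set t := _ *m J u2 => eqC.
have U2 := rU _ r2; have U1 := rU _ r1.
have tN : pform p.+1 t (N u2) = 0.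
  apply: pform_mulmx; apply: trmx_inj.
  by rewrite !trmx_mul trmxK trmx_eta trmx0 mulmxA umbilic_normal.
have tf : pform p.+1 t (f u2) = 0.
  apply: pform_mulmx; apply: trmx_inj.
  by rewrite !trmx_mul trmxK trmx_eta trmx0 mulmxA patch_position_normal.
have C2 : C = N u2 + k *: f u2 := esym (CE _ r2).
have CN : pform p.+1 C (N u2) = 0.
  by rewrite C2 pformDl pformZl [pform _ (f u2) _]pformC Nf// kE// mulrN1 subrr.
have Cf : pform p.+1 C (f u2) = - 1 - k.
  by rewrite C2 pformDl pformZl Nf// fH// mulrN1.
have eN := congr1 (fun y => pform p.+1 y (N u2)) eqC.
rewrite /= !(pformDl, pformNl, pformZl) CN tN [pform _ (f u2) _]pformC Nf// mulr0 in eN.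
have xN2 : pform p.+1 xi (N u2) = 0 by lra.
have ef := congr1 (fun y => pform p.+1 y (f u2)) eqC.
rewrite /= !(pformDl, pformNl, pformZl) Cf tf fH// xN2 in ef.
have dk : (d2 - d) * (1 + k) = 0 by lra.
have [k1|k1] := eqVneq (1 + k) 0; last first.
  by move/eqP: dk; rewrite mulf_eq0 (negbTE k1) orbF subr_eq0 => /eqP.
(* For [k = -1] the pairing with [f u2] is vacuous. If [C = 0] then [N = f] and both heights are 0;
   otherwise the tangent vector [t] is a multiple of the normal vector [C], so both sides vanish. *)
have [C0|C0] := eqVneq C 0.
  have kE1 : k = -1 by lra.
  have Nf1 u : ball u0 r u -> N u = f u.
    by move=> ru; have := CE _ ru; rewrite C0 kE1 scaleN1r => /eqP; rewrite subr_eq0 => /eqP.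
  by rewrite /d2 /d -(Nf1 u2)// -(Nf1 u1)// xN2 xN.
have tC : t = (d2 - d) *: C.
  move/eqP: eqC; rewrite xN2 scale0r subr0 eq_sym subr_eq => /eqP ->.
  by rewrite scalerBl addrC.
have CJ : C *m E *m (J u2)^T = 0.
  rewrite C2 !mulmxDl -!scalemxAl umbilic_normal// patch_position_normal//.
  by rewrite scaler0 addr0.
have t0 : t = 0.
  move: (congr1 (fun y => y *m E *m (J u2)^T) tC); rewrite /= -!scalemxAl CJ scaler0.
  rewrite {1}/t -(mulmxA _ (J u2)) -(mulmxA _ (J u2 *m E)) -induced_gramE mulmxKV ?Gu//.
  by rewrite /t => ->; rewrite !mul0mx.
move/esym/eqP: tC; rewrite t0 scaler_eq0 (negbTE C0) orbF subr_eq0.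
by move=> /eqP.
Qed.

End immersed_patch.

(** * The second fundamental form through the normal projection *)

Section second_fundamental_form.
Variables (R : realType) (m n p : nat).
Local Notation E := (eta_mx R p.+1 n.+1).
Variables (f : 'rV[R]_m -> 'rV[R]_n.+1) (U : set 'rV[R]_m).
Variable g : 'rV[R]_m -> 'M[R]_m.
Hypotheses (oU : open U) (fs : smooth_on U f).
Hypothesis fH : forall u, U u -> pform p.+1 (f u) (f u) = - 1.
Hypothesis Gu : forall u, U u -> induced_gram p f u \in unitmx.
Hypothesis gE : forall u, U u -> induced_gram p f u = g u.

Local Notation J := (tangent_mx f).
Local Notation A := (hessian_mx f).
Local Notation G := (induced_gram p f).
Local Notation Pi := (normal_proj p f).

Lemma row_hessian_mx u a b : row a (A (ebase R b) u) = partial b (partial a f) u.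
Proof. exact: rowK. Qed.

Lemma row_tangent_mx u c : row c (J u) = partial c f u.
Proof. exact: rowK. Qed.

Lemma partial_sym u a b : U u ->
  partial b (partial a f) u = partial a (partial b f) u.
Proof.
move=> Uu; apply: etrans (esym (row_hessian_mx u a b)) _.
apply: etrans _ (row_hessian_mx u b a).
apply: etrans (rowE _ _) (etrans _ (esym (rowE _ _))).
exact: (hessian_sym oU fs (ebase R b) (ebase R a) Uu).
Qed.

Lemma partial_gram u a b d : U u ->
  partial d (fun v => g v a b : R) u =
  pform p.+1 (partial d (partial a f) u) (partial b f u)
  + pform p.+1 (partial d (partial b f) u) (partial a f u).
Proof.
move=> Uu.
have /is_derive_mxP/(_ a b)[_ D] := gram_derive p fs (ebase R d) Uu.
transitivity ('D_(ebase R d) (fun y => G y a b : R) u).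
  by apply: near_eq_derive; near=> y; rewrite gE//; near: y; exact: open_nbhs_nbhs.
apply: etrans D _; rewrite mxE; apply: (congr2 +%R); apply: etrans (eta_entry _ _ _ _ _) _.
  exact: (congr2 (@pform R p.+1 n.+1) (row_hessian_mx u a d) (row_tangent_mx u b)).
apply: etrans (pformC _ _ _) _.
exact: (congr2 (@pform R p.+1 n.+1) (row_hessian_mx u b d) (row_tangent_mx u a)).
Unshelve. all: by end_near. Qed.

(** In the Koszul combination of derivatives of the Gram matrix, symmetry of second partial
    derivatives leaves only twice the product of the second derivative with a tangent vector. *)
Lemma christoffelE u a b c : U u ->
  christoffel g u c a b =
  (partial a (partial b f) u *m E *m (J u)^T *m invmx (G u)) 0 c.
Proof.
move=> Uu; rewrite /christoffel -gE//.
pose K a b d : R := pform p.+1 (partial a (partial b f) u) (partial d f u).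
have Ks a' b' d : K a' b' d = K b' a' d.
  exact: (congr1 (fun x => pform p.+1 x (partial d f u)) (partial_sym b' a' Uu)).
have KE d : partial a (fun v => (g v b d : R)) u + partial b (fun v => (g v a d : R)) u
    - partial d (fun v => (g v a b : R)) u = 2 * K a b d.
  apply: etrans (congr2 (fun x y => x - y) (congr2 +%R (partial_gram b d a Uu)
    (partial_gram a d b Uu)) (partial_gram a b d Uu)) _.
  rewrite -[LHS]/(K a b d + K a d b + (K b a d + K b d a) - (K d a b + K d b a)).
  by rewrite (Ks b a) (Ks d a) (Ks d b); clearbody K; ring.
under eq_bigr => d _ do rewrite KE mulrCA.
rewrite -mulr_sumr mulKf ?pnatr_eq0// mxE.
apply: eq_bigr => d _; rewrite eta_entry row_id rowK mulrC; congr (_ * _).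
have : (invmx (G u))^T = invmx (G u) by rewrite trmx_inv tr_induced_gram.
by move=> /matrixP/(_ d c); rewrite mxE.
Qed.

Lemma christoffel_tangent u a b : U u ->
  \sum_(c < m) christoffel g u c a b *: partial c f u =
  partial a (partial b f) u - partial a (partial b f) u *m Pi u.
Proof.
move=> Uu; rewrite /normal_proj mulmxBr mulmx1 opprB addrC subrK !mulmxA mulmx_sum_row.
by apply: eq_bigr => c _; rewrite christoffelE// rowK.
Qed.

Lemma pform_partial2 u a b : U u ->
  pform p.+1 (partial a (partial b f) u) (f u) = - G u a b.
Proof.
move=> Uu.
have h1 := patch_derive fs (ebase R a) Uu.
have /derivableP h2 := @diff_derivable _ _ _ _ _ (ebase R a)
  (patch_differentiable1 fs (ebase R b) Uu).
have [_ D] := is_derive_pform p.+1 h2 h1.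
have Z : 'D_(ebase R a) (fun y => pform p.+1 ('D_(ebase R b) f y) (f y) : R) u = 0.
  transitivity ('D_(ebase R a) (cst (0 : R)) u); last by rewrite derive_cst.
  apply: near_eq_derive; near=> y.
  have Uy : U y by near: y; exact: open_nbhs_nbhs.
  rewrite (patch_derivE fs _ Uy); apply: pform_mulmx; apply: trmx_inj.
  rewrite !trmx_mul trmxK trmx_eta trmx0 mulmxA.
  exact: patch_position_normal oU fs fH _ Uy.
have : pform p.+1 (partial a (partial b f) u) (f u) + pform p.+1 (partial b f u) (partial a f u) = 0.
  apply: etrans (etrans (esym D) Z); congr (_ + pform _ _ _).
  by rewrite -rowE row_tangent_mx.
move/eqP; rewrite addr_eq0 => /eqP H; apply: etrans H _; congr (- _).
by rewrite mxE; exact: pformC.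
Unshelve. all: by end_near. Qed.

(** Subtracting the Christoffel terms leaves the flat normal part; [tangent_proj] removes its
    component along [f], which is determined by the Gram matrix since [<f, f>] is constant. *)
Lemma second_ffE u a b : U u ->
  second_ff p g f u a b = partial a (partial b f) u *m Pi u - G u a b *: f u.
Proof.
move=> Uu; rewrite /second_ff christoffel_tangent// /tangent_proj.
by rewrite (pform_partial2 a b Uu) scaleNr opprB [LHS]addrC addrA subrK.
Qed.

End second_fundamental_form.

(** * Total umbilicity in the flat ambient space *)

Section umbilical_patch.
Variables (R : realType) (m n p : nat).
Local Notation E := (eta_mx R p.+1 n.+1).
Variables (f : 'rV[R]_m -> 'rV[R]_n.+1) (U : set 'rV[R]_m).
Variable g : 'rV[R]_m -> 'M[R]_m.
Hypotheses (m2 : (1 < m)%N) (oU : open U) (fs : smooth_on U f).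
Hypothesis fH : forall u, U u -> pform p.+1 (f u) (f u) = - 1.
Hypothesis Gu : forall u, U u -> induced_gram p f u \in unitmx.
Hypothesis gE : forall u, U u -> induced_gram p f u = g u.
Hypothesis umb : forall u a b, U u ->
  second_ff p g f u a b = g u a b *: mean_curv p g f u.

Local Notation J := (tangent_mx f).
Local Notation A := (hessian_mx f).
Local Notation G := (induced_gram p f).
Local Notation Pi := (normal_proj p f).

Definition patch_normal u := mean_curv p g f u + f u.

Lemma umbilical_partial2 u a b : U u ->
  partial a (partial b f) u *m Pi u = G u a b *: patch_normal u.
Proof.
move=> Uu; have := umb a b Uu; rewrite (second_ffE oU fs fH gE)// -gE// => /eqP.
by rewrite subr_eq -scalerDr => /eqP.
Qed.

(** Coordinate vectors may all be null, so the nonzero entry need not be diagonal. It is what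
    permits solving the umbilicity equation for the normal vector. *)
Lemma gram_entry_neq0 u : U u -> exists a b, G u a b != 0.
Proof.
move=> Uu; apply: contrapT => /forallNP nG.
have G0 : G u = 0.
  apply/matrixP => a b; rewrite [RHS]mxE; apply/eqP.
  by have /forallNP/(_ b)/negP := nG a; rewrite negbK.
pose c : 'I_m := Ordinal (ltnW m2); have := mulmxV (Gu Uu); rewrite G0 mul0mx.
by move=> /matrixP/(_ c c)/eqP; rewrite !mxE eqxx eq_sym oner_eq0.
Qed.

Lemma patch_normal_proj u : U u -> patch_normal u *m Pi u = patch_normal u.
Proof.
move=> Uu; have [a [b ab]] := gram_entry_neq0 Uu.
apply: (scalerI ab); rewrite scalemxAl -umbilical_partial2//.
by rewrite -mulmxA (normal_projK Gu).
Qed.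

Lemma patch_normal_position u : U u -> pform p.+1 (patch_normal u) (f u) = -1.
Proof.
move=> Uu; have [a [b ab]] := gram_entry_neq0 Uu.
apply: (mulfI ab); rewrite -pformZl -umbilical_partial2// pformE.
rewrite -(mulmxA _ (Pi u)) eta_normal_proj mulmxA -mulmxA -trmx_mul.
rewrite (normal_proj_normal (patch_position_normal oU fs fH Uu)) -pformE.
by rewrite (pform_partial2 oU fs fH)// mulrN1.
Qed.

Lemma umbilical_directional u v w : U u ->
  'D_v ('D_w f) u *m Pi u = v *m G u *m w^T *m patch_normal u.
Proof.
move=> Uu; rewrite (patch_derivE2 oU fs)//.
have rows a : A (ebase R a) u *m Pi u = (row a (G u))^T *m patch_normal u.
  apply/row_matrixP => b; apply: etrans (row_mul _ _ _) _.
  apply: etrans (congr1 (mulmx^~ (Pi u)) (row_hessian_mx f u b a)) _.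
  rewrite umbilical_partial2// row_mul -mul_scalar_mx; congr (_ *m _).
  apply/matrixP => i j; rewrite !ord1; move: (G u) => X.
  by rewrite !mxE eqxx mulr1n.
have cols a : delta_mx 0 a *m A v u *m Pi u = (v *m G u) 0 a *: patch_normal u.
  rewrite (hessian_sym oU fs v (delta_mx 0 a))// -mulmxA rows mulmxA.
  rewrite -mul_scalar_mx; congr (_ *m _).
  apply/matrixP => i j; rewrite !ord1; move: (G u) (tr_induced_gram p f u) => X Xs.
  rewrite !mxE eqxx mulr1n; apply: eq_bigr => c _.
  by rewrite mxE mxE -{1}Xs mxE.
rewrite [w]row_sum_delta !mulmx_suml linear_sum/= mulmx_sumr mulmx_suml.
apply: eq_bigr => a _; rewrite -!scalemxAl cols [(_ *: _)^T]linearZ /= -scalemxAr -scalemxAl.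
congr (_ *: _); rewrite -mul_scalar_mx; congr (_ *m _).
apply/matrixP => i j; rewrite !ord1 trmx_delta -colE; move: (v *m G u) => X.
by rewrite !mxE eqxx mulr1n.
Qed.

End umbilical_patch.

(** * Velocity and acceleration of curves in a patch *)

Section patch_curves.
Variables (R : realType) (m n : nat).
Variables (f : 'rV[R]_m -> 'rV[R]_n.+1) (U : set 'rV[R]_m).
Hypotheses (oU : open U) (fs : smooth_on U f).
Local Notation J := (tangent_mx f).
Local Notation A := (hessian_mx f).

Lemma hessian_expand u v w : U u ->
  v *m A w u = \sum_(a < m) \sum_(b < m) (w 0 a * v 0 b) *: partial a (partial b f) u.
Proof.
move=> Uu; rewrite [v]row_sum_delta mulmx_suml exchange_big/=.
apply: eq_bigr => b _; rewrite -scalemxAl (hessian_sym oU fs w (delta_mx 0 b))//.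
rewrite mulmx_sum_row scaler_sumr; apply: eq_bigr => a _.
rewrite scalerA mulrC summxE (bigD1 b)//= !mxE !eqxx mulr1 big1 ?addr0; last first.
  by move=> i ib; rewrite !mxE eqxx/= eq_sym (negbTE ib) mulr0.
congr (_ *: _); apply: etrans (row_hessian_mx f u a b) _.
exact: (partial_sym oU fs a b Uu).
Qed.

Variables (c : R -> 'rV[R]_m) (I : set R).
Hypothesis cd : forall t, I t -> differentiable c t.
Hypothesis cd1 : forall t, I t -> differentiable ('D_1 c) t.
Hypothesis cU : forall t, I t -> U (c t).

Lemma patch_curve_derive t : I t ->
  is_derive t 1 (fun s => f (c s)) ('D_1 c t *m J (c t)).
Proof.
move=> It; have /derivableP c1 := @diff_derivable _ _ _ _ _ (1 : R) (cd It).
have := is_derive_curve (patch_differentiable fs (cU It)) c1.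
by rewrite (patch_derivE fs _ (cU It)).
Qed.

Lemma patch_curve_derive2 t : I t ->
  is_derive t 1 (fun s => 'D_1 c s *m J (c s))
    ('D_1 ('D_1 c) t *m J (c t) + 'D_1 c t *m A ('D_1 c t) (c t)).
Proof.
move=> It; have /derivableP c1 := @diff_derivable _ _ _ _ _ (1 : R) (cd It).
have /derivableP c2 := @diff_derivable _ _ _ _ _ (1 : R) (cd1 It).
apply: is_derive_mulmx c2 _; apply/is_derive_mxP => a j.
have := is_derive_curve (patch_differentiable1 fs (ebase R a) (cU It)) c1.
move=> /is_derive_mxP/(_ 0 j) H.
have -> : (fun s => J (c s) a j) = (fun s => 'D_(ebase R a) f (c s) 0 j).
  by apply/funext => s; rewrite mxE.
by rewrite [X in is_derive _ _ _ X]mxE.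
Qed.

End patch_curves.

Section umbilical_acceleration.
Variables (R : realType) (m n p : nat).
Local Notation E := (eta_mx R p.+1 n.+1).
Variables (f : 'rV[R]_m -> 'rV[R]_n.+1) (U : set 'rV[R]_m).
Variable g : 'rV[R]_m -> 'M[R]_m.
Hypotheses (oU : open U) (fs : smooth_on U f).
Hypothesis fH : forall u, U u -> pform p.+1 (f u) (f u) = - 1.
Hypothesis gE : forall u, U u -> induced_gram p f u = g u.
Hypothesis umb : forall u a b, U u ->
  second_ff p g f u a b = g u a b *: mean_curv p g f u.

(** The tangential part is the Christoffel term of the geodesic equation, so a geodesic keeps only
    the normal part; the normal part alone also identifies [N] independently of coordinates. *)
Lemma umbilical_acceleration u v : U u ->
  v *m hessian_mx f v u =
  (\row_k \sum_(a < m) \sum_(b < m) christoffel g u k a b * v 0 a * v 0 b)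
    *m tangent_mx f u
  + pform p.+1 (v *m tangent_mx f u) (v *m tangent_mx f u) *: patch_normal p f g u.
Proof.
move=> Uu.
have D := umbilical_directional oU fs fH gE umb v v Uu.
have {}D : v *m hessian_mx f v u *m normal_proj p f u =
    v *m induced_gram p f u *m v^T *m patch_normal p f g u.
  apply: etrans D; congr (_ *m _); apply/esym; exact: patch_derivE2 oU fs _ _ _ Uu.
rewrite -[LHS](subrK (v *m hessian_mx f v u *m normal_proj p f u)).
congr (_ + _); last first.
  rewrite D (mx11_scalar (v *m _ *m _)) mul_scalar_mx pformE induced_gramE.
  by rewrite trmx_mul !mulmxA.
rewrite /normal_proj mulmxBr mulmx1 opprB addrC subrK !mulmxA; congr (_ *m _).
apply/rowP => k; rewrite [RHS]mxE (hessian_expand oU fs)// !mulmx_suml summxE.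
apply: eq_bigr => a _; rewrite !mulmx_suml summxE; apply: eq_bigr => b _.
rewrite -!scalemxAl mxE (christoffelE oU fs gE a b k Uu).
by rewrite mulrC mulrA.
Qed.

End umbilical_acceleration.

(** The level set through [y] is open and closed. *)
Lemma connected_locally_constant (T : topologicalType) (V : Type) (F : T -> V) :
  connected [set: T] -> (forall x, \forall y \near x, F y = F x) ->
  forall x y, F x = F y.
Proof.
move=> Tc Fl x y; pose B := [set z | F z = F y].
have lc z (D : set V) : D (F z) -> \forall w \near z, D (F w).
  by move=> Dz; apply: filterS (Fl z) => w ->.
have Bo : open B.
  by rewrite openE => z Bz; apply: (lc z [set F y]).
have Bc : closed B.
  rewrite -[B]setCK; apply: open_closedC; rewrite openE => z Bz.
  exact: (lc z (~` [set F y])).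
have : B = setT.
  apply: Tc; first by exists y.
    by exists B => //; rewrite setTI.
  by exists B => //; rewrite setTI.
by move=> BT; suff: B x by []; rewrite BT.
Qed.

(** * Independence of the normal vector from the chart *)

Section umbilical_immersion.
Variables (R : realType) (m s n p : nat).
Hypothesis m2 : (2 <= m)%N.
Variables (M : pseudoRiemannian R m s) (phi : M -> 'rV[R]_n.+1).
Hypothesis hphi : isometric_immersion p phi.
Hypothesis humb : totally_umbilical p phi.

Local Notation E := (eta_mx R p.+1 n.+1).
Local Notation pf i := (phi \o @param _ _ _ M i).
Local Notation crd i x := (@chart_coord _ _ _ M i x).
Local Notation J i := (tangent_mx (pf i)).
Local Notation Nor i := (patch_normal p (pf i) (gram i)).

Lemma phyp1 (x : 'rV[R]_n.+1) : phyp p 1 x <-> pform p.+1 x x = -1.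
Proof. by rewrite /phyp/= expr1n. Qed.

Lemma cimage_coord (i : chart M) x : cdom i x -> cimage i (crd i x).
Proof. by move=> ix; exists x. Qed.

Lemma phi_coord (i : chart M) x : cdom i x -> pf i (crd i x) = phi x.
Proof. by move=> ix /=; rewrite chart_coordK. Qed.

Lemma patch_open (i : chart M) : open (cimage i).
Proof. exact: cimage_open. Qed.

Lemma patch_smooth (i : chart M) : smooth_on (cimage i) (pf i).
Proof. by case: hphi. Qed.

Lemma phi_norm x : pform p.+1 (phi x) (phi x) = -1.
Proof. by apply/phyp1; case: hphi. Qed.

Lemma patch_norm (i : chart M) u : cimage i u -> pform p.+1 (pf i u) (pf i u) = -1.
Proof. by move=> _; exact: phi_norm. Qed.

Lemma patch_gram (i : chart M) u : cimage i u -> induced_gram p (pf i) u = gram i u.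
Proof. by case: hphi => _ _; apply. Qed.

Lemma patch_gram_unit (i : chart M) u : cimage i u -> induced_gram p (pf i) u \in unitmx.
Proof. by move=> iu; rewrite patch_gram//; case: (gram_index iu). Qed.

Lemma patch_umbilical (i : chart M) u a b : cimage i u ->
  second_ff p (gram i) (pf i) u a b = gram i u a b *: mean_curv p (gram i) (pf i) u.
Proof. by case=> x ix <-; exact: humb. Qed.

Lemma tangent_normal (i : chart M) u : cimage i u -> Nor i u *m E *m (J i u)^T = 0.
Proof.
move=> iu; apply: (umbilic_normal (@patch_gram_unit i) _ iu) => v iv.
exact: (patch_normal_proj m2 (@patch_open i) (@patch_smooth i) (@patch_norm i)
  (@patch_gram_unit i) (@patch_gram i) (@patch_umbilical i) iv).
Qed.

Lemma nonnull_direction (i : chart M) u : cimage i u ->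
  exists v, pform p.+1 (v *m J i u) (v *m J i u) != 0.
Proof.
move=> iu; apply: contrapT => /forallNP nv.
have [a [b]] := gram_entry_neq0 m2 (@patch_gram_unit i) iu.
have q0 v : pform p.+1 (v *m J i u) (v *m J i u) = 0.
  by have /negP := nv v; rewrite negbK => /eqP.
rewrite induced_gramE eta_entry !rowE => /negP; apply; apply/eqP.
have := q0 (delta_mx 0 a + delta_mx 0 b).
rewrite mulmxDl pformDl !pformDr !q0 add0r addr0 [X in _ + X]pformC.
by move/eqP; rewrite -mulr2n mulrn_eq0 => /eqP.
Qed.

Lemma chart_overlap_open (i j : chart M) : open (chart_coord i @` (cdom i `&` cdom j)).
Proof.
rewrite openE => u [x [ix jx] <-{u}].
have iu := cimage_coord ix.
have pc : (@param _ _ _ M i) @ (crd i x) --> param i (crd i x) by exact: param_continuous.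
rewrite chart_coordK// in pc.
have n1 : \forall u \near crd i x, (cdom i `&` cdom j) (param i u).
  by apply: pc; apply: open_nbhs_nbhs; split => //; apply: openI; exact: cdom_open.
have n2 : \forall u \near crd i x, cimage i u.
  by apply: open_nbhs_nbhs; split => //; exact: patch_open.
apply: filterS2 n1 n2 => u ij [y iy yu]; exists y => //.
by move: ij; rewrite -yu chart_coordK.
Qed.

(** The acceleration of one curve is computed in two charts: the results differ by tangential terms
    and contain [<v, v>] times the respective normals. A nonnull [v] then separates the normals. *)
Lemma normal_chart_independent (i j : chart M) x : cdom i x -> cdom j x ->
  Nor i (crd i x) = Nor j (crd j x).
Proof.
move=> ix jx; have iu := cimage_coord ix; have ju := cimage_coord jx.
set u := crd i x in iu *; set u' := crd j x in ju *.
set W := chart_coord i @` (cdom i `&` cdom j).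
have oW : open W by exact: chart_overlap_open.
have Wu : W u by exists x.
pose tau := chart_coord j \o @param _ _ _ M i.
have taus : smooth_on W tau by exact: transition_smooth.
have tauu : tau u = u' by rewrite /tau/= chart_coordK.
have Wi w : W w -> cimage i w by move=> [y [iy jy] <-]; exact: cimage_coord.
have Wj w : W w -> cimage j (tau w).
  by move=> [y [iy jy] <-]; rewrite /tau/= chart_coordK//; exact: cimage_coord.
have Wf w : W w -> pf i w = pf j (tau w).
  by move=> [y [iy jy] <-]; rewrite /tau/= !chart_coordK.
have taud w : W w -> differentiable tau w by have [td _] := taus 1%N; exact: td.
have taud1 v w : W w -> differentiable ('D_v tau) w.
  by have [_ /(_ v) [td _]] := taus 2%N; exact: td.
(* The line [u + t *: v] of chart [i] is read in chart [j] as the curve [c]; the second derivative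
   of the transition map contributes only a tangent vector. *)
have main v : v *m J i u = 'D_v tau u *m J j u' /\
    exists c, v *m hessian_mx (pf i) v u =
      c *m J j u' + 'D_v tau u *m hessian_mx (pf j) ('D_v tau u) u'.
  pose c (t : R) := tau (u + t *: v).
  pose I : set R := [set t | W (u + t *: v)].
  have oI : open I.
    have : continuous (fun t : R => u + t *: v).
      by move=> t; apply: cvgD; [exact: cvg_cst|apply: cvgZr_tmp; exact: cvg_id].
    by move/continuousP; apply.
  have I0 : I 0 by rewrite /I/= scale0r addr0.
  have lined (t : R) : differentiable (fun t : R => u + t *: v) t.
    by apply: differentiableD => //; apply: differentiableZl.
  have cd t : I t -> differentiable c t.
    by move=> It; apply: (@differentiable_comp _ _ _ _ (fun t : R => u + t *: v) tau) => //; exact: taud.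
  have cE t : I t -> 'D_1 c t = 'D_v tau (u + t *: v).
    move=> It; have /derivableP td := @diff_derivable _ _ _ _ _ v (taud _ It).
    by have [] := is_derive_line td.
  have cd1 t : I t -> differentiable ('D_1 c) t.
    move=> It; have td : differentiable (fun t : R => 'D_v tau (u + t *: v)) t.
      by apply: (@differentiable_comp _ _ _ _ (fun t : R => u + t *: v) ('D_v tau)) => //; exact: taud1.
    apply: near_eq_differentiable td; near=> y; apply/esym/cE.
    by near: y; exact: open_nbhs_nbhs.
  have cU t : I t -> cimage j (c t) by move=> It; exact: Wj.
  have first t : I t -> 'D_v (pf i) (u + t *: v) = 'D_1 c t *m J j (c t).
    move=> It; have [_ <-] := patch_curve_derive (@patch_smooth j) cd cU It.
    have fid := patch_differentiable (@patch_smooth i) (Wi _ It).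
    have /derivableP fd := @diff_derivable _ _ _ _ _ v fid.
    have [_ <-] := is_derive_line fd; apply: near_eq_derive; near=> y.
    by apply: Wf; near: y; exact: open_nbhs_nbhs.
  have c0 : c 0 = u' by rewrite /c scale0r addr0.
  have c10 : 'D_1 c 0 = 'D_v tau u by rewrite cE// scale0r addr0.
  split.
    have := first 0 I0; rewrite c0 c10 scale0r addr0 => <-.
    by rewrite (patch_derivE (@patch_smooth i) v iu).
  exists ('D_1 ('D_1 c) 0).
  have [_ S] := patch_curve_derive2 (@patch_smooth j) cd cd1 cU I0.
  rewrite c0 c10 in S; apply: etrans _ S.
  apply: etrans (esym (patch_derivE2 (@patch_open i) (@patch_smooth i) v v iu)) _.
  have fid := patch_differentiable1 (@patch_smooth i) v iu.
  have /derivableP fd := @diff_derivable _ _ _ _ _ v fid.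
  have fd' : is_derive (u + 0 *: v) v ('D_v (pf i)) ('D_v ('D_v (pf i)) u).
    by rewrite scale0r addr0.
  have [_ <-] := is_derive_line fd'; apply: near_eq_derive; near=> y.
  by apply: first; near: y; exact: open_nbhs_nbhs.
have [v qv] := nonnull_direction iu.
have [vJ [c cE]] := main v.
pose T := \matrix_(a < m) 'D_(delta_mx 0 a) tau u.
have JT : J i u = T *m J j u'.
  apply/row_matrixP => a; rewrite row_mul; apply: etrans (rowE a (J i u)) _.
  by apply: etrans (main (delta_mx 0 a)).1 _; congr (_ *m _); apply/esym; exact: rowK.
have Tu : T \in unitmx.
  have := patch_gram_unit iu; rewrite induced_gramE JT trmx_mul !mulmxA.
  by rewrite -!mulmxA unitmx_mul => /andP[].
have NJ : Nor i u *m E *m (J j u')^T = 0.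
  have := tangent_normal iu; rewrite JT trmx_mul mulmxA => /(congr1 (mulmx^~ (invmx T^T))).
  by rewrite mul0mx mulmxK// unitmx_tr.
have NJ' := tangent_normal ju.
have := umbilical_acceleration (@patch_open i) (@patch_smooth i) (@patch_norm i)
  (@patch_gram i) (@patch_umbilical i) v iu.
have := umbilical_acceleration (@patch_open j) (@patch_smooth j) (@patch_norm j)
  (@patch_gram j) (@patch_umbilical j) ('D_v tau u) ju.
rewrite cE -vJ => ->; set q := pform _ _ _ in qv *.
rewrite JT; set a := \row_k _; set b := \row_k _.
move: (Nor i u) (Nor j u') NJ NJ' => N1 N2 NJ NJ' eqN.
(* The left side is tangent and the right side normal, so both vanish by non-degeneracy, and [q] is
   nonzero. *)
have {}eqN : (c + a - b *m T) *m J j u' = q *: (N1 - N2).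
  rewrite mulmxBl mulmxDl scalerBr -mulmxA; apply/eqP.
  by rewrite subr_eq addrAC [q *: N1 + _]addrC -eqN !addrA addrK.
have := congr1 (fun y => y *m E *m (J j u')^T) eqN.
rewrite /= -!scalemxAl !mulmxBl NJ NJ' subrr scaler0 -!mulmxBl => e0.
have : c + a - b *m T = 0.
  rewrite -(mulmxK (patch_gram_unit ju) (c + a - b *m T)) induced_gramE.
  by rewrite !mulmxA e0 mul0mx.
move=> z; move: eqN; rewrite z mul0mx => /esym/eqP.
by rewrite scaler_eq0 (negbTE qv) subr_eq0 => /eqP.
Unshelve. all: by end_near. Qed.

End umbilical_immersion.

(** * From patches to the connected manifold *)

Section umbilical_immersion_global.
Variables (R : realType) (m s n p : nat).
Hypothesis m2 : (2 <= m)%N.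
Variables (M : pseudoRiemannian R m s) (phi : M -> 'rV[R]_n.+1).
Hypothesis hphi : isometric_immersion p phi.
Hypothesis humb : totally_umbilical p phi.

Local Notation E := (eta_mx R p.+1 n.+1).
Local Notation pf i := (phi \o @param _ _ _ M i).
Local Notation crd i x := (@chart_coord _ _ _ M i x).
Local Notation J i := (tangent_mx (pf i)).
Local Notation Nor i := (patch_normal p (pf i) (gram i)).

Lemma near_chart (i : chart M) x : cdom i x -> exists r : R,
  [/\ 0 < r, ball (crd i x) r `<=` cimage i &
    \forall y \near x, cdom i y /\ ball (crd i x) r (crd i y)].
Proof.
move=> ix.
have /nbhs_ballP[r /= r0 rU] : nbhs (crd i x) (cimage i).
  by apply: open_nbhs_nbhs; split; [exact: cimage_open|exists x].
exists r; split=> //.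
have cc : chart_coord i @ x --> crd i x by exact: chart_coord_continuous.
have n1 : \forall y \near x, ball (crd i x) r (crd i y).
  by apply: cc; exact: nbhsx_ballx.
have n2 : \forall y \near x, cdom i y.
  by apply: open_nbhs_nbhs; split => //; exact: cdom_open.
by apply: filterS2 n2 n1.
Qed.

Lemma phi_continuous : continuous phi.
Proof.
move=> x; have [i ix] := chart_cover x.
have [r [r0 rU n1]] := near_chart ix.
have fd : differentiable (pf i) (crd i x).
  by apply: (patch_differentiable (patch_smooth hphi i)); exists x.
have cc : chart_coord i @ x --> crd i x by exact: chart_coord_continuous.
have := cvg_comp _ _ cc (differentiable_continuous fd).
rewrite /= chart_coordK//; apply: cvg_trans; apply: near_eq_cvg.
by apply: filterS n1 => y [iy _]; rewrite /= chart_coordK.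
Qed.

Definition chart_at (x : M) : chart M := sval (cid (chart_cover x)).

Lemma chart_atP x : cdom (chart_at x) x.
Proof. exact: svalP (cid (chart_cover x)). Qed.

Definition normal_at (x : M) := Nor (chart_at x) (crd (chart_at x) x).

Lemma normal_atE (i : chart M) x : cdom i x -> Nor i (crd i x) = normal_at x.
Proof. by move=> ix; apply: normal_chart_independent => //; exact: chart_atP. Qed.

Lemma normal_at_mean_curvature (i : chart M) x : cdom i x ->
  mean_curvature p phi i x = normal_at x - phi x.
Proof.
by move=> ix; rewrite -(normal_atE ix) /patch_normal /= chart_coordK// addrK.
Qed.

Lemma patch_normalP (i : chart M) u : cimage i u ->
  Nor i u *m normal_proj p (pf i) u = Nor i u.
Proof.
exact: (patch_normal_proj m2 (@patch_open _ _ _ _ i) (patch_smooth hphi i)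
  (patch_norm hphi (i := i)) (patch_gram_unit hphi (i := i)) (patch_gram hphi (i := i))
  (patch_umbilical humb (i := i))).
Qed.

Lemma patch_directional (i : chart M) u v w : cimage i u ->
  'D_v ('D_w (pf i)) u *m normal_proj p (pf i) u =
  v *m induced_gram p (pf i) u *m w^T *m Nor i u.
Proof.
exact: (umbilical_directional (@patch_open _ _ _ _ i) (patch_smooth hphi i)
  (patch_norm hphi (i := i)) (patch_gram hphi (i := i)) (patch_umbilical humb (i := i))).
Qed.

Lemma patch_normal_phi (i : chart M) u : cimage i u ->
  pform p.+1 (Nor i u) (pf i u) = -1.
Proof.
exact: (patch_normal_position m2 (@patch_open _ _ _ _ i) (patch_smooth hphi i)
  (patch_norm hphi (i := i)) (patch_gram_unit hphi (i := i)) (patch_gram hphi (i := i))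
  (patch_umbilical humb (i := i))).
Qed.

Lemma normal_at_phi x : pform p.+1 (normal_at x) (phi x) = -1.
Proof.
rewrite -(normal_atE (chart_atP x)) -(phi_coord phi (chart_atP x)).
by apply: patch_normal_phi; exists x => //; exact: chart_atP.
Qed.

Lemma normal_at_tangent (i : chart M) x : cdom i x ->
  J i (crd i x) *m E *m (normal_at x)^T = 0.
Proof.
move=> ix; rewrite -(normal_atE ix); apply: trmx_inj.
rewrite !trmx_mul trmxK trmx_eta trmx0 mulmxA.
by apply: (tangent_normal m2 hphi humb); exists x.
Qed.

Lemma umbilical_constants x y :
  pform p.+1 (normal_at x) (normal_at x) = pform p.+1 (normal_at y) (normal_at y) /\
  normal_at x + pform p.+1 (normal_at x) (normal_at x) *: phi x =
  normal_at y + pform p.+1 (normal_at y) (normal_at y) *: phi y.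
Proof.
pose F (x : M) := (pform p.+1 (normal_at x) (normal_at x),
  normal_at x + pform p.+1 (normal_at x) (normal_at x) *: phi x).
suff: F x = F y by case.
apply: connected_locally_constant (@carrier_connected _ _ _ M) _ x y => x.
have [i ix] := chart_cover x; have [r [r0 rU n1]] := near_chart ix.
apply: filterS n1 => y [iy ry]; rewrite /F -!(normal_atE ix) -!(normal_atE iy).
have o := @patch_open R m s M i; have sm := patch_smooth hphi i.
have gu := patch_gram_unit hphi (i := i).
have k1 := patch_curvature_constant o sm gu (@patch_normalP i) (@patch_directional i) m2 rU ry.
have c1 := patch_center_constant o sm gu (@patch_normalP i) (@patch_directional i) m2 rU ry.
by rewrite -[in RHS](phi_coord phi ix) -[in LHS](phi_coord phi iy) c1 k1.
Qed.

(** First derivatives of the height give orthogonality to the tangent space; second derivatives have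
    a tangential part, already orthogonal to [xi], and a normal part that is a Gram entry times
    [N]. *)
Lemma constant_height_orthogonal (i : chart M) u xi (d : R) : cimage i u ->
  (\forall v \near u, pform p.+1 xi (pf i v) = d) ->
  J i u *m E *m xi^T = 0 /\ pform p.+1 xi (Nor i u) = 0.
Proof.
move=> iu hd; have o := @patch_open R m s M i; have sm := patch_smooth hphi i.
have D1 v w : cimage i w -> (\forall w' \near w, pform p.+1 xi (pf i w') = d) ->
    pform p.+1 xi ('D_v (pf i) w) = 0.
  move=> iw hw; have fd := patch_derive sm v iw.
  have [_ D] := is_derive_pform p.+1 (is_derive_cst xi w v) fd.
  rewrite pform0l add0r in D; rewrite (patch_derivE sm v iw); apply: etrans (esym D) _.
  transitivity ('D_v (cst d) w); last by rewrite derive_cst.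
  exact: near_eq_derive.
have xJ v : pform p.+1 xi (v *m J i u) = 0.
  by rewrite -(patch_derivE sm v iu); exact: D1.
have xJ' : J i u *m E *m xi^T = 0.
  by apply/eta_col0P => a; rewrite rowE pformC xJ.
split=> //.
have D2 v w : pform p.+1 xi ('D_v ('D_w (pf i)) u) = 0.
  have /derivableP fd := @diff_derivable _ _ _ _ _ v (patch_differentiable1 sm w iu).
  have [_ D] := is_derive_pform p.+1 (is_derive_cst xi u v) fd.
  rewrite pform0l add0r in D; apply: etrans (esym D) _.
  transitivity ('D_v (cst (0 : R)) u); last by rewrite derive_cst.
  apply: near_eq_derive; near=> w'; apply: D1.
    by near: w'; exact: open_nbhs_nbhs.
  by near: w'; exact: (near_join hd).
have [a [b ab]] := gram_entry_neq0 m2 (patch_gram_unit hphi (i := i)) iu.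
have := patch_directional (delta_mx 0 a) (delta_mx 0 b) iu.
move: (D2 (delta_mx 0 a) (delta_mx 0 b)); move: ('D_(_) _ _) => Y xY.
rewrite trmx_delta -colE -rowE (mx11_scalar (col _ _)) mul_scalar_mx mxE mxE => YN.
apply: (mulfI ab); rewrite mulr0 -pformZr -YN.
rewrite /normal_proj mulmxBr mulmx1 pformDr xY pformNr add0r !mulmxA.
by rewrite xJ oppr0.
Unshelve. all: by end_near. Qed.

Lemma umbilical_affine_hull (i : chart M) x0 xi : cdom i x0 ->
  J i (crd i x0) *m E *m xi^T = 0 -> pform p.+1 xi (normal_at x0) = 0 ->
  forall x, pform p.+1 xi (phi x) = pform p.+1 xi (phi x0).
Proof.
move=> ix0 xJ xN; set d := pform p.+1 xi (phi x0).
have ball_const (j : chart M) x r : cdom j x -> ball (crd j x) r `<=` cimage j ->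
    forall u1 u2, ball (crd j x) r u1 -> ball (crd j x) r u2 ->
    J j u1 *m E *m xi^T = 0 -> pform p.+1 xi (Nor j u1) = 0 ->
    pform p.+1 xi (pf j u2) = pform p.+1 xi (pf j u1).
  move=> jx rU; exact: (patch_affine_hull (@patch_open _ _ _ M j) (patch_smooth hphi j)
    (patch_norm hphi (i := j)) (patch_gram_unit hphi (i := j)) (@patch_normalP j)
    (@patch_directional j) (@patch_normal_phi j) m2 rU).
(* Requiring the height on a neighbourhood makes [F] locally constant: if [F] holds at [y], then
   [xi] is orthogonal to the tangent space and to [N] there, and the patch result spreads the height
   [d] over a chart ball around [x]. *)
pose F (x : M) := `[< \forall y \near x, pform p.+1 xi (phi y) = d >].
have F0 : F x0.
  apply/asboolP; have [r [r0 rU n1]] := near_chart ix0.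
  apply: filterS n1 => y [iy ry]; rewrite -(phi_coord phi iy).
  rewrite (ball_const _ _ _ ix0 rU (crd i x0) (crd i y))//.
  - by rewrite phi_coord.
  - exact: ballxx.
  - by rewrite (normal_atE ix0).
have Fl (x : M) : \forall y \near x, F y = F x.
  have [Fx|Fx] := boolP (F x).
    move/asboolP: Fx => /near_join; apply: filterS => y hy.
    exact/asboolP.
  have [j jx] := chart_cover x; have [r [r0 rU n1]] := near_chart jx.
  apply: filterS (n1) => y [jy ry]; apply/negbTE; apply: contra Fx => /asboolP hy.
  have ju : cimage j (crd j y) by exists y.
  have [//|hJ hN] := @constant_height_orthogonal j (crd j y) xi d ju.
    have pc : (@param _ _ _ M j) @ (crd j y) --> param j (crd j y) by exact: param_continuous.
    by rewrite chart_coordK// in pc; exact: pc hy.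
  apply/asboolP; apply: filterS n1 => z [jz rz]; rewrite -(phi_coord phi jz).
  rewrite (ball_const _ _ _ jx rU (crd j y) (crd j z))// phi_coord//.
  exact: nbhs_singleton hy.
move=> x; have /asboolP := etrans (connected_locally_constant (@carrier_connected _ _ _ M) Fl x x0) F0.
exact: nbhs_singleton.
Qed.

(** The geodesic equation in any chart says exactly that the tangential coefficient of the flat
    acceleration is 0. The last clause recovers the initial velocity, the only place where a chart
    remains visible. *)
Lemma geodesic_curve (gamma : R -> M) : geodesic gamma ->
  exists dY : R -> 'rV[R]_n.+1,
   [/\ forall t : R, is_derive t 1 (phi \o gamma) (dY t),
       forall t : R, is_derive t 1 dY (pform p.+1 (dY t) (dY t) *: normal_at (gamma t)) &
       forall (i : chart M), cdom i (gamma 0) ->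
         dY 0 = derive1 (chart_coord i \o gamma) 0 *m J i (crd i (gamma 0))].
Proof.
move=> [gc gg]; pose dY := fun t : R => 'D_(1 : R) (phi \o gamma : R -> 'rV[R]_n.+1) t; exists dY.
have loc (i : chart M) (t : R) : cdom i (gamma t) -> let c := chart_coord i \o gamma in
    let I := gamma @^-1` cdom i in
    is_derive t 1 (phi \o gamma) ('D_1 c t *m J i (c t)) /\
      is_derive t 1 dY (pform p.+1 ('D_1 c t *m J i (c t)) ('D_1 c t *m J i (c t))
         *: normal_at (gamma t)).
  move=> it c I; have [cs cg] := gg i.
  have oI : open I by move/continuousP : gc; apply; exact: cdom_open.
  have cd t' : I t' -> differentiable c t' by have [cd _] := cs 1%N; exact: cd.
  have cd1 t' : I t' -> differentiable ('D_1 c) t'.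
    by have [_ /(_ 1) [cd' _]] := cs 2%N; exact: cd'.
  have cU t' : I t' -> cimage i (c t') by move=> It'; exists (gamma t').
  have sm := patch_smooth hphi i.
  have first t' : I t' -> is_derive t' 1 (phi \o gamma) ('D_1 c t' *m J i (c t')).
    move=> It'; apply: near_eq_is_derive (patch_curve_derive sm cd cU It').
    near=> y; rewrite /c/= chart_coordK//.
    by near: y; exact: open_nbhs_nbhs.
  split; first exact: first.
  have It : I t by [].
  have S := patch_curve_derive2 sm cd cd1 cU It.
  have dYd : is_derive t 1 dY ('D_1 ('D_1 c) t *m J i (c t) +
      'D_1 c t *m hessian_mx (pf i) ('D_1 c t) (c t)).
    apply: near_eq_is_derive S; near=> y.
    have Iy : I y by near: y; exact: open_nbhs_nbhs.
    by have [_ <-] := first _ Iy.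
  apply: (is_derive_eq dYd).
  rewrite (umbilical_acceleration (@patch_open _ _ _ M i) sm (patch_norm hphi (i := i))
    (patch_gram hphi (i := i)) (patch_umbilical humb (i := i)) _ (cU _ It)).
  rewrite addrA -mulmxDl -(normal_atE it) [X in X *m _](_ : _ = 0) ?mul0mx ?add0r//.
  apply/rowP => k; rewrite !mxE; apply: etrans (cg t it k).
  have e1 : derive1 c = 'D_1 c by apply/funext => x; rewrite derive1E.
  have e2 : derive1n 2 c t = 'D_1 ('D_1 c) t.
    by rewrite -[derive1n 2 c]/(derive1 (derive1 c)) e1 derive1E.
  by rewrite e2 e1.
split=> [t|t|i i0].
- have [i it] := chart_cover (gamma t); have [D _] := loc i t it.
  by split; [case: D|].
- have [i it] := chart_cover (gamma t); have [[_ D] D2] := loc i t it.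
  by rewrite -[dY t]/('D_1 (phi \o gamma) t) D.
- have [[_ D] _] := loc i 0 i0.
  by rewrite /dY D derive1E.
Unshelve. all: by end_near. Qed.

End umbilical_immersion_global.

Lemma pform_continuous (R : realType) q N (x : 'rV[R]_N) :
  continuous (fun y => pform q y x : R).
Proof.
move=> y; rewrite (_ : (fun y => _) = (fun y => (y *m (eta_mx R q N *m x^T)) 0 0)).
  have h1 := @mulmx_rV_continuous R N 1 (eta_mx R q N *m x^T) y.
  exact: cvg_comp h1 (@coord_continuous _ _ _ 0 0 _).
by apply/funext => z; rewrite pformE mulmxA.
Qed.

(** * Nonnull hyperplanes cut out totally geodesic hypersurfaces *)

Section hyperplane_section.
Variables (R : realType) (n p : nat).
Local Notation E := (eta_mx R p.+1 n.+2).
Implicit Types x y xi : 'rV[R]_n.+2.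

Definition hyperplane_section xi : set 'rV[R]_n.+2 :=
  [set y | phyp p 1 y /\ pform p.+1 xi y = 0].

Lemma smooth_quadratic q k N (B : 'M[R]_(k, N)) (U : set 'rV[R]_k) : open U ->
  smooth_on U (fun u => 1 + pform q (u *m B) (u *m B) : R).
Proof.
move=> oU.
have entry i : smooth_on U (fun u => (u *m B) 0 i : R).
  have lin : linear (fun u : 'rV[R]_k => (u *m B) 0 i : R^o).
    by move=> a u v; rewrite mulmxDl -scalemxAl !mxE.
  pose F := GRing.isLinear.Build _ _ _ _ _ lin.
  pose L : {linear 'rV[R]_k -> R^o} := HB.pack (fun u : 'rV[R]_k => (u *m B) 0 i) F.
  exact: (smooth_linear L).
move=> l; have sumC := @Ck_on_sum R _ _ l U _ (index_enum 'I_N)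
  (fun i u => (-1) ^+ (i < q)%N * (u *m B) 0 i * (u *m B) 0 i : R) oU _.
apply: (Ck_onD oU (Ck_on_cst l U (1 : R)) (sumC _)) => i.
have sgn := Ck_on_cst l U ((-1) ^+ (i < q)%N : R).
exact: Ck_onM oU (Ck_onM oU sgn (entry i l)) (entry i l).
Qed.

Section local_parametrization.
Variables (xi x : 'rV[R]_n.+2).
Hypotheses (xi0 : pform p.+1 xi xi != 0) (Sx : hyperplane_section xi x).

Let xx : pform p.+1 x x = -1. Proof. by case: Sx; rewrite /phyp/= expr1n. Qed.
Let xix : pform p.+1 xi x = 0. Proof. by case: Sx. Qed.

(** The [n] rows of [A] with [y] and [xi] are independent, as pairing with the nonnull [y] and [xi]
    shows, so they span the whole space and only 0 is orthogonal to all of them. *)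
Lemma frame_unit (A : 'M[R]_(n, n.+2)) y : row_free A ->
  A *m E *m xi^T = 0 -> A *m E *m y^T = 0 ->
  pform p.+1 y y = -1 -> pform p.+1 xi y = 0 ->
  forall z, A *m E *m z^T = 0 -> pform p.+1 z y = 0 -> pform p.+1 z xi = 0 -> z = 0.
Proof.
move=> Af Axi Ay yy xiy z Az zy zxi.
pose Z : 'M[R]_(n + (1 + 1), n.+2) := col_mx A (col_mx y xi).
have Zf : row_free Z.
  rewrite -kermx_eq0; apply/rowV0P => v /sub_kermxP.
  rewrite -[v]hsubmxK -[rsubmx v]hsubmxK !mul_row_col.
  set a := lsubmx v; set b := lsubmx (rsubmx v); set c := rsubmx (rsubmx v).
  rewrite (mx11_scalar b) (mx11_scalar c) !mul_scalar_mx => v0.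
  have b0 : b 0 0 = 0.
    have := congr1 (fun t => pform p.+1 t y) v0.
    rewrite /= !(pformDl, pformZl, pform0l) (pform_mulmx a Ay) yy xiy.
    lra.
  have c0 : c 0 0 = 0.
    have := congr1 (fun t => pform p.+1 t xi) v0.
    rewrite /= !(pformDl, pformZl, pform0l) (pform_mulmx a Axi) b0 mul0r !add0r.
    by move/eqP; rewrite mulf_eq0 (negbTE xi0) orbF => /eqP.
  move: v0; rewrite b0 c0 !scale0r !addr0 => aA.
  have -> : a = 0 by apply/eqP; rewrite -(mulmx_free_eq0 _ Af) aA.
  by rewrite !raddf0 !row_mx0.
apply: (@pform_nondegenerate _ p.+1) => w.
have /submxP[D ->] : (w <= Z)%MS.
  apply: submx_full; rewrite /row_full.
  by move/eqP: Zf => ->; rewrite addnC.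
rewrite pformC -[D]hsubmxK -[rsubmx D]hsubmxK !mul_row_col !pformDl.
rewrite (pform_mulmx _ Az) (mx11_scalar (lsubmx (rsubmx D))).
rewrite (mx11_scalar (rsubmx (rsubmx D))) !mul_scalar_mx !pformZl.
by rewrite (pformC _ y) zy (pformC _ xi) zxi !mulr0 !addr0.
Qed.

Lemma frame_gram_unit (A : 'M[R]_(n, n.+2)) y : row_free A ->
  A *m E *m xi^T = 0 -> A *m E *m y^T = 0 ->
  pform p.+1 y y = -1 -> pform p.+1 xi y = 0 -> A *m E *m A^T \in unitmx.
Proof.
move=> Af Axi Ay yy xiy; rewrite -row_free_unit -kermx_eq0.
apply/rowV0P => v /sub_kermxP vG.
have vA : v *m A = 0.
  apply: (frame_unit Af Axi Ay yy xiy); last exact: pform_mulmx.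
    by apply: trmx_inj; rewrite !trmx_mul trmxK trmx_eta trmx0 mulmxA trmxK -vG !mulmxA.
  exact: pform_mulmx.
by apply/eqP; rewrite -(mulmx_free_eq0 _ Af) vA.
Qed.

Lemma tangent_basis : exists2 B : 'M[R]_(n, n.+2), row_free B &
  B *m E *m xi^T = 0 /\ B *m E *m x^T = 0.
Proof.
pose W : 'M[R]_(1 + 1, n.+2) := col_mx xi x.
pose K := kermx (E *m W^T).
have rW : \rank W = 2%N.
  apply/eqP; rewrite -[2%N]/(1 + 1)%N -/(row_free W) -kermx_eq0; apply/rowV0P => v /sub_kermxP.
  rewrite -[v]hsubmxK mul_row_col; set b := lsubmx v; set c := rsubmx v.
  rewrite (mx11_scalar b) (mx11_scalar c) !mul_scalar_mx => v0.
  have c0 : c 0 0 = 0.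
    have := congr1 (fun t => pform p.+1 t x) v0.
    by rewrite /= !(pformDl, pformZl, pform0l) xix xx; lra.
  have b0 : b 0 0 = 0.
    have := congr1 (fun t => pform p.+1 t xi) v0.
    rewrite /= !(pformDl, pformZl, pform0l) c0 mul0r !addr0.
    by move/eqP; rewrite mulf_eq0 (negbTE xi0) orbF => /eqP.
  by rewrite b0 c0 !raddf0 row_mx0.
have rK : \rank K = n by rewrite rank_orthogonal rW subSS subSS subn0.
have : exists2 B : 'M[R]_(\rank K, n.+2), (B <= K)%MS & row_free B.
  by exists (row_base K); rewrite ?eq_row_base ?row_base_free.
rewrite rK => -[B BK Bf].
exists B => //; move/sub_kermxP: BK; rewrite tr_col_mx mulmxA mul_mx_row.
by rewrite -[0 in RHS]row_mx0 => /eq_row_mx.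
Qed.

Variables (B : 'M[R]_(n, n.+2)).
Hypotheses (Bf : row_free B) (Bxi : B *m E *m xi^T = 0) (Bx : B *m E *m x^T = 0).

(** The section is parametrized near [x] as a graph over its tangent space; this height is what
    restores the norm -1. *)
Definition graph_height (u : 'rV[R]_n) : R :=
  Num.sqrt (1 + pform p.+1 (u *m B) (u *m B)).

Definition graph_domain : set 'rV[R]_n := [set u | 0 < 1 + pform p.+1 (u *m B) (u *m B)].

Definition graph_param (u : 'rV[R]_n) : 'rV[R]_n.+2 := u *m B + graph_height u *: x.

Lemma graph_height_sqr u : graph_domain u ->
  graph_height u ^+ 2 = 1 + pform p.+1 (u *m B) (u *m B).
Proof. by move=> Uu; rewrite sqr_sqrtr// ltW. Qed.

Lemma graph_param_section u : graph_domain u -> hyperplane_section xi (graph_param u).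
Proof.
move=> Uu; split; last first.
  by rewrite pformDr pformZr xix mulr0 addr0 pformC (pform_mulmx _ Bxi).
rewrite /phyp/= expr1n !(pformDl, pformDr, pformZl, pformZr).
rewrite (pform_mulmx _ Bx) pformC (pform_mulmx _ Bx) xx.
have := graph_height_sqr Uu; rewrite expr2.
set a := pform _ _ _; set h := graph_height u; rewrite /h -/a => hh.
by rewrite !mulr0 addr0 add0r mulrN1 mulrN hh; lra.
Qed.

Lemma graph_domain_open : open graph_domain.
Proof.
have qc : continuous (fun u : 'rV[R]_n => 1 + pform p.+1 (u *m B) (u *m B) : R).
  by move=> u; exact: (smooth_quadratic p.+1 B openT 0%N).
by move/continuousP : qc => /(_ [set t | 0 < t]); apply; exact: open_gt.
Qed.

Lemma graph_param_smooth : smooth_on graph_domain graph_param.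
Proof.
have oU := graph_domain_open.
have rs : smooth_on graph_domain graph_height.
  apply: smooth_sqrt => //; exact: smooth_quadratic.
move=> k; apply: Ck_onD => //; last exact: Ck_onZl.
exact: (smooth_linear (mulmxr B)).
Qed.

(** [P] reads the coordinates along the tangent basis [B] by orthogonal projection. It inverts the
    graph, whence injectivity, rank and openness of the parametrization. *)
Lemma graph_coordinates : exists2 P : 'M[R]_(n.+2, n),
  forall u c, (u *m B + c *: x) *m P = u &
  forall y, pform p.+1 xi y = 0 -> y = y *m P *m B - pform p.+1 y x *: x.
Proof.
have Gu := frame_gram_unit Bf Bxi Bx xx xix.
pose P := E *m B^T *m invmx (B *m E *m B^T).
have BP : B *m P = 1%:M by rewrite /P !mulmxA mulmxV.
have xP : x *m P = 0.
  have : x *m E *m B^T = 0.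
    by apply: trmx_inj; rewrite !trmx_mul trmxK trmx_eta trmx0 mulmxA.
  by rewrite /P !mulmxA => ->; rewrite mul0mx.
exists P => [u c|y yxi].
  by rewrite mulmxDl -mulmxA BP mulmx1 -scalemxAl xP scaler0 addr0.
apply/eqP; rewrite -subr_eq0; apply/eqP; apply: (frame_unit Bf Bxi Bx xx xix).
- apply: trmx_inj; rewrite !trmx_mul trmxK trmx_eta trmx0 mulmxA.
  rewrite mulmxBl mulmxBl !mulmxBl -scalemxAl.
  have xB : x *m E *m B^T = 0.
    by apply: trmx_inj; rewrite !trmx_mul trmxK trmx_eta trmx0 mulmxA.
  have e : P *m B *m E *m B^T = E *m B^T.
    by rewrite /P -(mulmxA _ B E) -(mulmxA _ (B *m E)) mulmxKV.
  have e2 : y *m P *m B *m E *m B^T = y *m E *m B^T by rewrite -[RHS]mulmxA -e !mulmxA.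
  by rewrite -!scalemxAl xB scaler0 subr0 e2 subrr.
- rewrite !(pformDl, pformNl, pformZl) (pform_mulmx _ Bx) xx; lra.
- rewrite !(pformDl, pformNl, pformZl) (pform_mulmx _ Bxi) (pformC _ x) xix pformC yxi.
  by rewrite mulr0 subrr subr0.
Qed.

(** The norm equation determines the coefficient of [x] up to sign, and the open condition
    [<y, x> < 0] selects the positive root. *)
Lemma graph_image_open (V : set 'rV[R]_n) : open V -> V `<=` graph_domain ->
  relatively_open (hyperplane_section xi) (graph_param @` V).
Proof.
move=> oV VU; have [P Pc Pd] := graph_coordinates.
exists ([set y | pform p.+1 y x < 0] `&` [set y | V (y *m P)]); split.
  apply: openI.
    have /continuousP/(_ [set t | t < 0]) := @pform_continuous R p.+1 _ x.
    by apply; exact: open_lt.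
  by have /continuousP := @mulmx_rV_continuous R _ _ P; apply.
apply/seteqP; split=> [_ [u Vu <-]|y [[yS yxi] [yx Vy]]].
  have Uu := VU _ Vu; split; first exact: graph_param_section.
  split; last by rewrite /= Pc.
  rewrite /= pformDl pformZl (pform_mulmx _ Bx) xx add0r mulrN1 oppr_lt0.
  by rewrite sqrtr_gt0.
exists (y *m P) => //; rewrite /graph_param [RHS](Pd _ yxi) -scaleNr; congr (_ + _ *: _).
have Uy := VU _ Vy; move: yS; rewrite /phyp/= expr1n {1 2}(Pd _ yxi).
set a := pform p.+1 y x in yx *.
rewrite !(pformDl, pformDr, pformZl, pformZr, pformNl, pformNr).
rewrite (pform_mulmx _ Bx) pformC (pform_mulmx _ Bx) xx => e.
rewrite /graph_height; set q := pform _ _ _ in e *.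
have -> : 1 + q = (- a) ^+ 2 by rewrite sqrrN expr2; lra.
by rewrite sqrtr_sqr ger0_norm// oppr_ge0 ltW.
Qed.

Lemma graph_param_norm u : graph_domain u ->
  pform p.+1 (graph_param u) (graph_param u) = -1.
Proof. by move=> /graph_param_section[]; rewrite /phyp/= expr1n. Qed.

Lemma graph_tangent u v : graph_domain u ->
  exists c, v *m tangent_mx graph_param u = v *m B + c *: x.
Proof.
move=> Uu; rewrite -(patch_derivE graph_param_smooth v Uu).
have rd : differentiable graph_height u.
  have rs : smooth_on graph_domain graph_height.
    by apply: smooth_sqrt => //; [exact: graph_domain_open|exact/smooth_quadratic/graph_domain_open].
  by have [rd _] := rs 1%N; exact: rd.
have bd := linear_rV_derive (mulmxr B : {linear 'rV[R]_n -> 'rV[R]_n.+2}) u v.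
exists ('D_v graph_height u).
have h2 : is_derive u v (fun w => graph_height w *: x) ('D_v graph_height u *: x).
  have zd := @differentiableZl _ _ _ _ x _ rd.
  split; first exact: diff_derivable.
  by rewrite deriveE// diffZl// deriveE.
have [_] : is_derive u v graph_param (v *m B + 'D_v graph_height u *: x) := is_deriveD bd h2.
by [].
Qed.

Lemma graph_tangent_orthogonal u : graph_domain u ->
  tangent_mx graph_param u *m E *m xi^T = 0.
Proof.
move=> Uu; apply/eta_col0P => a; rewrite rowE.
have [c ->] := graph_tangent (delta_mx 0 a) Uu.
by rewrite pformDl pformZl (pform_mulmx _ Bxi) pformC xix mulr0 addr0.
Qed.

Lemma graph_tangent_position u : graph_domain u ->
  tangent_mx graph_param u *m E *m (graph_param u)^T = 0.
Proof.
move=> Uu; apply: trmx_inj; rewrite !trmx_mul trmxK trmx_eta trmx0 mulmxA.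
exact: (patch_position_normal graph_domain_open graph_param_smooth graph_param_norm Uu).
Qed.

Lemma graph_tangent_free u : graph_domain u -> row_free (tangent_mx graph_param u).
Proof.
move=> Uu; have [P Pc _] := graph_coordinates.
rewrite -kermx_eq0; apply/rowV0P => v /sub_kermxP vJ.
by have [c E0] := graph_tangent v Uu; rewrite -(Pc v c) -E0 vJ mul0mx.
Qed.

Lemma graph_gram_unit u : graph_domain u -> induced_gram p graph_param u \in unitmx.
Proof.
move=> Uu; rewrite induced_gramE; have [_ s2] := graph_param_section Uu.
exact: (frame_gram_unit (graph_tangent_free Uu) (graph_tangent_orthogonal Uu)
  (graph_tangent_position Uu) (graph_param_norm Uu) s2).
Qed.

(** The second fundamental form is orthogonal to the tangent space and to the position by
    construction, and to [xi] because the graph stays in the orthogonal of [xi]; [frame_unit] leaves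
    only 0. *)
Lemma graph_second_ff u a b : graph_domain u ->
  second_ff p (induced_gram p graph_param) graph_param u a b = 0.
Proof.
move=> Uu; have oU := graph_domain_open; have fs := graph_param_smooth.
have fH := graph_param_norm; have [_ s2] := graph_param_section Uu.
have fPi : graph_param u *m normal_proj p graph_param u = graph_param u.
  exact: normal_proj_normal (patch_position_normal oU fs fH Uu).
have xiPi : xi *m normal_proj p graph_param u = xi.
  apply: normal_proj_normal; apply: trmx_inj.
  by rewrite !trmx_mul trmxK trmx_eta trmx0 mulmxA graph_tangent_orthogonal.
have swap (y z : 'rV[R]_n.+2) : pform p.+1 (y *m normal_proj p graph_param u) z
    = pform p.+1 y (z *m normal_proj p graph_param u).
  by rewrite !pformE -(mulmxA _ _ E) eta_normal_proj trmx_mul !mulmxA.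
rewrite (second_ffE oU fs fH (fun _ _ => erefl))//.
apply: (frame_unit (graph_tangent_free Uu) (graph_tangent_orthogonal Uu)
  (graph_tangent_position Uu) (fH _ Uu) s2).
- apply: trmx_inj; rewrite !trmx_mul trmxK trmx_eta trmx0 mulmxA.
  rewrite !mulmxBl (normal_proj_orthogonal graph_gram_unit)// -!scalemxAl.
  by rewrite (patch_position_normal oU fs fH Uu) scaler0 subrr.
- rewrite pformDl pformNl pformZl swap fPi (pform_partial2 oU fs fH a b Uu) fH//.
  by rewrite mulrN1 opprK addNr.
- rewrite pformDl pformNl pformZl swap xiPi [pform _ (graph_param u) xi]pformC s2 mulr0 subr0.
  have D1 v w : graph_domain w -> pform p.+1 xi ('D_v graph_param w) = 0.
    move=> Uw; rewrite (patch_derivE fs v Uw) pformC; apply: pform_mulmx.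
    exact: graph_tangent_orthogonal.
  have /derivableP fd := @diff_derivable _ _ _ _ _ (ebase R a)
    (patch_differentiable1 fs (ebase R b) Uu).
  have [_ D] := is_derive_pform p.+1 (is_derive_cst xi u (ebase R a)) fd.
  rewrite pform0l add0r in D; rewrite pformC; apply: etrans (esym D) _.
  transitivity ('D_(ebase R a) (cst (0 : R)) u); last by rewrite derive_cst.
  by apply: near_eq_derive; near=> w; apply: D1; near: w; exact: open_nbhs_nbhs.
Unshelve. all: by end_near. Qed.

End local_parametrization.

Lemma hyperplane_section_totally_geodesic xi : pform p.+1 xi xi != 0 ->
  totally_geodesic_hypersurface p (hyperplane_section xi).
Proof.
move=> xi0; split=> [y []//|x Sx].
have [B Bf [Bxi Bx]] := tangent_basis xi0 Sx.
exists (graph_domain B), (graph_param x B); split.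
- split; first exact: graph_domain_open.
  exists 0; first by rewrite /graph_domain/= mul0mx pform0l addr0.
  by rewrite /graph_param /graph_height mul0mx pform0l addr0 sqrtr1 scale1r add0r.
- split; first exact: graph_param_smooth.
  have [P Pc _] := graph_coordinates xi0 Sx Bf Bxi Bx.
  by move=> u v _ _ uv; rewrite -(Pc u (graph_height B u)) -/(graph_param x B u) uv Pc.
- by move=> V oV VU; exact: (graph_image_open xi0 Sx Bf Bxi Bx).
- by move=> u Uu; exact: (graph_gram_unit xi0 Sx Bf Bxi Bx).
- by move=> u Uu a b; exact: (graph_second_ff xi0 Sx Bf Bxi Bx).
Qed.

End hyperplane_section.

Lemma full_not_in_hyperplane (R : realType) m s n p (M : pseudoRiemannian R m s)
    (phi : M -> 'rV[R]_n.+1) (xi : 'rV[R]_n.+1) :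
  (0 < n)%N -> (forall x, phyp p 1 (phi x)) -> full p phi ->
  (forall x, pform p.+1 xi (phi x) = 0) -> pform p.+1 xi xi = 0.
Proof.
case: n phi xi => // n phi xi _ hphi hfull xphi.
apply/eqP; apply: contraPT hfull => xi0 hfull; apply: hfull.
exists (hyperplane_section p xi); split; first exact: hyperplane_section_totally_geodesic.
by move=> _ [x _ <-]; split.
Qed.

Lemma relatively_open_near (T : topologicalType) (A B : set T) : A `<=` B ->
  (forall a, A a -> \forall y \near a, B y -> A y) -> relatively_open B A.
Proof.
move=> AB An; exists (interior [set y | B y -> A y]); split; first exact: open_interior.
apply/seteqP; split=> [a Aa|a [Ba /interior_subset]]; last exact.
by split; [exact: AB|exact: An].
Qed.

(** * The image is open in the quadric *)

Section affine_hull_quadric.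
Variables (R : realType) (m s n p : nat).
Hypothesis m2 : (2 <= m)%N.
Variables (M : pseudoRiemannian R m s) (phi : M -> 'rV[R]_n.+1).
Hypothesis hphi : isometric_immersion p phi.
Hypothesis humb : totally_umbilical p phi.

Local Notation E := (eta_mx R p.+1 n.+1).
Local Notation pf i := (phi \o @param _ _ _ M i).
Local Notation crd i x := (@chart_coord _ _ _ M i x).
Local Notation J i := (tangent_mx (pf i)).
Local Notation N := (normal_at p phi).

(* The intersection of H^n_p(-1) with the affine hull of the image. *)
Definition hull_quadric : set 'rV[R]_n.+1 :=
  [set y | phyp p 1 y /\ forall xi, (forall x x', pform p.+1 xi (phi x) = pform p.+1 xi (phi x')) ->
    forall x, pform p.+1 xi y = pform p.+1 xi (phi x)].

Lemma range_hull_quadric : range phi `<=` hull_quadric.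
Proof. by move=> _ [x _ <-]; split; [case: hphi|move=> xi xc x'; exact: xc]. Qed.

(** Vectors orthogonal to the tangent space and to [N] have constant height on the image, so the
    double orthogonal puts [y - phi x] in the span of both. Pairing with [phi x] gives the
    coefficient of [N], and [<y, y> = -1] gives the quadratic relation. *)
Lemma hull_quadric_decompose (i : chart M) x y : cdom i x -> hull_quadric y ->
  exists v, y = phi x + v *m J i (crd i x) + (-1 - pform p.+1 y (phi x)) *: N x /\
    pform p.+1 (v *m J i (crd i x)) (v *m J i (crd i x)) =
      let a := -1 - pform p.+1 y (phi x) in 2 * a - pform p.+1 (N x) (N x) * a ^+ 2.
Proof.
move=> ix [yH yA].
have iu : cimage i (crd i x) by exists x.
have : (y - phi x <= col_mx (J i (crd i x)) (N x))%MS.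
  apply: (@double_orthogonal _ p.+1) => w.
  rewrite !mul_col_mx -[0]col_mx0 => /eq_col_mx[Jw Nw].
  have wN : pform p.+1 w (N x) = 0 by rewrite pformC pformE Nw mxE.
  have wc := umbilical_affine_hull m2 hphi humb ix Jw wN.
  rewrite pformC pformDr pformNr (yA w _ x) ?subrr// => z z'.
  by rewrite !wc.
move=> /submxP[D]; rewrite -[D]hsubmxK mul_row_col (mx11_scalar (rsubmx D)) mul_scalar_mx.
set v := lsubmx D; set a := rsubmx D 0 0 => yE.
have {}yE : y = phi x + v *m J i (crd i x) + a *: N x.
  by rewrite -addrA -yE addrC subrK.
have vN : pform p.+1 (v *m J i (crd i x)) (N x) = 0.
  by apply: pform_mulmx; exact: (normal_at_tangent m2 hphi humb ix).
have vphi : pform p.+1 (v *m J i (crd i x)) (phi x) = 0.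
  apply: pform_mulmx; apply: trmx_inj; rewrite !trmx_mul trmxK trmx_eta trmx0 mulmxA.
  rewrite -(phi_coord phi ix).
  exact: (patch_position_normal (@patch_open R m s M i) (patch_smooth hphi i)
    (patch_norm hphi (i := i)) iu).
have Nphi : pform p.+1 (N x) (phi x) = -1 by exact: (normal_at_phi m2 hphi humb).
have phi1 := phi_norm hphi x.
have aE : -1 - pform p.+1 y (phi x) = a.
  rewrite yE; move: (v *m _) (N x) (phi x) vphi Nphi phi1 => X Y Z h1 h2 h3.
  by rewrite !(pformDl, pformZl) h1 h2 h3; lra.
exists v; rewrite aE; split=> //=.
have := (phyp1 p y).1 yH; rewrite yE.
move: (v *m _) (N x) (phi x) vN vphi Nphi phi1 => X Y Z h0 h1 h2 h3.
rewrite !(pformDl, pformDr, pformZl, pformZr) h0 h1 h2 h3.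
rewrite (pformC _ Z X) (pformC _ Z Y) (pformC _ Y X) h0 h1 h2.
by move: (pform _ X X) (pform _ Y Y) => qx qy h; lra.
Qed.

(** If [v *m X w = 0] then [v = v *m (1%:M - X w)], impossible for nonzero [v] once the entries of
    [1%:M - X w] are at most [1 / (k + 1)]. *)
Lemma near_unitmx k (X : 'rV[R]_m -> 'M[R]_k) u :
  X u = 1%:M -> (forall a b, {for u, continuous (fun w => X w a b : R)}) ->
  \forall w \near u, X w \in unitmx.
Proof.
move=> Xu Xc.
have e0 : 0 < (k.+1%:R)^-1 :> R by rewrite invr_gt0 ltr0n.
have : \forall w \near u, forall ab : 'I_k * 'I_k, `|X u ab.1 ab.2 - X w ab.1 ab.2| < (k.+1%:R)^-1.
  apply: (@filter_forall _ _ _ (nbhs u)) => ab.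
  by have /cvgrPdist_lt/(_ _ e0) := Xc ab.1 ab.2.
apply: filterS => w Xw; rewrite -row_free_unit -kermx_eq0; apply/rowV0P => v /sub_kermxP vX.
have nX : `|1%:M - X w| <= (k.+1%:R)^-1.
  apply: mx_norm_le; first exact: ltW.
  by move=> a b; rewrite -Xu; have := Xw (a, b); rewrite !mxE => /ltW.
have vE : v = v *m (1%:M - X w) by rewrite mulmxBr mulmx1 vX subr0.
have := mx_norm_mulmx v (1%:M - X w); rewrite -vE => h.
apply/eqP; rewrite -normr_le0.
have h2 : k%:R * `|1%:M - X w| <= k%:R * (k.+1%:R)^-1 by rewrite ler_wpM2l.
have h3 : k%:R * (k.+1%:R)^-1 < 1 :> R.
  by rewrite ltr_pdivrMr ?ltr0n// mul1r ltr_nat.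
have := normr_ge0 v; move: h h2 h3; move: (k%:R * _) (k%:R * _) (`|v|) => a b c.
by nra.
Qed.

Lemma range_relatively_open : relatively_open hull_quadric (range phi).
Proof.
apply: relatively_open_near; first exact: range_hull_quadric.
move=> _ [x _ <-]; have [i ix] := chart_cover x.
have iu : cimage i (crd i x) by exists x.
set u0 := crd i x in iu *; set J0 := J i u0.
have G0 := patch_gram_unit hphi iu; have fs := patch_smooth hphi i.
have oU := @patch_open R m s M i.
(* [Q] extracts the tangential coordinates at [x]; [F] is therefore a map between spaces of
   dimension [m] with identity Jacobian at [u0]. *)
pose Q := E *m J0^T *m invmx (induced_gram p (pf i) u0).
have JQ : J0 *m Q = 1%:M by rewrite /Q !mulmxA -induced_gramE mulmxV.
pose F u := (pf i u - phi x) *m Q.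
have Fd u v : cimage i u -> is_derive u v F (v *m (J i u *m Q)).
  move=> iu'; rewrite mulmxA.
  have d1 := is_deriveB (patch_derive fs v iu') (is_derive_cst (phi x) u v).
  have := is_derive_mulmx d1 (is_derive_cst Q u v).
  by rewrite subr0 mulmx0 addr0.
have Fdiff u : cimage i u -> differentiable F u.
  move=> iu'; apply: (@differentiable_comp _ _ _ _ (fun u => pf i u - phi x) (mulmxr Q)).
    by apply: differentiableB => //; exact: (patch_differentiable fs iu').
  exact: linear_rV_differentiable.
have FJ u : cimage i u -> jacobian F u = J i u *m Q.
  move=> iu'; apply/row_matrixP => a; rewrite !rowE -deriveEjacobian; last exact: Fdiff.
  by have [_ ->] := Fd u (delta_mx 0 a) iu'.
pose k := pform p.+1 (N x) (N x).
have kbound (T : Type) (F' : set_system T) (h : T -> R) : Filter F' ->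
    h @ F' --> (-1 : R) -> \forall t \near F', k * (-1 - h t) < 1.
  move=> FF /cvgrPdist_lt hc.
  have e0 : 0 < (`|k| + 1)^-1 by rewrite invr_gt0 ltr_wpDl.
  apply: filterS (hc _ e0) => t ht; rewrite (le_lt_trans (ler_norm _))// normrM.
  rewrite (@le_lt_trans _ _ ((`|k| + 1) * `|-1 - h t|))//.
    by rewrite ler_wpM2r// lerDl.
  by rewrite -ltr_pdivlMl ?ltr_wpDl// mulr1.
(* Besides invertibility of the Jacobian, [V] imposes the bound that singles out one root of the
   quadratic relation. *)
pose V := [set u | cimage i u /\ J i u *m Q \in unitmx /\ k * (-1 - pform p.+1 (pf i u) (phi x)) < 1].
have nV : \forall u \near u0, V u.
  have n1 : \forall u \near u0, cimage i u by exact: open_nbhs_nbhs.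
  have n2 : \forall u \near u0, J i u *m Q \in unitmx.
    apply: near_unitmx => // a b.
    rewrite (_ : (fun w => _) = (fun w => ('D_(ebase R a) (pf i) w *m Q) 0 b)).
      apply: differentiable_continuous.
      apply: (@differentiable_entry _ _ _ _ (fun w => 'D_(ebase R a) (pf i) w *m Q)).
      apply: (@differentiable_comp _ _ _ _ ('D_(ebase R a) (pf i)) (mulmxr Q)).
        exact: (patch_differentiable1 fs).
      exact: linear_rV_differentiable.
    apply/funext => w.
    apply: etrans _ (congr1 (fun y => (y *m Q) 0 b) (row_tangent_mx (pf i) w a)).
    by rewrite /= -row_mul [RHS]mxE.
  have n3 : \forall u \near u0, k * (-1 - pform p.+1 (pf i u) (phi x)) < 1.
    have fc := differentiable_continuous (patch_differentiable fs iu).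
    have c1 : (fun u => pform p.+1 (pf i u) (phi x)) @ u0 --> pform p.+1 (pf i u0) (phi x).
      exact: (cvg_comp _ _ fc (@pform_continuous R p.+1 _ (phi x) (pf i u0))).
    by move: c1; rewrite [pf i u0](phi_coord phi ix) (phi_norm hphi) => /kbound; apply.
  by apply: filterS3 n1 n2 n3.
have Vi u : interior V u -> V u by exact: interior_subset.
have onto : \forall z \near F u0, exists2 u, interior V u & F u = z.
  apply: locally_onto; [exact: open_interior|exact: nV|].
  move=> u /Vi[iu' [Ju _]]; split; first exact: Fdiff.
  by rewrite FJ.
have F0 : F u0 = 0 by rewrite /F phi_coord// subrr mul0mx.
have c3 : (fun y => (y - phi x) *m Q) @ phi x --> F u0.
  have d : differentiable (fun y => (y - phi x) *m Q) (phi x).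
    apply: (@differentiable_comp _ _ _ _ (fun y => y - phi x) (mulmxr Q)).
      exact: differentiableB.
    exact: linear_rV_differentiable.
  have h : (fun y => (y - phi x) *m Q) @ phi x --> (phi x - phi x) *m Q.
    exact: differentiable_continuous d.
  by move: h; rewrite subrr mul0mx F0.
have m1 : \forall y \near phi x, exists2 u, interior V u & F u = (y - phi x) *m Q.
  exact: c3 _ onto.
have m3 : \forall y \near phi x, k * (-1 - pform p.+1 y (phi x)) < 1.
  have := @pform_continuous R p.+1 _ (phi x) (phi x).
  by rewrite /continuous_at (phi_norm hphi) => /kbound; apply.
move: m1 m3; apply: filterS2 => y [u /Vi[iu' [_ ku]] Fu] ky By.
exists (param i u) => //; rewrite -[LHS]/(pf i u).
have Bu : hull_quadric (pf i u) by apply: range_hull_quadric; exists (param i u).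
have [v [yE yq]] := hull_quadric_decompose ix By.
have [w [uE uq]] := hull_quadric_decompose ix Bu.
have NQ : N x *m Q = 0.
  have : N x *m E *m J0^T = 0.
    apply: trmx_inj; rewrite !trmx_mul trmxK trmx_eta trmx0 mulmxA.
    exact: (normal_at_tangent m2 hphi humb ix).
  by rewrite /Q !mulmxA => ->; rewrite mul0mx.
have coord z t c : z = phi x + t *m J0 + c *: N x -> (z - phi x) *m Q = t.
  move=> ->; rewrite -[phi x + _ + _]addrA [X in X - _]addrC addrK mulmxDl -mulmxA JQ mulmx1 -scalemxAl NQ.
  by rewrite scaler0 addr0.
have vw : v = w by rewrite -(coord _ _ _ yE) -(coord _ _ _ uE) -Fu.
move: yq uq yE uE; rewrite vw -/k /=.
set a := -1 - pform p.+1 y (phi x) in ky *; set b := -1 - pform p.+1 (pf i u) (phi x) in ku *.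
move=> -> ab -> ->; congr (_ + _ *: _).
(* Both coefficients solve the same quadratic equation; distinct solutions would satisfy
   [k a + k b = 2], against [k a < 1] and [k b < 1]. *)
have : (a - b) * (2 - k * a - k * b) = 0 by move: ab; lra.
move/eqP; rewrite mulf_eq0 subr_eq0 => /orP[/eqP//|/eqP h].
by exfalso; move: ku ky h; lra.
Qed.

End affine_hull_quadric.

(** * Explicit solutions of the geodesic equation in flat coordinates *)

(* [cs], [sn] and [vs] generalize [cos], [sin] and [1 - cos] to the equation
   [y'' = - k y] with [k] of any sign. *)
Section oscillator.
Variable R : realType.

Record oscillator (k : R) (cs sn vs : R -> R) : Prop := Oscillator {
  oscillator_cs : forall t : R, is_derive t 1 cs (- (k * sn t));
  oscillator_sn : forall t : R, is_derive t 1 sn (cs t);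
  oscillator_vs : forall t : R, is_derive t 1 vs (sn t);
  oscillator_cs0 : cs 0 = 1;
  oscillator_sn0 : sn 0 = 0;
  oscillator_vs0 : vs 0 = 0;
  oscillator_pythagoras : forall t, cs t * cs t + k * (sn t * sn t) = 1;
  oscillator_half_angle : forall t, vs t * (1 + cs t) = sn t * sn t }.

Lemma is_derive_rescale (f df : R -> R) (c a b t : R) :
  (forall x : R, is_derive x 1 f (df x)) ->
  is_derive t 1 (fun s => b + c * f (a * s)) (c * (df (a * t) * a)).
Proof.
move=> fd; have lin : is_derive t 1 (fun s : R => a * s) a.
  by apply: is_derive_eq (is_derive_mulr (is_derive_cst a t 1) (is_derive_id t 1)) _;
    rewrite mul0r add0r mulr1.
have d1 := @is_derive1_comp _ f (fun s => a * s) t _ _ (fd (a * t)) lin.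
have d2 := is_derive_mulr (is_derive_cst c t 1) d1.
apply: is_derive_eq (is_deriveD (is_derive_cst b t 1) d2) _.
by rewrite mul0r !add0r.
Qed.

Lemma oscillator_trig (a : R) : a != 0 ->
  oscillator (a ^+ 2) (fun t => 0 + 1 * cos (a * t)) (fun t => 0 + a^-1 * sin (a * t))
    (fun t => a ^- 2 + - a ^- 2 * cos (a * t)).
Proof.
move=> a0; split=> [t|t|t||||t|t].
- apply: is_derive_eq (is_derive_rescale _ _ _ _ (@is_derive_cos R)) _.
  by field.
- apply: is_derive_eq (is_derive_rescale _ _ _ _ (@is_derive_sin R)) _.
  by field.
- apply: is_derive_eq (is_derive_rescale _ _ _ _ (@is_derive_cos R)) _.
  by field.
- by rewrite mulr0 cos0; ring.
- by rewrite mulr0 sin0; ring.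
- by rewrite mulr0 cos0; ring.
- have := cos2Dsin2 (a * t); move: (cos _) (sin _) => c d cd.
  by rewrite -[RHS]cd; field.
- have := cos2Dsin2 (a * t); move: (cos _) (sin _) => c d cd.
  transitivity (a ^- 2 * (1 - c ^+ 2)); first by field.
  by rewrite -[X in X - _]cd; field.
Qed.

Lemma oscillator_line : oscillator 0 (fun=> 1) id (fun t => 2^-1 * (t * t)).
Proof.
split=> [t|t|t||||t|t] //.
- by rewrite mul0r oppr0; exact: (is_derive_cst (1 : R^o) (t : R^o) 1).
- exact: is_derive_id.
- have d := is_derive_mulr (is_derive_cst (2^-1 : R) (t : R) 1)
    (is_derive_mulr (is_derive_id (t : R) 1) (is_derive_id (t : R) 1)).
  by apply: is_derive_eq d _ => /=; rewrite /cst; field.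
- by rewrite !mulr0.
- by rewrite mul0r mulr1 addr0.
- by field.
Qed.

Definition coshR (x : R) : R := (expR x + expR (- x)) / 2.
Definition sinhR (x : R) : R := (expR x - expR (- x)) / 2.

Lemma expRNK (x : R) : expR x * expR (- x) = 1.
Proof. by rewrite -expRD subrr expR0. Qed.

Lemma is_derive_expRN (x : R) : is_derive x 1 (fun y => expR (- y)) (- expR (- x)).
Proof.
have := is_derive_rescale 1 (-1) 0 x (@is_derive_expR R).
rewrite (_ : (fun s => _) = (fun y => expR (- y))); last first.
  by apply/funext => y; rewrite add0r mul1r mulN1r.
by move=> d; apply: is_derive_eq d _; rewrite mul1r mulrN1 mulN1r.
Qed.

Lemma is_derive_coshR (x : R) : is_derive x 1 coshR (sinhR x).
Proof.
have d : is_derive x 1 (fun y => expR y + expR (- y)) (expR x - expR (- x)).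
  exact: is_deriveD (is_derive_expR x) (is_derive_expRN x).
apply: is_derive_eq (is_derive_mulr d (is_derive_cst (2^-1 : R) x 1)) _.
by rewrite mulr0 addr0.
Qed.

Lemma is_derive_sinhR (x : R) : is_derive x 1 sinhR (coshR x).
Proof.
have d : is_derive x 1 (fun y => expR y - expR (- y)) (expR x - - expR (- x)).
  exact: is_deriveB (is_derive_expR x) (is_derive_expRN x).
apply: is_derive_eq (is_derive_mulr d (is_derive_cst (2^-1 : R) x 1)) _.
by rewrite mulr0 addr0 opprK.
Qed.

Lemma coshR2BsinhR2 (x : R) : coshR x ^+ 2 - sinhR x ^+ 2 = 1.
Proof.
rewrite /coshR /sinhR -[RHS](expRNK x); move: (expR x) (expR (- x)) => a b.
by field.
Qed.

Lemma oscillator_hyperbolic (a : R) : a != 0 ->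
  oscillator (- a ^+ 2) (fun t => 0 + 1 * coshR (a * t)) (fun t => 0 + a^-1 * sinhR (a * t))
    (fun t => - a ^- 2 + a ^- 2 * coshR (a * t)).
Proof.
have c0 : coshR 0 = 1 by rewrite /coshR oppr0 expR0; field.
have s0 : sinhR 0 = 0 by rewrite /sinhR oppr0 subrr mul0r.
move=> a0; split=> [t|t|t||||t|t].
- apply: is_derive_eq (is_derive_rescale _ _ _ _ is_derive_coshR) _.
  by field.
- apply: is_derive_eq (is_derive_rescale _ _ _ _ is_derive_sinhR) _.
  by field.
- apply: is_derive_eq (is_derive_rescale _ _ _ _ is_derive_coshR) _.
  by field.
- by rewrite mulr0 c0; ring.
- by rewrite mulr0 s0; ring.
- by rewrite mulr0 c0; ring.
- have := coshR2BsinhR2 (a * t); move: (coshR _) (sinhR _) => c d cd.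
  by rewrite -[RHS]cd; field.
- have := coshR2BsinhR2 (a * t); move: (coshR _) (sinhR _) => c d cd.
  transitivity (a ^- 2 * (c ^+ 2 - 1)); first by field.
  by rewrite -[X in _ - X]cd; field.
Qed.

(** The three sign cases of [k] correspond to [mu] below, above and equal to 1. *)
Lemma oscillator_exists (mu : R) : -1 < mu ->
  exists k cs sn vs, [/\ oscillator k cs sn vs, cs 1 = mu & sn 1 != 0].
Proof.
move=> mu1; have [lt1|gt1|->] := ltgtP mu 1.
- have a0 : 0 < acos mu by rewrite acos_gt0// ltW.
  exists (acos mu ^+ 2); do 3 eexists; split.
  + by apply: oscillator_trig; exact: lt0r_neq0.
  + by rewrite /= add0r mul1r mulr1 acosK// in_itv/= !ltW.
  + rewrite /= add0r mulr1 mulf_neq0 ?invr_neq0 ?lt0r_neq0//.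
    by rewrite sin_gt0_pi// a0 acos_ltpi// mu1 ltW.
(* [ln e] is the inverse hyperbolic cosine of [mu]: the numbers [e] and [1 / e] have sum [2 mu]. *)
- pose e := mu + Num.sqrt (mu ^+ 2 - 1).
  have mu2 : 0 < mu ^+ 2 - 1 by nra.
  have r0 : 0 < Num.sqrt (mu ^+ 2 - 1) by rewrite sqrtr_gt0.
  have e1 : 1 < e by rewrite /e; lra.
  have ee : e * (2 * mu - e) = 1.
    have := sqr_sqrtr (ltW mu2); rewrite /e; move: (Num.sqrt _) => r rr.
    by transitivity (mu ^+ 2 - r ^+ 2); [ring|rewrite rr; ring].
  have e0 : 0 < e by lra.
  have eL : expR (ln e) = e by apply: lnK; rewrite qualifE.
  have eN : expR (- ln e) = 2 * mu - e.
    by apply: (mulfI (lt0r_neq0 e0)); rewrite ee -{1}eL expRNK.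
  exists (- ln e ^+ 2); do 3 eexists; split.
  + by apply: oscillator_hyperbolic; rewrite lt0r_neq0// ln_gt0.
  + by rewrite /= add0r mul1r mulr1 /coshR eL eN; field.
  + rewrite /= add0r mulr1 mulf_neq0 ?invr_neq0 ?lt0r_neq0 ?ln_gt0//.
    by rewrite /sinhR eL eN divr_gt0// /e; lra.
- exists 0; do 3 eexists; split; first exact: oscillator_line.
    by [].
  exact: oner_neq0.
Qed.

Lemma is_derive_scale N (f : R -> R) (F : R -> 'rV[R]_N) df dF (x : R) :
  is_derive x 1 f df -> is_derive x 1 F dF ->
  is_derive x 1 (fun y => f y *: F y) (df *: F x + f x *: dF).
Proof.
move=> fd Fd; apply/is_derive_mxP => i j; rewrite ord1 !mxE.
move/is_derive_mxP : Fd => /(_ 0 j) Fd.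
rewrite (_ : (fun y => _) = (fun y => f y * F y 0 j)).
  exact: is_derive_mulr.
by apply/funext => y; rewrite mxE.
Qed.

Lemma is_derive0_constant N (F : R -> 'rV[R]_N) :
  (forall x : R, is_derive x 1 F 0) -> forall t, F t = F 0.
Proof.
move=> Fd t; apply: (@derive0_constant R R 1 N F 0 (`|t| + 1)).
  move=> x v _; split.
    have [+ _] := Fd x; move=> /derivable1_diffP; exact: diff_derivable.
  have [d dE] := Fd x; have {}d := (derivable1_diffP _ _).1 d.
  rewrite deriveE// -[v]mulr1 -[v * 1]/(v *: (1 : R^o)) linearZ/= -deriveE// dE.
  by rewrite scaler0.
by rewrite -ball_normE/= sub0r normrN ltrDl.
Qed.

(** Taking the acceleration [Z] as an unknown absorbs the constant term of the equation for [Y], so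
    that [k = 0] is no exception. *)
Lemma oscillator_solution N (k : R) (cs sn vs : R -> R) (Y X Z : R -> 'rV[R]_N) :
  oscillator k cs sn vs -> (forall t : R, is_derive t 1 Y (X t)) ->
  (forall t : R, is_derive t 1 X (Z t)) -> (forall t : R, is_derive t 1 Z (- k *: X t)) ->
  forall t, Y t = Y 0 + sn t *: X 0 + vs t *: Z 0.
Proof.
move=> [dc ds dv c0 s0 v0 cs1 _] dY dX dZ.
have XE t : X t = cs t *: X 0 + sn t *: Z 0.
  (* These two combinations have zero derivative; the Pythagorean identity then inverts them to
     recover [X t]. *)
  have P1 : cs t *: X t - sn t *: Z t = X 0.
    have := @is_derive0_constant _ (fun y => cs y *: X y - sn y *: Z y).
    rewrite c0 s0 scale0r subr0 scale1r; apply=> x.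
    apply: is_derive_eq (is_deriveB (is_derive_scale (dc x) (dX x))
      (is_derive_scale (ds x) (dZ x))) _.
    by apply/rowP => j; rewrite !mxE; ring.
  have P2 : (k * sn t) *: X t + cs t *: Z t = Z 0.
    have := @is_derive0_constant _ (fun y => (k * sn y) *: X y + cs y *: Z y).
    rewrite c0 s0 mulr0 scale0r add0r scale1r; apply=> x.
    have kd : is_derive x 1 (fun y => k * sn y) (k * cs x).
      by apply: is_derive_eq (is_derive_mulr (is_derive_cst k x 1) (ds x)) _; rewrite mul0r add0r.
    apply: is_derive_eq (is_deriveD (is_derive_scale kd (dX x))
      (is_derive_scale (dc x) (dZ x))) _.
    by apply/rowP => j; rewrite !mxE; ring.
  rewrite -P1 -P2; apply/rowP => j; rewrite !mxE.
  transitivity ((cs t * cs t + k * (sn t * sn t)) * X t 0 j); last by ring.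
  by rewrite cs1 mul1r.
move=> t; have : Y t - (sn t *: X 0 + vs t *: Z 0) = Y 0.
  have := @is_derive0_constant _ (fun y => Y y - (sn y *: X 0 + vs y *: Z 0)).
  rewrite s0 v0 !scale0r addr0 subr0; apply=> x.
  apply: is_derive_eq (is_deriveB (dY x)
    (is_deriveD (is_derive_scale (ds x) (is_derive_cst (X 0) x 1))
       (is_derive_scale (dv x) (is_derive_cst (Z 0) x 1)))) _.
  by rewrite !scaler0 !addr0 -XE subrr.
by move/eqP; rewrite subr_eq addrA => /eqP.
Qed.

End oscillator.

(** A connected subset of [B] meeting [A] lies in [A], because its trace on [A] is relatively open
    and closed. *)
Lemma clopen_connected_component (T : topologicalType) (B A : set T) x :
  A x -> connected A -> relatively_open B A ->
  B `&` closure A `<=` A ->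
  A = connected_component B x.
Proof.
move=> Ax conA [U [oU AE]] cA; have AB : A `<=` B by rewrite AE.
apply/seteqP; split => [|z [C [Cx CB Cc] Cz]]; first exact: connected_component_max.
suff: C `&` A = C by move=> CA; have : C z by []; rewrite -CA => -[].
apply: Cc; first by exists x.
  exists U => //; apply/seteqP; split=> w [Cw]; first by rewrite AE => -[].
  by move=> Uw; split=> //; rewrite AE; split=> //; exact: CB.
exists (closure A); first exact: closed_closure.
apply/seteqP; split=> w [Cw Aw]; split=> //; first exact: subset_closure.
by apply: cA; split=> //; exact: CB.
Qed.

(** * Complete manifolds fill a connected component *)

Section completeness.
Variables (R : realType) (m s n p : nat).
Hypothesis m2 : (2 <= m)%N.
Variables (M : pseudoRiemannian R m s) (phi : M -> 'rV[R]_n.+1).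
Hypothesis hphi : isometric_immersion p phi.
Hypothesis humb : totally_umbilical p phi.

Local Notation N := (normal_at p phi).
Local Notation k x := (pform p.+1 (N x) (N x)).

(** The derivative is [2 <dY, dY> <dY, N>]. It vanishes because [dY] is orthogonal to [phi] and,
    [<C, phi>] being constant, also to [C]. *)
Lemma geodesic_tangent_norm (gamma : R -> M) (dY : R -> 'rV[R]_n.+1) :
  (forall t : R, is_derive t 1 (phi \o gamma) (dY t)) ->
  (forall t : R, is_derive t 1 dY (pform p.+1 (dY t) (dY t) *: N (gamma t))) ->
  forall t, pform p.+1 (dY t) (dY t) = pform p.+1 (dY 0) (dY 0).
Proof.
move=> Yd dYd.
have Y0 t : pform p.+1 (dY t) (phi (gamma t)) = 0.
  have [_ D] := is_derive_pform p.+1 (Yd t) (Yd t).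
  have : 'D_1 (fun t : R => pform p.+1 ((phi \o gamma) t) ((phi \o gamma) t)) t = 0.
    rewrite (_ : (fun t => _) = cst (-1)) ?derive_cst//.
    by apply/funext => z /=; exact: (phi_norm hphi).
  rewrite D [X in _ + X]pformC /=; move: (pform _ _ _) => a h; lra.
have C0 t : pform p.+1 (dY t) (N (gamma t)) = 0.
  pose C := N (gamma t) + k (gamma t) *: phi (gamma t).
  have [_ D] := is_derive_pform p.+1 (is_derive_cst C t 1) (Yd t).
  have : 'D_1 (fun t : R => pform p.+1 C ((phi \o gamma) t)) t = 0.
    rewrite (_ : (fun t => _) = cst (-1 - k (gamma t))) ?derive_cst//.
    apply/funext => z /=.
    have [kz Cz] := umbilical_constants m2 hphi humb (gamma t) (gamma z).
    rewrite /C Cz kz pformDl pformZl (normal_at_phi m2 hphi humb) (phi_norm hphi).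
    by rewrite mulrN1.
  by rewrite D pform0l add0r /C pformDl pformZl pformC => h; move: h; rewrite [X in _ * X]pformC Y0 mulr0 addr0.
have row1 (z : R) : is_derive z 1 (fun t => (pform p.+1 (dY t) (dY t))%:M : 'rV[R]_1) 0.
  apply/is_derive_mxP => i j; rewrite !ord1 mxE.
  rewrite (_ : (fun t => _) = (fun t => pform p.+1 (dY t) (dY t))); last first.
    by apply/funext => w; rewrite mxE eqxx mulr1n.
  apply: is_derive_eq (is_derive_pform p.+1 (dYd z) (dYd z)) _.
  by rewrite pformZl pformZr C0 pformC C0 mulr0 addr0.
by move=> t; have /(congr1 (fun X : 'rV[R]_1 => X 0 0)) := is_derive0_constant row1 t; rewrite !mxE !eqxx !mulr1n.
Qed.

Lemma geodesic_reach (x : M) y : geodesically_complete M ->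
  hull_quadric p phi y -> k x * (-1 - pform p.+1 y (phi x)) < 2 -> range phi y.
Proof.
move=> Mc By; have [i ix] := chart_cover x.
have [v [+ +]] := hull_quadric_decompose m2 hphi humb ix By.
move: (-1 - _) => a /= yE vq ka.
(* The target is [phi x + v + a N], to be reached at time 1. Starting with velocity [v / sn 1], the
   geodesic has [e * vs 1] as coefficient of [N]; for this to be [a] the value [cs 1] must be
   [1 - k a], which exceeds -1 exactly when [k a < 2]. *)
have [kk [cs [sn [vs [osc c1 s1]]]]] : exists kk cs sn vs,
    [/\ oscillator kk cs sn vs, cs 1 = 1 - k x * a & sn 1 != 0].
  by apply: oscillator_exists; move: ka; lra.
have [gamma [gg g0 gd]] := Mc i x ((sn 1)^-1 *: v) ix.
have [dY [Yd dYd]] := geodesic_curve m2 hphi humb gg.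
rewrite g0 => /(_ i ix); rewrite gd => dY0.
have eE := geodesic_tangent_norm Yd dYd.
set e := pform p.+1 (dY 0) (dY 0) in eE.
have e0 : e = (sn 1)^-1 ^+ 2 * (2 * a - k x * a ^+ 2).
  by rewrite /e dY0 -scalemxAl pformZl pformZr vq mulrA.
pose C := N x + k x *: phi x.
pose Z t := e *: (C - k x *: phi (gamma t)).
have NE t : N (gamma t) = C - k x *: phi (gamma t).
  have [kz Cz] := umbilical_constants m2 hphi humb x (gamma t).
  by rewrite /C Cz kz addrK.
have dYd' (t : R) : is_derive t 1 dY (Z t) by rewrite /Z -NE -(eE t).
(* The frequency chosen from the endpoint agrees with the one of the geodesic: the Pythagorean
   identity and the quadratic relation for [v] give the same multiple of [sn 1 ^+ 2]. *)
have kkE : kk = k x * e.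
  have := oscillator_pythagoras osc 1; rewrite c1 e0.
  move: (k x) (sn 1) s1 => c b b0 h.
  apply: (mulIf (mulf_neq0 b0 b0)).
  have -> : kk * (b * b) = 1 - (1 - c * a) * (1 - c * a) by rewrite -[X in _ = X - _]h; ring.
  by field.
have dZ (t : R) : is_derive t 1 Z (- kk *: dY t).
  apply: is_derive_eq (is_derive_scale (is_derive_cst e t 1)
    (is_deriveB (is_derive_cst C t 1)
      (is_derive_scale (is_derive_cst (k x) t 1) (Yd t)))) _.
  by rewrite !scale0r !add0r kkE; rewrite /cst; move: (dY t) => w; apply/rowP => j; rewrite !mxE; ring.
have := oscillator_solution osc Yd dYd' dZ 1; rewrite /= g0 dY0.
rewrite /Z g0 addrK -scalemxAl !scalerA divff// scale1r => YE.
exists (gamma 1) => //; rewrite YE yE; congr (_ + _ *: _).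
(* The half-angle identity yields [vs 1 * (2 - k a) = sn 1 * sn 1], hence [e * vs 1 = a] without
   dividing by [k] or [e]. *)
have := oscillator_half_angle osc 1; rewrite c1 e0.
have : 1 + (1 - k x * a) != 0 by rewrite lt0r_neq0//; move: ka; lra.
move: (k x) (sn 1) (vs 1) s1 => c b d b0 h0 h.
apply: (mulIf h0).
transitivity (d * (1 + (1 - c * a)) * (b^-1 ^+ 2 * (2 * a - c * a ^+ 2))); first by ring.
by rewrite h; field.
Qed.

Lemma range_connected_component (x : M) : geodesically_complete M ->
  range phi = connected_component (hull_quadric p phi) (phi x).
Proof.
move=> Mc; apply: clopen_connected_component.
- by exists x.
- apply: connected_continuous_connected; first exact: (@carrier_connected _ _ _ M).
  by apply: continuous_subspaceT; exact: (phi_continuous hphi).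
- exact: range_relatively_open.
move=> y [By cy]; have y1 := (phyp1 p y).1 By.1.
(* The left side is 0 at [z = y], so an image point close enough to the limit point [y] satisfies
   the condition of [geodesic_reach]. *)
have near_y : \forall z \near y, k x * (-1 - pform p.+1 z y) < 2.
  have c : (fun z => k x * (-1 - pform p.+1 z y)) @ y --> k x * (-1 - pform p.+1 y y).
    have c1 := @pform_continuous R p.+1 _ y y.
    exact: (cvgM (cvg_cst (k x)) (cvgB (cvg_cst (-1 : R)) c1)).
  by move/cvgr_lt : c => /(_ 2); apply; rewrite y1 subrr mulr0.
have [_ [[z _ <-] zk]] := cy _ near_y.
apply: (geodesic_reach (x := z)) => //; move: zk => /=.
by rewrite pformC (umbilical_constants m2 hphi humb x z).1.
Qed.

End completeness.

(** * Consequences of an isotropic orthogonal complement *)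

Section umbilical_frame.
Variables (R : realType) (q N m s : nat) (J : 'M[R]_(m, N)) (f h : 'rV[R]_N).
Local Notation E := (eta_mx R q N).
Hypothesis Gs : metric_of_index s (J *m E *m J^T).
Hypothesis Jf : J *m E *m f^T = 0.
Hypothesis Jh : J *m E *m h^T = 0.
Hypothesis ff : pform q f f = -1.
Hypothesis fh : pform q f h = 0.
Hypothesis isotropic : forall w : 'rV[R]_N, J *m E *m w^T = 0 ->
  pform q w f = 0 -> pform q w h = 0 -> pform q w w = 0.
Hypothesis mN : (m.+1 < N)%N.

Lemma isotropic_pform (w w' : 'rV[R]_N) :
  J *m E *m w^T = 0 -> pform q w f = 0 -> pform q w h = 0 ->
  J *m E *m w'^T = 0 -> pform q w' f = 0 -> pform q w' h = 0 -> pform q w w' = 0.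
Proof.
move=> w1 w2 w3 v1 v2 v3.
have := isotropic (w := w + w').
rewrite linearD/= mulmxDr w1 v1 addr0 !pformDl w2 v2 w3 v3 !addr0 => /(_ erefl erefl erefl).
rewrite !pformDr isotropic// (isotropic v1)// (pformC _ w' w).
by move: (pform _ _ _) => a; lra.
Qed.

(** Removing the tangential part and the part along [f] lets non-degeneracy be tested only on
    vectors orthogonal to both. *)
Lemma frame_proj (y : 'rV[R]_N) : exists y', [/\ J *m E *m y'^T = 0, pform q y' f = 0 &
  forall w : 'rV[R]_N, J *m E *m w^T = 0 -> pform q w f = 0 -> pform q w y' = pform q w y].
Proof.
have [Gsym Gu _ _] := Gs.
pose a := y *m E *m J^T *m invmx (J *m E *m J^T).
exists (y - a *m J + pform q y f *: f); split.
- apply: trmx_inj; rewrite !trmx_mul trmxK trmx_eta trmx0 !mulmxA !mulmxDl !mulNmx.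
  have -> : a *m J *m E *m J^T = y *m E *m J^T.
    by rewrite -[a *m J *m E]mulmxA -[a *m _ *m _]mulmxA /a mulmxKV.
  rewrite subrr add0r -!scalemxAl; have -> : f *m E *m J^T = 0; last exact: scaler0.
  by apply: trmx_inj; rewrite !trmx_mul trmxK trmx_eta trmx0 mulmxA.
- rewrite !(pformDl, pformNl, pformZl) (pform_mulmx _ Jf) ff; ring.
- move=> w Jw wf.
  rewrite !(pformDr, pformNr, pformZr) wf mulr0 addr0 (pformC _ w (a *m J)).
  by rewrite (pform_mulmx _ Jw) subr0.
Qed.

Lemma frame_dim k (T : 'M[R]_(k, N)) :
  (forall w : 'rV[R]_N, J *m E *m w^T = 0 -> T *m E *m w^T = 0 -> w = 0) -> (N <= m + k)%N.
Proof.
move=> w0; set W := col_mx J T.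
have : kermx (E *m W^T) = 0.
  apply/eqP/rowV0P => w /sub_kermxP wW; apply: w0.
    apply: trmx_inj; rewrite !trmx_mul trmxK trmx_eta trmx0.
    by move: wW; rewrite /W tr_col_mx mul_mx_row mul_mx_row -[0]row_mx0 => /eq_row_mx[].
  apply: trmx_inj; rewrite !trmx_mul trmxK trmx_eta trmx0.
  by move: wW; rewrite /W tr_col_mx mul_mx_row mul_mx_row -[0]row_mx0 => /eq_row_mx[].
move/(congr1 (fun X => \rank X)); rewrite rank_orthogonal mxrank0 => /eqP.
by rewrite subn_eq0 => /leq_trans; apply; rewrite rank_leq_row.
Qed.

(** For nonnull [h] any test vector can also be made orthogonal to [h]; isotropy then makes [w]
    orthogonal to everything. *)
Lemma nonnull_frame_trivial (w : 'rV[R]_N) : pform q h h != 0 ->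
  J *m E *m w^T = 0 -> pform q w f = 0 -> pform q w h = 0 -> w = 0.
Proof.
move=> h0 w1 w2 w3; apply: (@pform_nondegenerate _ q) => y.
have [y' [y1 y2 <- //]] := frame_proj y.
pose z := y' - (pform q y' h / pform q h h) *: h.
have <- : pform q w z = pform q w y' by rewrite pformDr pformNr pformZr w3 mulr0 subr0.
apply: isotropic_pform => //.
- by rewrite /z linearB/= linearZ/= mulmxBr -scalemxAr y1 Jh scaler0 subr0.
- by rewrite pformDl pformNl pformZl y2 (pformC _ h) fh mulr0 subr0.
- by rewrite pformDl pformNl pformZl divfK// subrr.
Qed.

Lemma nonnull_frame_dim : pform q h h != 0 -> N = m.+2.
Proof.
move=> h0; apply/eqP; rewrite eqn_leq mN andbT.
rewrite -addn2; apply: (@frame_dim (1 + 1) (col_mx f h)) => w Jw.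
rewrite !mul_col_mx -[0]col_mx0 => /eq_col_mx[fw hw].
by apply: nonnull_frame_trivial => //; rewrite pformC pformE ?fw ?hw mxE.
Qed.

(** If [h] were 0, the orthogonal of [J] and [f] would be isotropic, hence trivial, so [N] would be
    at most [m + 1]. This is what excludes the totally geodesic cases. *)
Lemma null_frame_neq0 : pform q h h = 0 -> h != 0.
Proof.
move=> hh; apply/eqP => h0; move: mN; rewrite ltnNge => /negP; apply.
rewrite -addn1; apply: (@frame_dim 1 f) => w Jw fw.
have wf : pform q w f = 0 by rewrite pformC pformE fw mxE.
apply: (@pform_nondegenerate _ q) => y; have [y' [y1 y2 <- //]] := frame_proj y.
by apply: isotropic_pform; rewrite ?h0 ?pform0r.
Qed.

(** The vector [z] completes [h] to a hyperbolic plane: any normal [w] with [<h, w> <> 0] is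
    rescaled, and a multiple of [h] cancels its norm. *)
Lemma null_frame_dual : pform q h h = 0 -> exists z : 'rV[R]_N,
  [/\ J *m E *m z^T = 0, pform q z f = 0, pform q z z = 0 & pform q h z = -1].
Proof.
move=> hh; have /eqP h0 := null_frame_neq0 hh.
have [w hw] : exists w, pform q h w != 0.
  apply: contra_notP h0 => hw; apply: (@pform_nondegenerate _ q) => w.
  by apply/eqP; apply: contra_notT hw => hw; exists w.
have hf : pform q h f = 0 by rewrite pformC.
have [w' [w1 w2 wE]] := frame_proj w; move: (wE h Jh hf) hw => <-.
move: w' w1 w2 {w wE} => w w1 w2 hw.
pose c := - (pform q h w)^-1.
exists (c *: w + (c ^+ 2 * pform q w w / 2) *: h); split.
- by rewrite linearD/= !linearZ/= mulmxDr -!scalemxAr w1 Jh !scaler0 addr0.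
- by rewrite pformDl !pformZl w2 hf !mulr0 addr0.
- rewrite !(pformDl, pformDr, pformZl, pformZr) hh (pformC _ w h) /c.
  by move: (pform q h w) (pform q w w) hw => a b a0; field.
- by rewrite pformDr !pformZr hh mulr0 addr0 /c mulNr mulVf.
Qed.

Lemma null_frame_trivial (z w : 'rV[R]_N) : pform q h h = 0 ->
  J *m E *m z^T = 0 -> pform q z f = 0 -> pform q z z = 0 -> pform q h z = -1 ->
  J *m E *m w^T = 0 -> pform q w f = 0 -> pform q w h = 0 -> pform q w z = 0 -> w = 0.
Proof.
move=> hh z1 z2 z3 z4 w1 w2 w3 w4; apply: (@pform_nondegenerate _ q) => y.
have [y' [y1 y2 <- //]] := frame_proj y.
pose u := y' + pform q y' h *: z.
have <- : pform q w u = pform q w y' by rewrite pformDr pformZr w4 mulr0 addr0.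
apply: isotropic_pform => //.
- by rewrite /u linearD/= linearZ/= mulmxDr -scalemxAr y1 z1 scaler0 addr0.
- by rewrite pformDl pformZl y2 z2 mulr0 addr0.
- by rewrite pformDl pformZl (pformC _ z) z4 mulrN1 subrr.
Qed.

Lemma null_frame_dim : pform q h h = 0 -> (N <= m.+3)%N.
Proof.
move=> hh; have [z [z1 z2 z3 z4]] := null_frame_dual hh.
rewrite -addn3; apply: (@frame_dim (1 + (1 + 1)) (col_mx f (col_mx h z))) => w Jw.
rewrite !mul_col_mx -[0]col_mx0 => /eq_col_mx[fw]; rewrite -[0]col_mx0 => /eq_col_mx[hw zw].
by apply: (null_frame_trivial hh z1) => //; rewrite pformC pformE ?fw ?hw ?zw mxE.
Qed.

Lemma pform_row1 (v : 'rV[R]_1) (y : 'rV[R]_N) :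
  pform q (v *m y) (v *m y) = v 0 0 ^+ 2 * pform q y y.
Proof. by rewrite (mx11_scalar v) mul_scalar_mx pformZl pformZr mulrA -expr2 !mxE eqxx mulr1n. Qed.

Lemma rV1_sqr_gt0 (v : 'rV[R]_1) : v != 0 -> 0 < v 0 0 ^+ 2.
Proof.
move=> v0; rewrite lt_def sqr_ge0 andbT sqrf_eq0; apply: contra v0 => /eqP v0.
by rewrite (mx11_scalar v) v0 raddf0.
Qed.

Lemma index_lower_bound1 : (s < q)%N.
Proof.
have := index_lower_bound Gs Jf; rewrite addn1; apply=> v /rV1_sqr_gt0 v0.
by rewrite pform_row1 ff mulrN1 oppr_lt0.
Qed.

Lemma index_lower_bound2 (y : 'rV[R]_N) : J *m E *m y^T = 0 -> pform q f y = 0 ->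
  pform q y y < 0 -> (s.+2 <= q)%N.
Proof.
move=> Jy fy y0; have J2 : J *m E *m (col_mx f y)^T = 0.
  by rewrite tr_col_mx mul_mx_row Jf Jy row_mx0.
have := index_lower_bound Gs J2; rewrite addn2; apply=> v v0.
rewrite -[v]hsubmxK mul_row_col; set a := lsubmx v; set b := rsubmx v.
have ab : pform q (a *m f) (b *m y) = 0.
  by rewrite (mx11_scalar a) (mx11_scalar b) !mul_scalar_mx pformZl pformZr fy !mulr0.
rewrite pformDl !pformDr ab (pformC _ (b *m y)) ab addr0 add0r !pform_row1 ff.
have [a0|/rV1_sqr_gt0 a0] := eqVneq a 0.
  have /rV1_sqr_gt0 b0 : b != 0.
    by apply: contra v0 => /eqP b0; rewrite -[v]hsubmxK -/a -/b a0 b0 row_mx0.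
  by move: a0 b0 => -> b0; rewrite mxE; nra.
by have := sqr_ge0 (b 0 0); nra.
Qed.

Lemma index_upper_bound1 (y : 'rV[R]_N) : J *m E *m y^T = 0 -> 0 < pform q y y ->
  (m.+1 <= s + (N - q))%N.
Proof.
move=> Jy y0; have := index_upper_bound Gs Jy; rewrite addn1; apply=> v /rV1_sqr_gt0 v0.
by rewrite pform_row1 mulr_gt0.
Qed.

Lemma index_upper_bound0 : (m <= s + (N - q))%N.
Proof.
have J0 : J *m E *m (0 : 'M[R]_(0, N))^T = 0 by rewrite trmx0 mulmx0.
have := index_upper_bound Gs J0; rewrite addn0; apply=> v.
by rewrite thinmx0 eqxx.
Qed.

End umbilical_frame.

Lemma homeomorphic_connected_component (T U : topologicalType) (F : T -> U) (G : U -> T) B x :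
  continuous F -> continuous G -> cancel F G -> cancel G F -> B x ->
  F @` connected_component B x = connected_component (F @` B) (F x).
Proof.
move=> Fc Gc FK GK Bx; apply/seteqP; split=> [_ [z [C [Cx CB Cc] Cz] <-]|y [C [Cx CB Cc] Cy]].
  exists (F @` C); last by exists z.
  split; [by exists x|exact: image_subset|].
  by apply: connected_continuous_connected => //; exact: continuous_subspaceT.
exists (G y); last exact: GK.
exists (G @` C); last by exists y.
split; first by exists (F x).
  by move=> _ [z /CB [w Bw <-] <-]; rewrite FK.
by apply: connected_continuous_connected => //; exact: continuous_subspaceT.
Qed.

Lemma homeomorphic_relatively_open (T U : topologicalType) (F : T -> U) (G : U -> T) B A :
  continuous G -> cancel F G -> cancel G F ->
  relatively_open B A -> relatively_open (F @` B) (F @` A).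
Proof.
move=> Gc FK GK [V [oV ->]]; exists (G @^-1` V); split.
  by apply: open_comp => // y _; exact: Gc.
apply/seteqP; split=> [_ [z [Bz Vz] <-]|_ [[z Bz <-]] /=]; first by split; [exists z|rewrite /= FK].
by rewrite FK => Vz; exists z.
Qed.

(** * Slices of the pseudo-hyperbolic space and their linear images *)

Section linear_isometries.
Variables (R : realType) (n p : nat).
Local Notation E := (eta_mx R p.+1 n.+1).

(** Two equations serve the case of codimension two; the hypersurface cases repeat a single
    equation. *)
Definition quadric_slice (a b : 'rV[R]_n.+1) (c d : R) : set 'rV[R]_n.+1 :=
  [set y | phyp p 1 y /\ pform p.+1 a y = c /\ pform p.+1 b y = d].

Lemma linear_local_isometry (A : 'M[R]_n.+1) : isometry_mx p.+1 A ->
  local_isometry p (mulmxr A : 'rV[R]_n.+1 -> 'rV[R]_n.+1).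
Proof.
move=> AE x; rewrite !phyp1 /= isometry_mxP// => x1; split=> //.
exists setT, (mulmxr A : 'rV[R]_n.+1 -> 'rV[R]_n.+1); split=> //.
- by split=> //; exact: openT.
- exact: smooth_linear.
- move=> v w _ _.
  have D v' : 'D_v' (mulmxr A : 'rV[R]_n.+1 -> 'rV[R]_n.+1) x = v' *m A.
    by have [_ ->] := linear_rV_derive (mulmxr A) x v'.
  by rewrite !D isometry_mxP.
Qed.

Lemma linear_ambient_isometry (A : 'M[R]_n.+1) : isometry_mx p.+1 A ->
  ambient_isometry p (mulmxr A : 'rV[R]_n.+1 -> 'rV[R]_n.+1).
Proof.
move=> AE; split; first exact: linear_local_isometry.
exists (mulmxr (invmx A)); split; first exact/linear_local_isometry/isometry_mxV.
- by move=> y _ /=; rewrite mulmxK// (isometry_mx_unit AE).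
- by move=> y _ /=; rewrite mulmxKV// (isometry_mx_unit AE).
Qed.

Lemma isometry_quadric_slice (A : 'M[R]_n.+1) a b c d : isometry_mx p.+1 A ->
  (mulmxr A : 'rV[R]_n.+1 -> 'rV[R]_n.+1) @` quadric_slice a b c d =
  quadric_slice (a *m A) (b *m A) c d.
Proof.
move=> AE; have Au := isometry_mx_unit AE.
apply/seteqP; split=> [_ [z [z1 [za zb]] <-]|y [y1 [ya yb]]] /=.
  by split; [rewrite phyp1 isometry_mxP//; exact/phyp1|rewrite !isometry_mxP].
exists (y *m invmx A); last by rewrite /= mulmxKV.
have yE : y = y *m invmx A *m A by rewrite mulmxKV.
move: (y *m invmx A) yE => z yE; rewrite {}yE !isometry_mxP// in y1 ya yb *.
by split=> //; apply/phyp1; rewrite -(isometry_mxP AE); exact/phyp1.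
Qed.

End linear_isometries.
Arguments quadric_slice {R n} p a b c d.

(** * Full umbilical immersions seen from one point *)

Section full_umbilical.
Variables (R : realType) (m s n p : nat).
Hypothesis m2 : (2 <= m)%N.
Hypothesis mn : (m < n)%N.
Variables (M : pseudoRiemannian R m s) (phi : M -> 'rV[R]_n.+1).
Hypothesis hphi : isometric_immersion p phi.
Hypothesis humb : totally_umbilical p phi.
Hypothesis hfull : full p phi.

Local Notation E := (eta_mx R p.+1 n.+1).
Local Notation pf i := (phi \o @param _ _ _ M i).
Local Notation crd i x := (@chart_coord _ _ _ M i x).
Local Notation J i := (tangent_mx (pf i)).
Local Notation N := (normal_at p phi).

(** The empty set is vacuously a totally geodesic hypersurface, and it would contain an empty
    image. *)
Lemma full_inhabited : inhabited M.
Proof.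
apply: contra_notP hfull => noM; exists set0; split; first by split.
by move=> y [x]; case: noM; exact: inhabits.
Qed.

Definition mean_at x := N x - phi x.

Lemma mean_at_position x : pform p.+1 (phi x) (mean_at x) = 0.
Proof.
rewrite pformDr pformNr (pformC _ (phi x)) (normal_at_phi m2 hphi humb) (phi_norm hphi).
by rewrite subrr.
Qed.

Lemma mean_at_norm x : pform p.+1 (mean_at x) (mean_at x) = pform p.+1 (N x) (N x) + 1.
Proof.
rewrite {1}/mean_at pformDl pformNl mean_at_position subr0 pformDr pformNr.
by rewrite (normal_at_phi m2 hphi humb) opprK.
Qed.

Lemma position_tangent (i : chart M) x : cdom i x -> J i (crd i x) *m E *m (phi x)^T = 0.
Proof.
move=> ix; apply: trmx_inj; rewrite !trmx_mul trmxK trmx_eta trmx0 mulmxA.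
rewrite -(phi_coord phi ix).
apply: (patch_position_normal (@patch_open R m s M i) (patch_smooth hphi i)
    (patch_norm hphi (i := i))).
by exists x.
Qed.

Lemma mean_at_tangent (i : chart M) x : cdom i x ->
  J i (crd i x) *m E *m (mean_at x)^T = 0.
Proof.
move=> ix; rewrite linearB/= mulmxBr (normal_at_tangent m2 hphi humb ix).
by rewrite position_tangent// subrr.
Qed.

Lemma mean_curvature_norm (i : chart M) x y : cdom i x ->
  pform p.+1 (mean_curvature p phi i x) (mean_curvature p phi i x) =
  pform p.+1 (mean_at y) (mean_at y).
Proof.
move=> ix; rewrite (normal_at_mean_curvature m2 hphi humb ix) !mean_at_norm.
by rewrite (umbilical_constants m2 hphi humb x y).1.
Qed.

(** Here [k = -1], so the constant vector [N + k phi] is the mean curvature vector itself. *)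
Lemma mean_curvature_null (i : chart M) x y : cdom i x ->
  pform p.+1 (mean_at y) (mean_at y) = 0 -> mean_curvature p phi i x = mean_at y.
Proof.
move=> ix; rewrite (normal_at_mean_curvature m2 hphi humb ix) mean_at_norm => ky.
have [kx] := umbilical_constants m2 hphi humb x y; rewrite kx.
have -> : pform p.+1 (N y) (N y) = -1 by move: ky; lra.
by rewrite !scaleN1r.
Qed.

Lemma full_isotropic (i : chart M) x (w : 'rV[R]_n.+1) : cdom i x ->
  J i (crd i x) *m E *m w^T = 0 -> pform p.+1 w (phi x) = 0 ->
  pform p.+1 w (mean_at x) = 0 -> pform p.+1 w w = 0.
Proof.
move=> ix w1 w2 w3; apply: (full_not_in_hyperplane _ _ hfull).
- exact: leq_ltn_trans mn.
- by case: hphi.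
move=> y; rewrite (umbilical_affine_hull m2 hphi humb ix w1)//.
by move: w3; rewrite pformDr pformNr w2 subr0.
Qed.

Lemma tangent_gram_index (i : chart M) x : cdom i x ->
  metric_of_index s (J i (crd i x) *m E *m (J i (crd i x))^T).
Proof.
move=> ix; have iu : cimage i (crd i x) by exists x.
by rewrite -induced_gramE (patch_gram hphi iu); exact: gram_index.
Qed.

(** The vectors of constant height on the image are exactly those orthogonal to the tangent space
    and to [N] at one point. *)
Lemma hull_quadricP (i : chart M) x y : cdom i x ->
  hull_quadric p phi y <-> phyp p 1 y /\ forall w : 'rV[R]_n.+1,
    J i (crd i x) *m E *m w^T = 0 -> pform p.+1 w (N x) = 0 ->
    pform p.+1 w y = pform p.+1 w (phi x).
Proof.
move=> ix; split=> -[y1 yw]; split=> // w.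
  move=> w1 w2; apply: yw => z z'.
  by rewrite !(umbilical_affine_hull m2 hphi humb ix w1 w2).
move=> wc z; rewrite (wc z x).
have iu : cimage i (crd i x) by exists x.
have [|w1 w2] := @constant_height_orthogonal _ _ _ _ _ m2 _ _ hphi humb i (crd i x) w (pform p.+1 w (phi x)) iu.
  by apply: (@filterE _ (nbhs (crd i x))) => v; exact: wc.
by apply: yw => //; rewrite -(normal_atE m2 hphi humb ix).
Qed.

End full_umbilical.

(** * Codimension, index and equations of the quadric *)

Section hull_of_full_umbilical.
Variables (R : realType) (m s n p : nat).
Hypothesis m2 : (2 <= m)%N.
Hypothesis mn : (m < n)%N.
Hypothesis pn : (p <= n)%N.
Variables (M : pseudoRiemannian R m s) (phi : M -> 'rV[R]_n.+1).
Hypothesis hphi : isometric_immersion p phi.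
Hypothesis humb : totally_umbilical p phi.
Hypothesis hfull : full p phi.

Local Notation E := (eta_mx R p.+1 n.+1).
Local Notation pf i := (phi \o @param _ _ _ M i).
Local Notation crd i x := (@chart_coord _ _ _ M i x).
Local Notation J i := (tangent_mx (pf i)).
Local Notation N := (normal_at p phi).
Local Notation H := (mean_at p phi).
Local Notation kappa x := (pform p.+1 (H x) (H x)).

Lemma normal_at_meanE x : N x = H x + phi x.
Proof. by rewrite /mean_at subrK. Qed.

Lemma index_le_dim (x : M) : (s <= m)%N.
Proof.
have [i ix] := chart_cover x; have [_ _ [W Ws _] _] := tangent_gram_index hphi ix.
by have := rank_leq_row W; rewrite Ws.
Qed.

Lemma nonnull_codim x : kappa x != 0 -> n = m.+1.
Proof.
move=> k0; have [i ix] := chart_cover x; apply: succn_inj.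
apply: (nonnull_frame_dim (tangent_gram_index hphi ix) (position_tangent hphi ix)
  (mean_at_tangent m2 hphi humb ix) (phi_norm hphi x) (mean_at_position m2 hphi humb x)) => //.
by move=> w; exact: full_isotropic.
Qed.

Lemma positive_index x : 0 < kappa x -> p = s.
Proof.
move=> k0; have [i ix] := chart_cover x.
have n1 := nonnull_codim (lt0r_neq0 k0).
have := index_lower_bound1 (tangent_gram_index hphi ix) (position_tangent hphi ix) (phi_norm hphi x).
have := index_upper_bound1 (tangent_gram_index hphi ix) (mean_at_tangent m2 hphi humb ix) k0.
by move: pn; rewrite n1; lia.
Qed.

Lemma negative_index x : kappa x < 0 -> p = s.+1.
Proof.
move=> k0; have [i ix] := chart_cover x.
have n1 := nonnull_codim (ltr0_neq0 k0).
have := index_lower_bound2 (tangent_gram_index hphi ix) (position_tangent hphi ix)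
  (phi_norm hphi x) (mean_at_tangent m2 hphi humb ix) (mean_at_position m2 hphi humb x) k0.
have := index_upper_bound0 (tangent_gram_index hphi ix).
by move: pn; rewrite n1; lia.
Qed.

(** Vectors orthogonal to the tangent space and to [N] are multiples of [C]: after subtracting the
    multiple with the same height at [x], the rest is orthogonal to the tangent space, [phi x] and
    [H x]. One equation therefore describes the quadric. *)
Lemma nonnull_hull x : kappa x != 0 -> let C := H x + kappa x *: phi x in
  hull_quadric p phi = quadric_slice p C C (- kappa x) (- kappa x).
Proof.
move=> k0 C; have [i ix] := chart_cover x.
have JH := mean_at_tangent m2 hphi humb ix; have Jphi := position_tangent hphi ix.
have HP := mean_at_position m2 hphi humb x; have PP := phi_norm hphi x.
have CP : pform p.+1 C (phi x) = - kappa x.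
  by rewrite pformDl pformZl PP (pformC _ (H x)) HP add0r mulrN1.
have CN : pform p.+1 C (N x) = 0.
  rewrite normal_at_meanE pformDr CP pformDl pformZl HP mulr0 addr0; exact: subrr.
have JC : J i (crd i x) *m E *m C^T = 0.
  by rewrite linearD/= linearZ/= mulmxDr -scalemxAr JH Jphi scaler0 addr0.
apply/seteqP; split=> [y /(hull_quadricP m2 hphi humb y ix)[y1 yw]|y [y1 [yC _]]].
  by split=> //; rewrite yw.
apply/(hull_quadricP m2 hphi humb y ix); split=> // w Jw wN.
have wE : w = (- pform p.+1 w (phi x) / kappa x) *: C.
  apply/eqP; rewrite -subr_eq0; apply/eqP.
  set a := _ / _.
  have uP : pform p.+1 (w - a *: C) (phi x) = 0.
    by rewrite pformDl pformNl pformZl CP /a mulrN divfK// opprK subrr.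
  have uH : pform p.+1 (w - a *: C) (H x) = 0.
    rewrite -[LHS]addr0 -uP -pformDr -normal_at_meanE pformDl pformNl pformZl.
    by rewrite wN CN mulr0 subrr.
  apply: (nonnull_frame_trivial (tangent_gram_index hphi ix) Jphi JH PP HP) => //.
    by move=> w'; exact: full_isotropic.
  by rewrite linearB/= linearZ/= mulmxBr -scalemxAr Jw JC scaler0 subr0.
by rewrite wE !pformZl yC CP.
Qed.

Lemma mean_at_neq0 x : kappa x = 0 -> H x != 0.
Proof.
move=> k0; have [i ix] := chart_cover x.
have iso w := full_isotropic m2 mn hphi humb hfull (w := w) ix.
exact: (null_frame_neq0 (tangent_gram_index hphi ix) (position_tangent hphi ix)
  (phi_norm hphi x) iso mn k0).
Qed.

(** With [z] the null partner of [H x], the constant-height vectors are spanned by [H x] and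
    [D = z - phi x]. The slice uses [D] and [H x - D] because these are orthogonal of norms -1 and
    1, fit for reflections. *)
Lemma null_hull x : kappa x = 0 -> [/\ n = m.+2, p = s.+1 &
  exists D, [/\ pform p.+1 D D = -1, pform p.+1 (H x) D = -1 &
    hull_quadric p phi = quadric_slice p D (H x - D) 1 (-1)]].
Proof.
move=> k0; have [i ix] := chart_cover x.
have JH := mean_at_tangent m2 hphi humb ix; have Jphi := position_tangent hphi ix.
have HP := mean_at_position m2 hphi humb x; have PP := phi_norm hphi x.
have gr := tangent_gram_index hphi ix.
have iso w := full_isotropic m2 mn hphi humb hfull (w := w) ix.
have [z [z1 z2 z3 z4]] := null_frame_dual gr Jphi JH PP HP iso mn k0.
have n3 := null_frame_dim gr Jphi JH PP HP iso mn k0.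
have comb (a : R) : J i (crd i x) *m E *m (z + a *: H x)^T = 0.
  by rewrite linearD/= linearZ/= mulmxDr -scalemxAr z1 JH scaler0 addr0.
have combn (a : R) : pform p.+1 (z + a *: H x) (z + a *: H x) = - (2 * a).
  move: (H x) k0 z4 => h hh hz.
  by rewrite !(pformDl, pformDr, pformZl, pformZr) z3 hh (pformC _ z) hz; ring.
have np : n = m.+2 /\ p = s.+1.
  (* The hyperbolic plane of [z] and [H x] supplies one negative direction, [z + H x], and one
     positive, [z - H x]; the two bounds pin down [n] and [p]. *)
  have i1 : (s.+2 <= p.+1)%N.
    apply: (index_lower_bound2 gr Jphi PP (comb 1)).
      by rewrite pformDr pformZr HP (pformC _ _ z) z2 mulr0 addr0.
    by rewrite combn mulr1 oppr_lt0.
  have i2 : (m.+1 <= s + (n.+1 - p.+1))%N.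
    by apply: (index_upper_bound1 gr (comb (-1))); rewrite combn mulrN1 opprK.
  by move: i1 i2 n3 pn; lia.
split; [exact: np.1|exact: np.2|].
have HD : pform p.+1 (H x) (z - phi x) = -1.
  by rewrite pformDr pformNr z4 (pformC _ (H x)) HP subr0.
have DD : pform p.+1 (z - phi x) (z - phi x) = -1.
  by rewrite !(pformDl, pformDr, pformNl, pformNr) z3 z2 (pformC _ (phi x) z) z2 PP; ring.
exists (z - phi x); split=> //.
have JD : J i (crd i x) *m E *m (z - phi x)^T = 0.
  by rewrite linearB/= mulmxBr z1 Jphi subrr.
have DP : pform p.+1 (z - phi x) (phi x) = 1.
  by rewrite pformDl pformNl z2 PP add0r opprK.
have DN : pform p.+1 (z - phi x) (N x) = 0.
  by rewrite normal_at_meanE pformDr DP (pformC _ _ (H x)) HD addrC subrr.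
have HN : pform p.+1 (H x) (N x) = 0.
  by rewrite normal_at_meanE pformDr k0 (pformC _ (H x)) HP addr0.
apply/seteqP; split=> [y /(hull_quadricP m2 hphi humb y ix)[y1 yw]|y [y1 [yD yH]]].
  split=> //; split; first by rewrite yw.
  by rewrite pformDl pformNl !yw// (pformC _ (H x)) HP DP sub0r.
have {}yH : pform p.+1 (H x) y = 0.
  by move: yH; rewrite pformDl [X in _ + X]pformNl yD => h; move: h; lra.
apply/(hull_quadricP m2 hphi humb y ix); split=> // w Jw wN.
pose b := pform p.+1 w (phi x); pose a := - pform p.+1 w z.
have wE : w = a *: H x + b *: (z - phi x).
  apply/eqP; rewrite -subr_eq0; apply/eqP; set u := _ - _.
  have uP : pform p.+1 u (phi x) = 0.
    rewrite /u pformDl pformNl pformDl !pformZl (pformC _ (H x)) HP DP.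
    by rewrite mulr0 add0r mulr1 subrr.
  have uN : pform p.+1 u (N x) = 0.
    by rewrite /u pformDl pformNl pformDl !pformZl wN HN DN !mulr0 addr0 subrr.
  have uH : pform p.+1 u (H x) = 0.
    by move: uN; rewrite normal_at_meanE pformDr uP addr0.
  have uz : pform p.+1 u z = 0.
    rewrite /u pformDl pformNl pformDl !pformZl z4 pformDl pformNl z3 (pformC _ (phi x)) z2.
    by rewrite subrr mulr0 addr0 /a mulrN1 opprK subrr.
  apply: (null_frame_trivial gr Jphi PP iso k0 z1) => //.
  rewrite /u; move: (H x) (z - phi x) JH JD => h d Jh Jd.
  have -> : (w - (a *: h + b *: d))^T = w^T - (a *: h^T + b *: d^T).
    by rewrite linearB/= linearD/= !linearZ.
  by rewrite mulmxBr mulmxDr -!scalemxAr Jw Jh Jd !scaler0 addr0 subr0.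
rewrite -/b wE pformDl !pformZl yH yD; ring.
Qed.

End hull_of_full_umbilical.

(** * The models as slices *)

Section model_slices.
Variable R : realType.

Lemma pform_prepend q N a b (x y : 'rV[R]_N) :
  pform q.+1 (prepend a x) (prepend b y) = - (a * b) + pform q x y.
Proof.
rewrite /pform big_ord_recl !mxE unlift_none/= expr1 mulN1r mulNr; congr (_ + _).
by apply: eq_bigr => i _; rewrite !mxE liftK.
Qed.

Lemma pform_append q N a b (x y : 'rV[R]_N) : (q <= N)%N ->
  pform q (append x a) (append y b) = pform q x y + a * b.
Proof.
move=> qN; rewrite /pform big_ord_recr/= !mxE unlift_none/= ltnNge qN/= mul1r.
congr (_ + _); apply: eq_bigr => i _.
have -> : widen_ord (leqnSn N) i = lift ord_max i by apply: ord_inj; rewrite lift_max.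
by rewrite !mxE liftK.
Qed.

Lemma prependP N (y : 'rV[R]_N.+1) : exists a x, y = prepend a x.
Proof.
exists (y 0 0), (\row_i y 0 (lift ord0 i)); apply/rowP => i.
by rewrite mxE; case: unliftP => [j ->|->]/=; rewrite ?mxE.
Qed.

Lemma appendP N (y : 'rV[R]_N.+1) : exists x a, y = append x a.
Proof.
exists (\row_i y 0 (lift ord_max i)), (y 0 ord_max); apply/rowP => i.
by rewrite mxE; case: unliftP => [j ->|->]/=; rewrite ?mxE.
Qed.

Lemma hyp_incl_id q n (x : 'rV[R]_n.+1) : hyp_incl q n x = x.
Proof.
apply/rowP => i; rewrite mxE subnn addn0 subn0 inord_val.
by case: leqP.
Qed.

(** Scaling the vector and the level by a common [g] keeps the slice; [g] is reserved for matching
    the norm of [C]. *)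
Lemma model3_slice m s (r g : R) : r ^+ 2 <= 1 -> g != 0 ->
  let c := Num.sqrt (1 - r ^+ 2) in
  model3 m s m.+1 r = quadric_slice s.+1 (prepend g 0) (prepend g 0) (- (g * c)) (- (g * c)).
Proof.
move=> r1 g0 c; have cc : c * c = 1 - r ^+ 2 by rewrite -expr2 sqr_sqrtr// subr_ge0.
apply/seteqP; split=> [_ [x xr <-]|y [+ [+ _]]].
  rewrite hyp_incl_id -/c; split.
    by apply/phyp1; rewrite pform_prepend cc xr; ring.
  by rewrite pform_prepend pform0l addr0.
have [a [x ->]] := prependP y; rewrite phyp1 !pform_prepend pform0l addr0 => n1.
move=> /oppr_inj/(mulfI g0) ac; rewrite ac cc in n1 *.
exists x; last by rewrite hyp_incl_id.
by rewrite /phyp/=; move: n1; move: (pform _ _ _) (r ^+ 2) => u v; lra.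
Qed.

Lemma model6_slice m s (r g : R) : g != 0 ->
  let c := Num.sqrt (1 + r ^+ 2) in
  model6 m s m.+1 r = quadric_slice s (prepend g 0) (prepend g 0) (- (g * c)) (- (g * c)).
Proof.
move=> g0 c; have cc : c * c = 1 + r ^+ 2.
  by rewrite -expr2 sqr_sqrtr// addr_ge0// sqr_ge0.
apply/seteqP; split=> [_ [x xr <-]|y [+ [+ _]]].
  rewrite hyp_incl_id -/c; split.
    by apply/phyp1; rewrite pform_prepend cc xr; ring.
  by rewrite pform_prepend pform0l addr0.
have [a [x ->]] := prependP y; rewrite phyp1 !pform_prepend pform0l addr0 => n1.
move=> /oppr_inj/(mulfI g0) ac; rewrite ac cc in n1 *.
exists x; last by rewrite hyp_incl_id.
by rewrite /psphere/=; move: n1; move: (pform _ _ _) (r ^+ 2) => u v; lra.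
Qed.

Lemma model4_slice m s (r g : R) : (s <= m)%N -> 1 <= r ^+ 2 -> g != 0 ->
  let c := Num.sqrt (r ^+ 2 - 1) in
  model4 m s m.+1 r = quadric_slice s (append 0 g) (append 0 g) (g * c) (g * c).
Proof.
move=> sm r1 g0 c; have cc : c * c = r ^+ 2 - 1 by rewrite -expr2 sqr_sqrtr// subr_ge0.
apply/seteqP; split=> [_ [x xr <-]|y [+ [+ _]]].
  rewrite hyp_incl_id -/c; split.
    by apply/phyp1; rewrite pform_append// cc xr; ring.
  by rewrite pform_append// pform0l add0r.
have [x [a ->]] := appendP y; rewrite phyp1 !pform_append// pform0l add0r => n1.
move=> /(mulfI g0) ac; rewrite ac cc in n1 *.
exists x; last by rewrite hyp_incl_id.
by rewrite /phyp/=; move: n1; move: (pform _ _ _) (r ^+ 2) => u v; lra.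
Qed.

Lemma model5_slice m s : (s <= m)%N ->
  model5 m s m.+2 =
  quadric_slice s.+1 (prepend (-1) (append 0 0)) (prepend 0 (append 0 (-1))) 1 (-1 : R).
Proof.
move=> sm; apply/seteqP; split=> [_ [x xr <-]|y [+ [+ +]]].
  rewrite hyp_incl_id; split.
    by apply/phyp1; rewrite pform_prepend pform_append// xr; ring.
  by rewrite !pform_prepend !pform_append// !pform0l; split; ring.
have [a [y' ->]] := prependP y; have [x [b ->]] := appendP y'.
rewrite phyp1 !pform_prepend !pform_append// !pform0l => n1 ha hb.
have a1 : a = 1 by move: ha; lra.
have b1 : b = 1 by move: hb; lra.
rewrite a1 b1 in n1 *; exists x; last by rewrite hyp_incl_id.
by rewrite /phyp/=; move: n1; move: (pform _ _ _) => u; rewrite expr1n; lra.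
Qed.

(** The null vector [(2, 0, 2)] fixes the difference of the extreme coordinates to be 1/2, which
    makes the norm equation linear in the first one. *)
Lemma model7_slice m s : (s <= m)%N ->
  model7 m s m.+1 =
  quadric_slice s (prepend 2 (append 0 2)) (prepend 2 (append 0 2)) (-1) (-1 : R).
Proof.
move=> sm; apply/seteqP; split=> [_ [x _ <-]|y [+ [+ _]]].
  rewrite hyp_incl_id; split.
    by apply/phyp1; rewrite pform_prepend pform_append//; field.
  by rewrite !pform_prepend !pform_append// !pform0l; split; field.
have [a [y' ->]] := prependP y; have [x [b ->]] := appendP y'.
rewrite phyp1 !pform_prepend !pform_append// !pform0l => n1 hab.
have bE : b = a - 2^-1 by move: hab; lra.
have aE : a = pform s x x + 5 / 4.
  by move: n1; rewrite bE; move: (pform _ _ _) => u; nra.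
exists x => //; rewrite hyp_incl_id bE aE; congr (prepend _ (append _ _)).
by field.
Qed.

End model_slices.

(** * Transport of the image onto a model *)

Section classification.
Variables (R : realType) (m s n p : nat).
Hypothesis m2 : (2 <= m)%N.
Variables (M : pseudoRiemannian R m s) (phi : M -> 'rV[R]_n.+1).
Hypothesis hphi : isometric_immersion p phi.
Hypothesis humb : totally_umbilical p phi.

Local Notation H := (mean_at p phi).
Local Notation kappa x := (pform p.+1 (H x) (H x)).

Lemma mean_curvature_satisfies_norm x (P : R -> Prop) : P (kappa x) ->
  mean_curvature_satisfies p phi (fun h => P (pform p.+1 h h)).
Proof. by move=> Px i y iy; rewrite (mean_curvature_norm m2 hphi humb x iy). Qed.

Lemma realizes_slice (A : 'M[R]_n.+1) a b c d B (x : M) : isometry_mx p.+1 A ->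
  hull_quadric p phi = quadric_slice p a b c d ->
  quadric_slice p (a *m A) (b *m A) c d = B ->
  realizes M ((mulmxr A : 'rV[R]_n.+1 -> 'rV[R]_n.+1) @` range phi) B.
Proof.
move=> AE hE <-; rewrite -isometry_quadric_slice// -hE.
have Au := isometry_mx_unit AE.
have Fc D : continuous (mulmxr D : 'rV[R]_n.+1 -> 'rV[R]_n.+1).
  exact: linear_rV_continuous.
have FK : cancel (mulmxr A : 'rV[R]_n.+1 -> 'rV[R]_n.+1) (mulmxr (invmx A)).
  by move=> y /=; rewrite mulmxK.
have GK : cancel (mulmxr (invmx A)) (mulmxr A : 'rV[R]_n.+1 -> 'rV[R]_n.+1).
  by move=> y /=; rewrite mulmxKV.
split.
  apply: homeomorphic_relatively_open (Fc _) FK GK _.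
  exact: range_relatively_open.
have Bx : hull_quadric p phi (phi x) by apply: (range_hull_quadric hphi); exists x.
move=> Mc; exists (mulmxr A (phi x)); first by exists (phi x).
rewrite (range_connected_component m2 hphi humb x Mc).
exact: homeomorphic_connected_component (Fc _) (Fc _) FK GK Bx.
Qed.

(** The prescribed norm of [g] is that of [C], nonzero under these hypotheses, so reflections carry
    [C] to [g]. *)
Lemma nonnull_realizes x g B : (m < n)%N -> full p phi -> kappa x != 0 -> kappa x != 1 ->
  pform p.+1 g g = kappa x * (1 - kappa x) ->
  quadric_slice p g g (- kappa x) (- kappa x) = B ->
  exists2 A : 'M[R]_n.+1, isometry_mx p.+1 A &
    realizes M ((mulmxr A : 'rV[R]_n.+1 -> 'rV[R]_n.+1) @` range phi) B.
Proof.
move=> mn hfull k0 k1 gg <-.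
pose C := H x + kappa x *: phi x.
have CC : pform p.+1 C C = pform p.+1 g g.
  have HP := mean_at_position m2 hphi humb x; have PP := phi_norm hphi x.
  rewrite /C gg; move: (H x) HP => h HP.
  rewrite !(pformDl, pformDr, pformZl, pformZr) PP (pformC _ h (phi x)) HP; ring.
have g0 : pform p.+1 g g != 0 by rewrite gg mulf_neq0// subr_eq0 eq_sym.
have [A [AE CA _]] := isometry_move CC g0.
exists A => //; apply: (realizes_slice x AE (nonnull_hull m2 mn hphi humb hfull k0)).
by rewrite -/C CA.
Qed.

End classification.

(** * The five values or ranges of the squared mean curvature *)

Section cases.
Variables (R : realType) (m s : nat).
Hypothesis m2 : (2 <= m)%N.
Variable M : pseudoRiemannian R m s.

Lemma negative_mean_curvature (phi : M -> 'rV[R]_m.+2) x :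
  isometric_immersion s.+1 phi -> totally_umbilical s.+1 phi -> full s.+1 phi ->
  pform s.+2 (mean_at s.+1 phi x) (mean_at s.+1 phi x) < 0 ->
  exists A : 'M[R]_m.+2, isometry_mx s.+2 A /\
    exists r : R, 0 < r < 1 /\
      realizes M ((mulmxr A : 'rV[R]_m.+2 -> 'rV[R]_m.+2) @` range phi) (model3 m s m.+1 r).
Proof.
move=> hphi humb hfull; set k := pform _ _ _ => k0.
(* This solves [k = 1 - 1 / r^2], the squared mean curvature of the model of radius [r]. *)
pose r := Num.sqrt (1 - k)^-1.
have k1 : 0 < 1 - k by move: k0; lra.
have r2 : r ^+ 2 = (1 - k)^-1 by rewrite sqr_sqrtr// invr_ge0 ltW.
have r0 : 0 < r by rewrite sqrtr_gt0 invr_gt0.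
have r1 : r ^+ 2 < 1 by rewrite r2 invf_lt1//; move: k0; lra.
pose c := Num.sqrt (1 - r ^+ 2).
have c0 : c != 0 by rewrite lt0r_neq0// sqrtr_gt0 subr_gt0.
have cc : c * c = - k / (1 - k).
  by rewrite -expr2 sqr_sqrtr ?subr_ge0 ?ltW// r2; field; exact: lt0r_neq0.
(* Taking [g = k / c] makes the level [- g c] equal to [- k], and then the norm [- g^2] equals
   [k (1 - k)]. *)
have gc : k / c * c = k by rewrite divfK.
have g0 : k / c != 0 by rewrite mulf_neq0 ?invr_eq0// ltr0_neq0.
have [|||A AE AB] := @nonnull_realizes _ _ _ _ _ m2 M phi hphi humb x (prepend (k / c) 0)
    (model3 m s m.+1 r) (ltnSn m) hfull (ltr0_neq0 k0).
- by rewrite -/k lt_eqF// (lt_trans k0).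
- rewrite -/k pform_prepend pform0l addr0 mulf_div cc.
  by field; rewrite (ltr0_neq0 k0) (lt0r_neq0 k1).
- by rewrite -/k (model3_slice _ _ (ltW r1) g0) -/c gc.
exists A; split=> //; exists r; split=> //.
by rewrite r0 -(ltr_pXn2r (n := 2))// ?nnegrE ?ltW// expr1n.
Qed.

Lemma large_mean_curvature (phi : M -> 'rV[R]_m.+2) x :
  isometric_immersion s phi -> totally_umbilical s phi -> full s phi ->
  1 < pform s.+1 (mean_at s phi x) (mean_at s phi x) ->
  exists A : 'M[R]_m.+2, isometry_mx s.+1 A /\
    exists r : R, 0 < r /\
      realizes M ((mulmxr A : 'rV[R]_m.+2 -> 'rV[R]_m.+2) @` range phi) (model6 m s m.+1 r).
Proof.
move=> hphi humb hfull; set k := pform _ _ _ => k1.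
have k0 : 0 < k by move: k1; lra.
have k2 : 0 < k - 1 by move: k1; lra.
(* For the pseudo-sphere model, [k = 1 + 1 / r^2]. *)
pose r := Num.sqrt (k - 1)^-1.
have r2 : r ^+ 2 = (k - 1)^-1 by rewrite sqr_sqrtr// invr_ge0 ltW.
have r0 : 0 < r by rewrite sqrtr_gt0 invr_gt0.
pose c := Num.sqrt (1 + r ^+ 2).
have c0 : c != 0 by rewrite lt0r_neq0// sqrtr_gt0 addr_gt0// exprn_gt0.
have cc : c * c = k / (k - 1).
  by rewrite -expr2 sqr_sqrtr ?addr_ge0 ?sqr_ge0// r2; field; exact: lt0r_neq0.
have gc : k / c * c = k by rewrite divfK.
have g0 : k / c != 0 by rewrite mulf_neq0 ?invr_eq0// lt0r_neq0.
have [|||A AE AB] := @nonnull_realizes _ _ _ _ _ m2 M phi hphi humb x (prepend (k / c) 0)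
    (model6 m s m.+1 r) (ltnSn m) hfull (lt0r_neq0 k0).
- by rewrite -/k gt_eqF.
- rewrite -/k pform_prepend pform0l addr0 mulf_div cc.
  by field; rewrite (lt0r_neq0 k0) (lt0r_neq0 k2).
- by rewrite -/k (model6_slice _ _ _ g0) -/c gc.
by exists A; split=> //; exists r.
Qed.

Lemma small_mean_curvature (phi : M -> 'rV[R]_m.+2) x :
  isometric_immersion s phi -> totally_umbilical s phi -> full s phi ->
  0 < pform s.+1 (mean_at s phi x) (mean_at s phi x) < 1 ->
  exists A : 'M[R]_m.+2, isometry_mx s.+1 A /\
    exists r : R, 1 < r /\
      realizes M ((mulmxr A : 'rV[R]_m.+2 -> 'rV[R]_m.+2) @` range phi) (model4 m s m.+1 r).
Proof.
move=> hphi humb hfull; set k := pform _ _ _ => /andP[k0 k1].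
have sm := index_le_dim hphi x.
have k2 : 0 < 1 - k by move: k1; lra.
pose r := Num.sqrt (1 - k)^-1.
have r2 : r ^+ 2 = (1 - k)^-1 by rewrite sqr_sqrtr// invr_ge0 ltW.
have r0 : 0 < r by rewrite sqrtr_gt0 invr_gt0.
have r1 : 1 < r ^+ 2 by rewrite r2 invf_gt1//; move: k0; lra.
pose c := Num.sqrt (r ^+ 2 - 1).
have c0 : c != 0 by rewrite lt0r_neq0// sqrtr_gt0 subr_gt0.
have cc : c * c = k / (1 - k).
  by rewrite -expr2 sqr_sqrtr ?subr_ge0 ?ltW// r2; field; exact: lt0r_neq0.
(* The sign differs from the prepended models because the appended coordinate is positive: the level
   is [g c] and the norm [g^2]. *)
have gc : - k / c * c = - k by rewrite divfK.
have g0 : - k / c != 0 by rewrite mulf_neq0 ?invr_eq0// oppr_eq0 lt0r_neq0.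
have [|||A AE AB] := @nonnull_realizes _ _ _ _ _ m2 M phi hphi humb x (append 0 (- k / c))
    (model4 m s m.+1 r) (ltnSn m) hfull (lt0r_neq0 k0).
- by rewrite -/k lt_eqF.
- rewrite -/k pform_append// pform0l add0r mulf_div cc.
  by field; rewrite (lt0r_neq0 k0) (lt0r_neq0 k2).
- by rewrite -/k (model4_slice sm (ltW r1) g0) -/c gc.
exists A; split=> //; exists r; split=> //.
by rewrite -(ltr_pXn2r (n := 2))// ?nnegrE ?ltW// expr1n.
Qed.

Lemma unit_mean_curvature (phi : M -> 'rV[R]_m.+2) x :
  isometric_immersion s phi -> totally_umbilical s phi -> full s phi ->
  pform s.+1 (mean_at s phi x) (mean_at s phi x) = 1 ->
  exists A : 'M[R]_m.+2, isometry_mx s.+1 A /\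
      realizes M ((mulmxr A : 'rV[R]_m.+2 -> 'rV[R]_m.+2) @` range phi) (model7 m s m.+1).
Proof.
move=> hphi humb hfull k1; have sm := index_le_dim hphi x.
(* [C] is null here, so [phi x] and [H x] are moved instead, to the point [f0] of the model at
   parameter 0 and its mean curvature vector [h0]; their sum is the vector defining the slice. *)
pose f0 : 'rV[R]_m.+2 := prepend (5 / 4) (append 0 (3 / 4)).
pose h0 : 'rV[R]_m.+2 := prepend (3 / 4) (append 0 (5 / 4)).
have ff : pform s.+1 f0 f0 = -1 by rewrite pform_prepend pform_append// pform0l; field.
have hh : pform s.+1 h0 h0 = 1 by rewrite pform_prepend pform_append// pform0l; field.
have fh : pform s.+1 f0 h0 = 0 by rewrite pform_prepend pform_append// pform0l; field.
have [||||||A [AE fA hA]] := @isometry_move2 R s.+1 m.+2 (phi x) (mean_at s phi x) f0 h0.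
- by rewrite ff (phi_norm hphi).
- by rewrite hh k1.
- by rewrite ff oppr_eq0 oner_eq0.
- by rewrite hh oner_eq0.
- exact: mean_at_position.
- exact: fh.
exists A; split=> //; have k0 : pform s.+1 (mean_at s phi x) (mean_at s phi x) != 0.
  by rewrite k1 oner_eq0.
apply: (realizes_slice m2 hphi humb x AE (nonnull_hull m2 (ltnSn m) hphi humb hfull k0)).
rewrite k1 scale1r mulmxDl hA fA model7_slice//.
have -> : h0 + f0 = prepend 2 (append 0 2) => //.
apply/rowP => i; rewrite !mxE; case: unliftP => [j _|_] /=; last by field.
by rewrite !mxE; case: unliftP => [j' _|_] /=; [rewrite !mxE addr0|field].
Qed.

Lemma null_mean_curvature (phi : M -> 'rV[R]_m.+3) x D :
  isometric_immersion s.+1 phi -> totally_umbilical s.+1 phi ->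
  let h := mean_at s.+1 phi x in
  pform s.+2 h h = 0 -> pform s.+2 D D = -1 -> pform s.+2 h D = -1 ->
  hull_quadric s.+1 phi = quadric_slice s.+1 D (h - D) 1 (-1) ->
  exists A : 'M[R]_m.+3, isometry_mx s.+2 A /\
      realizes M ((mulmxr A : 'rV[R]_m.+3 -> 'rV[R]_m.+3) @` range phi) (model5 m s m.+2).
Proof.
move=> hphi humb h hh DD hD hE; have sm := index_le_dim hphi x.
(* [d0] and [e0] read the first and last coordinates of the model, with norms and levels equal to
   those of [D] and [h - D]. *)
pose d0 : 'rV[R]_m.+3 := prepend (-1) (append 0 0).
pose e0 : 'rV[R]_m.+3 := prepend 0 (append 0 (-1)).
have dd : pform s.+2 d0 d0 = -1 by rewrite pform_prepend pform_append// pform0l; ring.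
have ee : pform s.+2 e0 e0 = 1 by rewrite pform_prepend pform_append// pform0l; ring.
have de : pform s.+2 d0 e0 = 0 by rewrite pform_prepend pform_append// pform0l; ring.
have [||||||A [AE dA eA]] := @isometry_move2 R s.+2 m.+3 D (h - D) d0 e0.
- by rewrite dd.
- move: h hh hD {hE} => h hh hD.
  by rewrite ee !(pformDl, pformDr, pformNl, pformNr) hh DD hD (pformC _ D) hD; ring.
- by rewrite dd oppr_eq0 oner_eq0.
- by rewrite ee oner_eq0.
- move: h hh hD {hE} => h hh hD.
  by rewrite pformDr pformNr (pformC _ D) hD DD subrr.
- exact: de.
exists A; split=> //; apply: (realizes_slice m2 hphi humb x AE hE).
by rewrite dA eA model5_slice.
Qed.

End cases.

Theorem theorem9 (R : realType) (m s n p : nat)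
    (hm : (2 <= m)%N) (hmn : (m < n)%N) (hp : (p <= n)%N)
    (M : pseudoRiemannian R m s) (phi : M -> 'rV[R]_n.+1)
    (hphi : isometric_immersion p phi)
    (humb : totally_umbilical p phi)
    (hfull : full p phi) :
  exists F : 'rV[R]_n.+1 -> 'rV[R]_n.+1, ambient_isometry p F /\
    let A := F @` range phi in
    (included m.+1 s n p /\ realizes M A (model1 m s n) /\
      totally_geodesic p phi /\
      mean_curvature_satisfies p phi (fun H => H = 0)) \/
    (included m.+1 s.+1 n p /\ realizes M A (model2 m s n) /\
      totally_geodesic p phi /\
      mean_curvature_satisfies p phi (fun H => H = 0)) \/
    (included m.+1 s.+1 n p /\
      (exists r : R, 0 < r < 1 /\ realizes M A (model3 m s n r)) /\
      mean_curvature_satisfies p phi (fun H => pform p.+1 H H < 0)) \/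
    (included m.+1 s n p /\
      (exists r : R, 1 < r /\ realizes M A (model4 m s n r)) /\
      mean_curvature_satisfies p phi (fun H => 0 < pform p.+1 H H < 1)) \/
    (included m.+2 s.+1 n p /\ realizes M A (model5 m s n) /\
      mean_curvature_satisfies p phi
        (fun H => H <> 0 /\ pform p.+1 H H = 0)) \/
    (included m.+1 s n p /\
      (exists r : R, 0 < r /\ realizes M A (model6 m s n r)) /\
      mean_curvature_satisfies p phi (fun H => 1 < pform p.+1 H H)) \/
    (included m.+1 s n p /\ realizes M A (model7 m s n) /\
      mean_curvature_satisfies p phi (fun H => pform p.+1 H H = 1)).
Proof.
have [x] := full_inhabited hfull.
have incl k q : included k q k q by [].
(* The squared mean curvature is constant on [M], so its position relative to 0 and 1 at one point
   selects the model, and [n] and [p] are then determined. *)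
case: (ltgtP (pform p.+1 (mean_at p phi x) (mean_at p phi x)) 0) => k0.
- have n1 := nonnull_codim hm hmn hphi humb hfull (ltr0_neq0 k0).
  have p1 := negative_index hm hmn hp hphi humb hfull k0; subst n p.
  have [A [AE rA]] := negative_mean_curvature hm hphi humb hfull k0.
  exists (mulmxr A); split; first exact: linear_ambient_isometry.
  do 2 right; left; split=> //; split=> //.
  exact: (mean_curvature_satisfies_norm hm hphi humb (P := fun k => k < 0) k0).
- have n1 := nonnull_codim hm hmn hphi humb hfull (lt0r_neq0 k0).
  have p1 := positive_index hm hmn hp hphi humb hfull k0; subst n p.
  case: (ltgtP (pform s.+1 (mean_at s phi x) (mean_at s phi x)) 1) => k1.
  + have k01 : 0 < pform s.+1 (mean_at s phi x) (mean_at s phi x) < 1 by rewrite k0.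
    have [A [AE rA]] := small_mean_curvature hm hphi humb hfull k01.
    exists (mulmxr A); split; first exact: linear_ambient_isometry.
    do 3 right; left; split=> //; split=> //.
    exact: (mean_curvature_satisfies_norm hm hphi humb (P := fun k => 0 < k < 1) k01).
  + have [A [AE rA]] := large_mean_curvature hm hphi humb hfull k1.
    exists (mulmxr A); split; first exact: linear_ambient_isometry.
    do 5 right; left; split=> //; split=> //.
    exact: (mean_curvature_satisfies_norm hm hphi humb (P := fun k => 1 < k) k1).
  + have [A [AE rA]] := unit_mean_curvature hm hphi humb hfull k1.
    exists (mulmxr A); split; first exact: linear_ambient_isometry.
    do 6 right; split=> //; split=> //.
    exact: (mean_curvature_satisfies_norm hm hphi humb (P := fun k => k = 1) k1).
- have [n2 p1 [D [DD hD hE]]] := null_hull hm hmn hp hphi humb hfull k0.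
  have h0 := mean_at_neq0 hm hmn hphi humb hfull k0; subst n p.
  have [A [AE rA]] := null_mean_curvature hm hphi humb k0 DD hD hE.
  exists (mulmxr A); split; first exact: linear_ambient_isometry.
  do 4 right; left; split=> //; split=> // i y iy.
  by rewrite (mean_curvature_null hm hphi humb iy k0); split=> //; exact/eqP.
Qed.
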